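(* Let $N$ be a positive integer and let $s$ be an arbitrary complex number such that $s\neq 1$ and $\Re(s)>1-2N$. Let $a$ be a nonzero complex number. Then $$|R_N(s,a)|\le \frac{|B_{2N}|}{(2N)!}\frac{|(s)_{2N-1}|}{|a|^{2N}}\sup_{r\ge 1}\left|\Pi_{s+2N-1}(2\pi a r)\right|,$$ $$|R_N(s,a)|\le \frac{|B_{2N}|}{(2N)!}\frac{|(s)_{2N-1}|}{|a|^{2N}}\frac{|s+2N-1|}{\Re(s)+2N-1}\sec^{\Re(s)+2N}\Big(\frac{\arg a}{2}\Big)\max\big(1,e^{-\Im(s)\arg a}\big),$$ provided that $|\arg a|<\pi$, and $$|R_N(s,a)|\le \frac{|B_{2N}|}{(2N)!}\frac{|(s)_{2N-1}|}{|a|^{2N}}\left(1+\frac{|s+2N-1|}{\Re(s)+2N-1}\,\chi(\Re(s)+2N-1)\max\big(1,e^{-\Im(s)\arg a}\big)\right),$$ provided that $|\arg a|\le\frac{\pi}{2}$.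
   Context: All complex powers and $\arg$ are taken with their principal values for $|\arg a|<\pi$. $\zeta(s,a)$ is the Hurwitz zeta function: $\zeta(s,a)=\sum_{n=0}^\infty (n+a)^{-s}$ for $\Re(s)>1$, $a\notin\mathbb{Z}_{\le 0}$, continued meromorphically in $s$ (only a simple pole at $s=1$), and, for fixed $s\ne 1$, analytic in $a$ for $|\arg a|<\pi$. $B_{2n}$ are the even-order Bernoulli numbers and $(w)_p=\Gamma(w+p)/\Gamma(w)$ is the Pochhammer symbol (for integer $p\ge1$ it is the polynomial $w(w+1)\cdots(w+p-1)$). For $|\arg a|<\pi$, $s\neq 1$ and a positive integer $N$, the remainder $R_N(s,a)$ is defined by $$\zeta(s,a)=\frac12 a^{-s}+\frac{a^{1-s}}{s-1}+a^{1-s}\left(\sum_{n=1}^{N-1}\frac{B_{2n}}{(2n)!}\frac{(s)_{2n-1}}{a^{2n}}+R_N(s,a)\right),$$ empty sums being zero. The basic terminant is $$\Pi_p(w)=\frac{w^p}{2}\left(e^{\frac{\pi}{2}ip}e^{iw}\,\Gamma(1-p,we^{\frac{\pi}{2}i})+e^{-\frac{\pi}{2}ip}e^{-iw}\,\Gamma(1-p,we^{-\frac{\pi}{2}i})\right),$$ where $\Gamma(1-p,\cdot)$ is the (upper) incomplete gamma function. It is a multivalued function of $w$ (a function on the Riemann surface of the logarithm, with $\arg(we^{\pm\frac{\pi}{2}i})=\arg w\pm\frac{\pi}{2}$ and the incomplete gamma function continued analytically from its principal branch), and for fixed $w$ it is entire in $p$. For $\Re(p)>0$, $\chi(p)=\pi^{1/2}\,\Gamma\left(\frac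 p2+1\right)/\Gamma\left(\frac p2+\frac12\right)$. *)

(* Defs.v *)
From Stdlib Require Import Reals Lra Lia Arith Factorial ClassicalEpsilon.
From Coquelicot Require Import Coquelicot.

Local Open Scope R_scope.

(** * Elementary complex functions, principal values *)

Definition Cexp (z : C) : C := (exp (Re z) * cos (Im z), exp (Re z) * sin (Im z)).

Definition Carg (z : C) : R :=
  if Rle_dec 0 (Im z) then acos (Re z / Cmod z) else - acos (Re z / Cmod z).

Definition Clog (z : C) : C := (ln (Cmod z), Carg z).

Definition Cpower (z w : C) : C := Cexp (w * Clog z)%C.

Lemma Re_div_Cmod_bounds (z : C) : z <> 0 -> -1 <= Re z / Cmod z <= 1.
Proof.
intros Hz; apply Cmod_gt_0 in Hz.
apply Rabs_le_between; unfold Rdiv.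
rewrite Rabs_mult, (Rabs_pos_eq (/ _)) by (left; now apply Rinv_0_lt_compat).
apply Rmult_le_reg_r with (Cmod z); [easy|].
rewrite Rmult_assoc, Rinv_l, Rmult_1_r, Rmult_1_l by lra.
apply re_le_Cmod.
Qed.

Lemma Carg_bounds (z : C) : z <> 0 -> - PI < Carg z <= PI.
Proof.
intros Hz; pose proof (Re_div_Cmod_bounds z Hz) as Hb.
apply Cmod_gt_0 in Hz.
pose proof (acos_bound (Re z / Cmod z)) as Ha; unfold Carg.
destruct Rle_dec as [Hi|Hi]; [pose proof PI_RGT_0; lra|].
destruct (Req_dec (acos (Re z / Cmod z)) PI) as [He|He]; [|lra].
apply (f_equal cos) in He; rewrite cos_acos, cos_PI in He by lra.
assert (Hr : Re z = - Cmod z).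
{ replace (Re z) with (Re z / Cmod z * Cmod z) by (field; lra); rewrite He; ring. }
pose proof (Cmod2_alt z) as H2; rewrite Hr in H2; nra.
Qed.

Lemma Cexp_Clog (z : C) : z <> 0 -> Cexp (Clog z) = z.
Proof.
intros Hz; pose proof (Re_div_Cmod_bounds z Hz) as Hb.
apply Cmod_gt_0 in Hz.
assert (Hs : Cmod z * sqrt (1 - (Re z / Cmod z)²) = Rabs (Im z)).
{ rewrite <- sqrt_Rsqr_abs, <- (sqrt_pow2 (Cmod z)) at 1 by lra.
  rewrite <- sqrt_mult_alt by apply pow2_ge_0; f_equal.
  replace (Cmod z ^ 2 * (1 - (Re z / Cmod z)²)) with (Cmod z ^ 2 - Re z ^ 2)
    by (unfold Rsqr; field; lra).
  rewrite Cmod2_alt; unfold Rsqr; ring. }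
unfold Cexp, Clog, Carg; simpl Re; simpl Im; rewrite exp_ln by easy.
destruct z as [x y]; simpl Re in *; simpl Im in *.
destruct Rle_dec as [Hi|Hi]; f_equal;
  rewrite ?cos_neg, ?sin_neg, ?cos_acos, ?sin_acos by lra; try (field; lra).
- rewrite Hs; now apply Rabs_pos_eq.
- rewrite Ropp_mult_distr_r_reverse, Hs, Rabs_left by lra; ring.
Qed.

Lemma Cexp_neq_0 (z : C) : Cexp z <> 0.
Proof.
intros H; injection H as H1 H2; pose proof (exp_pos (Re z)).
pose proof (sin2_cos2 (Im z)) as H3; unfold Rsqr in H3; nra.
Qed.

(** The Euler integral converges only for [0 < x], the only use made of it. *)
Definition Gamma (x : R) : R :=
  RInt_gen (fun t => Rpower t (x - 1) * exp (- t)) (at_right 0) (Rbar_locally p_infty).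

Fixpoint Cpochhammer (w : C) (p : nat) : C :=
  match p with
  | O => 1
  | S q => Cpochhammer w q * (w + INR q)
  end%C.

(** [bernoulli_upto n] tabulates B_0, ..., B_n; see [bernoulli_rec]. *)
Fixpoint bernoulli_upto (n : nat) : nat -> R :=
  match n with
  | O => fun _ => 1
  | S m => fun k =>
      if Nat.eqb k (S m)
      then - sum_f_R0 (fun j => Binomial.C (S (S m)) j * bernoulli_upto m j) m
             / INR (S (S m))
      else bernoulli_upto m k
  end.

Definition bernoulli (n : nat) : R := bernoulli_upto n n.

Lemma bernoulli_upto_eq (n k : nat) : (k <= n)%nat -> bernoulli_upto n k = bernoulli k.
Proof.
induction n as [|n IH]; intros Hk.
- now replace k with O by lia.
- destruct (Nat.eq_dec k (S n)) as [->|Hne]; [reflexivity|].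
  simpl; destruct (Nat.eqb_spec k (S n)); [easy|]; apply IH; lia.
Qed.

Lemma bernoulli_rec (n : nat) : (1 <= n)%nat ->
  sum_f_R0 (fun k => Binomial.C (S n) k * bernoulli k) n = 0.
Proof.
destruct n as [|n]; intros Hn; [lia|].
rewrite tech5; unfold bernoulli at 2; cbn [bernoulli_upto]; rewrite Nat.eqb_refl.
rewrite (sum_eq _ (fun j => Binomial.C (S (S n)) j * bernoulli_upto n j))
  by (intros; now rewrite bernoulli_upto_eq).
replace (Binomial.C (S (S n)) (S n)) with (INR (S (S n))).
- field; apply not_0_INR; lia.
- unfold Binomial.C; replace (S (S n) - S n)%nat with 1%nat by lia.
  change (fact (S (S n))) with (S (S n) * fact (S n))%nat; rewrite mult_INR.
  change (INR (fact 1)) with 1; field; apply INR_fact_neq_0.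
Qed.

(** * The Hurwitz zeta function *)

(** For fixed [a], [f] is the continuation in [s] of the Hurwitz series to the
    punctured plane; this determines [f] except at [s = 1]. *)
Definition is_hurwitz_zeta (a : C) (f : C -> C) : Prop :=
  (forall s : C, 1 < Re s ->
     is_series (fun n : nat => Cpower (INR n + a) (- s)) (f s)) /\
  (forall s : C, s <> 1 -> ex_derive f s).

Definition hurwitz_zeta (s a : C) : C :=
  epsilon (inhabits (fun _ : C => RtoC 0)) (is_hurwitz_zeta a) s.

(** Solved from its defining equation, [hurwitz_remainder_def] below. *)
Definition hurwitz_remainder (N : nat) (s a : C) : C :=
  ((hurwitz_zeta s a - / 2 * Cpower a (- s) - Cpower a (1 - s) / (s - 1))
     / Cpower a (1 - s)
   - sum_n_m (fun n : nat =>
       bernoulli (2 * n) / INR (fact (2 * n))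
       * (Cpochhammer s (2 * n - 1) / a ^ (2 * n)))%C 1 (N - 1))%C.

Lemma hurwitz_remainder_def (N : nat) (s a : C) :
  hurwitz_zeta s a =
    (/ 2 * Cpower a (- s) + Cpower a (1 - s) / (s - 1)
     + Cpower a (1 - s)
       * (sum_n_m (fun n : nat =>
            bernoulli (2 * n) / INR (fact (2 * n))
            * (Cpochhammer s (2 * n - 1) / a ^ (2 * n)))%C 1 (N - 1)
          + hurwitz_remainder N s a))%C.
Proof.
assert (H0 : Cpower a (1 - s) <> 0) by apply Cexp_neq_0.
unfold hurwitz_remainder; set (S := sum_n_m _ _ _); set (P := Cpower a (1 - s)) in *.
unfold Cdiv; set (u := Cinv (s - 1)).
replace (S + _)%C with ((hurwitz_zeta s a - / 2 * Cpower a (- s) - P * u) * / P)%C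
  by ring.
field; exact H0.
Qed.

(** * The incomplete gamma function and the basic terminant *)

(** A point of the Riemann surface of the logarithm is given by its logarithm
    [l], so that multiplication by e^(i t) is [l + i t].  On the principal sheet
    Gamma(alpha, z) is the integral of t^(alpha-1) e^(-t) along the ray from z to
    z + oo, which does not meet the cut when z is off it. *)
Definition is_incomplete_gamma (alpha : C) (f : C -> C) : Prop :=
  (forall l : C, Rabs (Im l) < PI ->
     is_RInt_gen (V := C_R_NormedModule)
       (fun t : R => Cpower (Cexp l + t) (alpha - 1) * Cexp (- (Cexp l + t)))%C
       (at_point 0) (Rbar_locally p_infty) (f l)) /\
  (forall l : C, ex_derive f l).

Definition incomplete_gamma (alpha l : C) : C :=
  epsilon (inhabits (fun _ : C => RtoC 0)) (is_incomplete_gamma alpha) l.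

(** [terminant p l] is Pi_p at the point [w] of the surface with log w = [l]. *)
Definition terminant (p l : C) : C :=
  (Cexp (p * l) / 2 *
    (Cexp (PI / 2 * Ci * p) * Cexp (Ci * Cexp l)
       * incomplete_gamma (1 - p) (l + PI / 2 * Ci)
     + Cexp (- (PI / 2 * Ci * p)) * Cexp (- (Ci * Cexp l))
       * incomplete_gamma (1 - p) (l - PI / 2 * Ci)))%C.

(** Needed at positive real arguments only. *)
Definition chi (p : R) : R :=
  sqrt PI * Gamma (p / 2 + 1) / Gamma (p / 2 + / 2).

(* Main.v *)
Require Import Defs.
From Stdlib Require Import Reals Lra Lia Arith ZArith Factorial Classical ClassicalEpsilon.
From Coquelicot Require Import Coquelicot.

(** The remainder is a weighted average of terminants, and each of the three bounds holds for
    every terminant in the average. Put p = s + 2N - 1, w = 2 pi k and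
<<
    J_k = integral over x > 0 of (1 - cos(w x)) (x + a)^(-p-1) dx   (k >= 1),
>>
    which converges because Re p > 0. The two facts that carry the proof are
<<
    Pi_p(2 pi a k) = p a^p J_k,
    R_N(s,a) = (-1)^(N+1) (s)_(2N-1) a^(-2N) sum_k 2/(2 pi k)^(2N) p a^p J_k.
>>
    Since the weights sum to |B_2N|/(2N)!, a bound for all |p a^p J_k| is a bound for R_N
    ([remainder_bound]). With the first fact this is the bound by the supremum of the
    terminant at the integers r = k. In the other two bounds J_k is estimated directly, the
    factor max(1, e^(-Im s arg a)) coming from the fact that the argument of x + a decreases
    from arg a to 0 in absolute value. In the sector, |x + a| >= (x + |a|) cos(arg a / 2)
    reduces the question to positive a and p, where two integrations by parts produce a
    discarded term of constant sign ([terminant_partial_sector]). In the right half-plane the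
    constant part of the kernel contributes exactly 1 to p a^p J_k, and in the cosine part
    |x + a|^2 >= x^2 + |a|^2 leaves the integral of (1 + y^2)^(-(q+1)/2), q = Re p, which is at
    most chi(q)/q ([beta_int_le_chi]), as the comparison of two solutions of one recurrence in
    q shows in the limit q -> oo.

    The terminant ([terminant_osc_integral]). In the logarithmic variable l the function
    Gamma(1-p, e^l) has the entire derivative -exp((1-p) l - e^l). Starting from the points
    log(2 pi a k) +- i pi/2, which may lie off the principal sheet, and moving a to x + a, the
    two incomplete gamma functions run into the principal sheet and tend to 0; their combined
    derivative is a sine integrand, and an integration by parts gives J_k.

    The remainder ([hurwitz_remainder_osc]). For Re s > 1 and N = 1 the formula is the
    Euler-Maclaurin formula with kernel x(1 - x)/2 on [0,1], expanded in its Fourier series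
    ([saw_fourier], [em_value_series]). Two integrations by parts in J_k relate the expressions
    of orders N and N + 1, because B_2N/(2N)! is (-1)^(N+1) times the sum of the weights
    ([bernoulli_zeta], [em_value_S]). Each expression is holomorphic for Re s > 1 - 2N, s <> 1,
    so together they continue the zeta function.

    Both the zeta function and the incomplete gamma function are characterized by a domain on
    which they are given and by complex differentiability elsewhere, so identity theorems are
    needed for functions that are only known to be differentiable ([identity_strip],
    [identity_punctured]). They follow from Cauchy's theorem for rectangles ([Goursat]): in the
    coordinate z + e^w it yields the maximum principle on circles, and multiplication by
    exponentials of a quadratic polynomial then pushes the set of zeros across a line. *)

Local Open Scope R_scope.

(** * Derivatives of complex functions *)

(** [Rderiv] is the derivative along a real parameter, [Cderiv] the complex derivative. *)
Definition Rderiv (f : R -> C) (x : R) (l : C) : Prop := @is_derive R_AbsRing C_R_NormedModule f x l.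
Definition Cderiv (f : C -> C) (z l : C) : Prop := @is_derive C_AbsRing C_NormedModule f z l.

Lemma Cmod_triangle' x y z : Cmod (x - z) <= Cmod (x - y) + Cmod (y - z).
Proof.
replace (x - z)%C with ((x - y) + (y - z))%C by ring; apply Cmod_triangle.
Qed.

Lemma Cmod_sub_sym x y : Cmod (x - y) = Cmod (y - x).
Proof. rewrite <- Cmod_opp; f_equal; ring. Qed.

Lemma im_le_Cmod z : Rabs (Im z) <= Cmod z.
Proof.
rewrite <- (Rabs_pos_eq (Cmod z)) by apply Cmod_ge_0.
apply Rsqr_le_abs_0; rewrite !Rsqr_pow2, Cmod2_alt; pose proof (pow2_ge_0 (Re z)); lra.
Qed.

Lemma Cderiv_eps (f : C -> C) (z l : C) :
  Cderiv f z l <->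
  forall eps, 0 < eps -> exists d, 0 < d /\ forall y, Cmod (y - z) < d ->
    Cmod (f y - f z - (y - z) * l) <= eps * Cmod (y - z).
Proof.
split.
- intros [_ H] eps He.
  destruct (H z (fun P HP => HP) (mkposreal eps He)) as [d Hd].
  exists d; split; [apply cond_pos|]; intros y Hy; apply Hd.
  exact Hy.
- intros H; split; [apply is_linear_scal_l|].
  intros x Hx eps.
  apply (@is_filter_lim_locally_unique C_AbsRing (AbsRing_NormedModule C_AbsRing)) in Hx; subst x.
  destruct (H eps (cond_pos eps)) as [d [Hd1 Hd2]].
  exists (mkposreal d Hd1); intros y Hy; apply Hd2; exact Hy.
Qed.

Lemma Rderiv_eps (f : R -> C) (z : R) (l : C) :
  Rderiv f z l <->
  forall eps, 0 < eps -> exists d, 0 < d /\ forall y, Rabs (y - z) < d ->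
    Cmod (f y - f z - (y - z) * l) <= eps * Rabs (y - z).
Proof.
assert (Hs : forall y, @scal R_AbsRing C_R_NormedModule (y - z) l = ((y - z) * l)%C).
{ intros y; rewrite <- RtoC_minus; apply scal_R_Cmult. }
split.
- intros [_ H] eps He.
  destruct (H z (fun P HP => HP) (mkposreal eps He)) as [d Hd].
  exists d; split; [apply cond_pos|]; intros y Hy; rewrite <- Hs, Cmod_norm; apply Hd.
  exact Hy.
- intros H; split; [apply is_linear_scal_l|].
  intros x Hx eps.
  apply (@is_filter_lim_locally_unique R_AbsRing (AbsRing_NormedModule R_AbsRing)) in Hx; subst x.
  destruct (H eps (cond_pos eps)) as [d [Hd1 Hd2]].
  exists (mkposreal d Hd1); intros y Hy.
  specialize (Hd2 y Hy); rewrite <- Hs, Cmod_norm in Hd2; exact Hd2.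
Qed.

Lemma Rderiv_pair (f : R -> C) (x : R) (l : C) :
  is_derive (fun t => Re (f t)) x (Re l) -> is_derive (fun t => Im (f t)) x (Im l) ->
  Rderiv f x l.
Proof.
intros H1 H2; apply Rderiv_eps; intros eps He.
destruct H1 as [_ H1]; destruct H2 as [_ H2].
assert (He2 : 0 < eps / 2) by lra.
destruct (H1 x (fun P HP => HP) (mkposreal _ He2)) as [d1 Hd1].
destruct (H2 x (fun P HP => HP) (mkposreal _ He2)) as [d2 Hd2].
exists (Rmin d1 d2); split; [apply Rmin_pos; apply cond_pos|].
intros y Hy.
specialize (Hd1 y (Rlt_le_trans _ _ _ Hy (Rmin_l _ _))).
specialize (Hd2 y (Rlt_le_trans _ _ _ Hy (Rmin_r _ _))).
change (Rabs ((Re (f y) - Re (f x)) - (y - x) * Re l) <= eps / 2 * Rabs (y - x)) in Hd1.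
change (Rabs ((Im (f y) - Im (f x)) - (y - x) * Im l) <= eps / 2 * Rabs (y - x)) in Hd2.
rewrite <- RtoC_minus.
set (w := (f y - f x - (y - x)%R * l)%C).
assert (Hw : w = (RtoC (Re w) + Ci * RtoC (Im w))%C) by
  (destruct w; unfold Cplus, Cmult, Ci, RtoC; simpl; f_equal; ring).
rewrite Hw; eapply Rle_trans; [apply Cmod_triangle|].
rewrite Cmod_mult, !Cmod_R, Cmod_Ci.
replace (Re w) with (Re (f y) - Re (f x) - (y - x) * Re l) by (unfold w; destruct (f y), (f x), l; simpl; ring).
replace (Im w) with (Im (f y) - Im (f x) - (y - x) * Im l) by (unfold w; destruct (f y), (f x), l; simpl; ring).
lra.
Qed.

Lemma Rderiv_comp_re (f : R -> C) (x : R) (l : C) (u : C) : Rderiv f x l ->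
  is_derive (fun t => Re (u * f t)) x (Re (u * l)).
Proof.
intros H; rewrite Rderiv_eps in H; split; [apply is_linear_scal_l|].
intros y Hy eps.
apply (@is_filter_lim_locally_unique R_AbsRing (AbsRing_NormedModule R_AbsRing)) in Hy; subst y.
assert (Hp : 0 < eps / (Cmod u + 1)).
{ apply Rdiv_lt_0_compat; [apply cond_pos|]; pose proof (Cmod_ge_0 u); lra. }
destruct (H _ Hp) as [d [Hd1 Hd2]].
exists (mkposreal d Hd1); intros y Hy.
specialize (Hd2 y Hy).
change (Rabs (Re (u * f y) - Re (u * f x) - (y - x) * Re (u * l)) <= eps * Rabs (y - x)).
replace (Re (u * f y) - Re (u * f x) - (y - x) * Re (u * l)) with
  (Re (u * (f y - f x - (y - x) * l))) by
  (destruct (f y), (f x), l, u; simpl; ring).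
eapply Rle_trans; [apply re_le_Cmod|]; rewrite Cmod_mult.
pose proof (Cmod_ge_0 u).
eapply Rle_trans; [apply Rmult_le_compat_l; [easy|exact Hd2]|].
replace (Cmod u * (eps / (Cmod u + 1) * Rabs (y - x))) with
  ((eps * Rabs (y-x)) * (Cmod u / (Cmod u + 1))) by (field; lra).
rewrite <- (Rmult_1_r (eps * Rabs (y-x))) at 2.
apply Rmult_le_compat_l.
- apply Rmult_le_pos; [left; apply cond_pos | apply Rabs_pos].
- apply Rmult_le_reg_r with (Cmod u + 1); [lra|]; field_simplify; lra.
Qed.

Lemma Rderiv_Re (f : R -> C) (x : R) (l : C) : Rderiv f x l ->
  is_derive (fun t => Re (f t)) x (Re l).
Proof.
intros H; apply (Rderiv_comp_re f x l 1) in H; rewrite Cmult_1_l in H.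
eapply is_derive_ext; [|exact H]; intros t; cbv beta; now rewrite Cmult_1_l.
Qed.

Lemma Rderiv_Im (f : R -> C) (x : R) (l : C) : Rderiv f x l ->
  is_derive (fun t => Im (f t)) x (Im l).
Proof.
intros H; apply (Rderiv_comp_re f x l (-Ci)) in H.
replace (Im l) with (Re (- Ci * l)) by (destruct l; simpl; ring).
eapply is_derive_ext; [|exact H]; intros t; cbv beta; destruct (f t); simpl; match goal with |- @eq _ ?u ?v => change (@eq R u v) end; ring.
Qed.

Lemma Rderiv_const (c : C) x : Rderiv (fun _ => c) x 0.
Proof. exact (is_derive_const (V:=C_R_NormedModule) c x). Qed.

Lemma Rderiv_eq f x l l' : Rderiv f x l -> l = l' -> Rderiv f x l'.
Proof. now intros H <-. Qed.

Lemma Rderiv_plus f g x lf lg : Rderiv f x lf -> Rderiv g x lg ->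
  Rderiv (fun t => f t + g t)%C x (lf + lg)%C.
Proof. exact (is_derive_plus (V:=C_R_NormedModule) f g x lf lg). Qed.

Lemma Rderiv_minus f g x lf lg : Rderiv f x lf -> Rderiv g x lg ->
  Rderiv (fun t => f t - g t)%C x (lf - lg)%C.
Proof. exact (is_derive_minus (V:=C_R_NormedModule) f g x lf lg). Qed.

Lemma Rderiv_opp f x lf : Rderiv f x lf -> Rderiv (fun t => - f t)%C x (- lf)%C.
Proof. exact (is_derive_opp (V:=C_R_NormedModule) f x lf). Qed.

Lemma Rderiv_mult f g x lf lg : Rderiv f x lf -> Rderiv g x lg ->
  Rderiv (fun t => f t * g t)%C x (lf * g x + f x * lg)%C.
Proof.
intros Hf Hg.
pose proof (Rderiv_Re _ _ _ Hf) as F1; pose proof (Rderiv_Im _ _ _ Hf) as F2.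
pose proof (Rderiv_Re _ _ _ Hg) as G1; pose proof (Rderiv_Im _ _ _ Hg) as G2.
apply Rderiv_pair.
- apply (is_derive_ext (fun t => Re (f t) * Re (g t) - Im (f t) * Im (g t))).
  { intros t; now rewrite re_mult. }
  replace (Re _) with (minus (plus (mult (Re lf) (Re (g x))) (mult (Re (f x)) (Re lg)))
    (plus (mult (Im lf) (Im (g x))) (mult (Im (f x)) (Im lg)))).
  + apply @is_derive_minus; apply @is_derive_mult; try easy; exact Rmult_comm.
  + rewrite re_plus, !re_mult; unfold minus, plus, opp, mult; simpl; ring.
- apply (is_derive_ext (fun t => Re (f t) * Im (g t) + Im (f t) * Re (g t))).
  { intros t; now rewrite im_mult. }
  replace (Im _) with (plus (plus (mult (Re lf) (Im (g x))) (mult (Re (f x)) (Im lg)))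
    (plus (mult (Im lf) (Re (g x))) (mult (Im (f x)) (Re lg)))).
  + apply @is_derive_plus; apply @is_derive_mult; try easy; exact Rmult_comm.
  + rewrite im_plus, !im_mult; unfold minus, plus, opp, mult; simpl; ring.
Qed.

Lemma Rderiv_RtoC (f : R -> R) x l : is_derive f x l -> Rderiv (fun t => RtoC (f t)) x (RtoC l).
Proof. intros H; apply Rderiv_pair; simpl; [exact H|exact (is_derive_const (V:=R_NormedModule) 0 x)]. Qed.

Lemma Rderiv_scal (c : C) f x l : Rderiv f x l -> Rderiv (fun t => c * f t)%C x (c * l)%C.
Proof.
intros H; eapply Rderiv_eq; [exact (Rderiv_mult _ _ _ _ _ (Rderiv_const c x) H)|].
simpl; ring.
Qed.

Lemma Rderiv_ext (f g : R -> C) x l : (forall t, f t = g t) -> Rderiv f x l -> Rderiv g x l.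
Proof. exact (is_derive_ext f g x l). Qed.

Lemma Cderiv_Rderiv_comp (f : C -> C) (g : R -> C) x l m :
  Cderiv f (g x) l -> Rderiv g x m -> Rderiv (fun t => f (g t)) x (l * m)%C.
Proof.
intros Hf Hg; rewrite Cderiv_eps in Hf; rewrite Rderiv_eps in Hg; apply Rderiv_eps.
intros eps He.
pose proof (Cmod_ge_0 l) as Hl; pose proof (Cmod_ge_0 m) as Hm.
set (e2 := eps / (2 * (Cmod l + 1))).
assert (He2 : 0 < e2) by (apply Rdiv_lt_0_compat; lra).
set (e1 := eps / (2 * (Cmod m + e2 + 1))).
assert (He1 : 0 < e1) by (apply Rdiv_lt_0_compat; lra).
destruct (Hf e1 He1) as [d1 [P1 H1]].
destruct (Hg e2 He2) as [d2 [P2 H2]].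
assert (P3 : 0 < d1 / (Cmod m + e2 + 1)) by (apply Rdiv_lt_0_compat; lra).
exists (Rmin d2 (d1 / (Cmod m + e2 + 1))); split; [now apply Rmin_pos|].
intros y Hy.
specialize (H2 y (Rlt_le_trans _ _ _ Hy (Rmin_l _ _))).
assert (Hy' := Rlt_le_trans _ _ _ Hy (Rmin_r _ _)).
pose proof (Rabs_pos (y - x)) as Ha.
assert (Hgy : Cmod (g y - g x) <= (Cmod m + e2) * Rabs (y - x)).
{ replace (g y - g x)%C with ((g y - g x - (y - x) * m) + (y - x) * m)%C by ring.
  eapply Rle_trans; [apply Cmod_triangle|].
  rewrite Cmod_mult, <- RtoC_minus, Cmod_R; rewrite <- RtoC_minus in H2; lra. }
assert (Hgy1 : Cmod (g y - g x) < d1).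
{ eapply Rle_lt_trans; [exact Hgy|].
  apply Rle_lt_trans with ((Cmod m + e2 + 1) * Rabs (y - x)); [nra|].
  apply (Rmult_lt_compat_l (Cmod m + e2 + 1)) in Hy'; [|lra].
  replace d1 with ((Cmod m + e2 + 1) * (d1 / (Cmod m + e2 + 1))) by (field; lra); lra. }
specialize (H1 (g y) Hgy1).
replace (f (g y) - f (g x) - (y - x) * (l * m))%C with
  ((f (g y) - f (g x) - (g y - g x) * l) + l * (g y - g x - (y - x) * m))%C by ring.
eapply Rle_trans; [apply Cmod_triangle|]; rewrite Cmod_mult.
assert (A1 : e1 * Cmod (g y - g x) <= eps / 2 * Rabs (y - x)).
{ eapply Rle_trans; [apply Rmult_le_compat_l; [lra|exact Hgy]|].
  rewrite <- Rmult_assoc; apply Rmult_le_compat_r; [easy|].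
  replace (eps / 2) with (e1 * (Cmod m + e2 + 1)) by (unfold e1; field; lra); nra. }
assert (A2 : Cmod l * Cmod (g y - g x - (y - x) * m) <= eps / 2 * Rabs (y - x)).
{ eapply Rle_trans; [apply Rmult_le_compat_l; [lra|exact H2]|].
  rewrite <- Rmult_assoc; apply Rmult_le_compat_r; [easy|].
  replace (eps / 2) with ((Cmod l + 1) * e2) by (unfold e2; field; lra); nra. }
lra.
Qed.

Lemma Cderiv_eq f x l l' : Cderiv f x l -> l = l' -> Cderiv f x l'.
Proof. now intros H <-. Qed.

Lemma Cderiv_ext (f g : C -> C) x l : (forall t, f t = g t) -> Cderiv f x l -> Cderiv g x l.
Proof. exact (is_derive_ext f g x l). Qed.

Lemma Cderiv_const (c z : C) : Cderiv (fun _ => c) z 0.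
Proof. exact (is_derive_const (K:=C_AbsRing) (V:=C_NormedModule) c z). Qed.

(** The field of complex numbers carries two normed-module structures over itself, as a
    product and as a ring; they have the same norm. *)
Lemma Cderiv_ring (f : C -> C) (z l : C) :
  @is_derive C_AbsRing (AbsRing_NormedModule C_AbsRing) f z l <-> Cderiv f z l.
Proof.
split; intros [_ H]; (split; [apply is_linear_scal_l|exact H]).
Qed.

Lemma Cderiv_id z : Cderiv (fun w => w) z 1.
Proof. apply Cderiv_ring; exact (is_derive_id (K:=C_AbsRing) z). Qed.

Lemma Cderiv_plus f g x lf lg : Cderiv f x lf -> Cderiv g x lg ->
  Cderiv (fun t => f t + g t)%C x (lf + lg)%C.
Proof. exact (is_derive_plus (V:=C_NormedModule) f g x lf lg). Qed.

Lemma Cderiv_minus f g x lf lg : Cderiv f x lf -> Cderiv g x lg ->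
  Cderiv (fun t => f t - g t)%C x (lf - lg)%C.
Proof. exact (is_derive_minus (V:=C_NormedModule) f g x lf lg). Qed.

Lemma Cderiv_opp f x lf : Cderiv f x lf -> Cderiv (fun t => - f t)%C x (- lf)%C.
Proof. exact (is_derive_opp (V:=C_NormedModule) f x lf). Qed.

Lemma Cderiv_mult f g x lf lg : Cderiv f x lf -> Cderiv g x lg ->
  Cderiv (fun t => f t * g t)%C x (lf * g x + f x * lg)%C.
Proof.
intros Hf Hg; apply Cderiv_ring in Hf; apply Cderiv_ring in Hg; apply Cderiv_ring.
exact (is_derive_mult (K:=C_AbsRing) f g x lf lg Hf Hg Cmult_comm).
Qed.

Lemma Cderiv_comp f g x lf lg : Cderiv f (g x) lf -> Cderiv g x lg ->
  Cderiv (fun t => f (g t)) x (lg * lf)%C.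
Proof.
intros Hf Hg; apply Cderiv_ring in Hg.
exact (is_derive_comp (K:=C_AbsRing) (V:=C_NormedModule) f g x lf lg Hf Hg).
Qed.

Lemma Cderiv_scal (c : C) f x l : Cderiv f x l -> Cderiv (fun t => c * f t)%C x (c * l)%C.
Proof.
intros H; eapply Cderiv_eq; [exact (Cderiv_mult _ _ _ _ _ (Cderiv_const c x) H)|].
cbv beta; ring.
Qed.

(** 1/y - 1/z + (y-z)/z^2 = (y-z)^2 / (y z^2), and |y| >= |z|/2 for y near z. *)
Lemma Cderiv_inv (z : C) : z <> 0 -> Cderiv Cinv z (- / (z * z))%C.
Proof.
intros Hz; assert (Hz' := proj1 (Cmod_gt_0 z) Hz); apply Cderiv_eps; intros eps He.
set (m := Cmod z) in *.
assert (P : 0 < eps * m ^ 3 / 2).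
{ pose proof (pow_lt m 3 Hz'); nra. }
exists (Rmin (m / 2) (eps * m ^ 3 / 2)); split; [apply Rmin_pos; lra|].
intros y Hy.
assert (Hy1 := Rlt_le_trans _ _ _ Hy (Rmin_l _ _)).
assert (Hy2 := Rlt_le_trans _ _ _ Hy (Rmin_r _ _)).
assert (Hym : m / 2 < Cmod y).
{ assert (T : Cmod z <= Cmod (y - z) + Cmod y).
  { rewrite Cmod_sub_sym; replace z with ((z - y) + y)%C at 1 by ring; apply Cmod_triangle. }
  fold m in T; lra. }
assert (Hy0 : y <> 0) by (apply Cmod_gt_0; lra).
replace (/ y - / z - (y - z) * - / (z * z))%C with ((y - z) * (y - z) / (y * (z * z)))%C
  by (field; auto).
assert (Hd : (y * (z * z))%C <> 0) by (repeat apply Cmult_neq_0; auto).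
rewrite Cmod_div, !Cmod_mult by easy; fold m.
pose proof (Cmod_ge_0 (y - z)) as Hp.
assert (Hq : 0 < Cmod y * (m * m)) by (repeat apply Rmult_lt_0_compat; lra).
apply Rmult_le_reg_r with (Cmod y * (m * m)); [easy|].
unfold Rdiv; rewrite Rmult_assoc, Rinv_l, Rmult_1_r by lra.
rewrite (Rmult_comm eps), Rmult_assoc; apply Rmult_le_compat_l; [easy|].
apply Rle_trans with (eps * m ^ 3 / 2); [lra|].
replace (eps * m ^ 3 / 2) with (eps * (m / 2 * (m * m))) by field.
apply Rmult_le_compat_l; [lra|]; apply Rmult_le_compat_r; nra.
Qed.

Lemma Cderiv_cont (f : C -> C) z l : Cderiv f z l ->
  forall eps, 0 < eps -> exists d, 0 < d /\ forall y, Cmod (y - z) < d -> Cmod (f y - f z) < eps.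
Proof.
intros H eps He; rewrite Cderiv_eps in H.
destruct (H 1 Rlt_0_1) as [d [Hd H1]].
pose proof (Cmod_ge_0 l).
assert (P : 0 < eps / (Cmod l + 2)) by (apply Rdiv_lt_0_compat; lra).
exists (Rmin d (eps / (Cmod l + 2))); split; [now apply Rmin_pos|].
intros y Hy.
specialize (H1 y (Rlt_le_trans _ _ _ Hy (Rmin_l _ _))).
assert (Hy2 := Rlt_le_trans _ _ _ Hy (Rmin_r _ _)).
replace (f y - f z)%C with ((f y - f z - (y - z) * l) + (y - z) * l)%C by ring.
eapply Rle_lt_trans; [apply Cmod_triangle|]; rewrite Cmod_mult.
apply (Rmult_lt_compat_l (Cmod l + 2)) in Hy2; [|lra].
replace ((Cmod l + 2) * (eps / (Cmod l + 2))) with eps in Hy2 by (field; lra).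
pose proof (Cmod_ge_0 (y - z)); nra.
Qed.

Lemma Rderiv_continuous f x l : Rderiv f x l -> continuous (T:=R_UniformSpace) (U:=C_UniformSpace) f x.
Proof.
intros H; apply (ex_derive_continuous (K:=R_AbsRing) (V:=C_R_NormedModule)); now exists l.
Qed.

(** A norm of an increment is attained by a real linear functional, which reduces the
    comparison to the real mean value theorem. *)
Lemma increment_dominated (f df : R -> C) (B dB : R -> R) x y : x <= y ->
  (forall t, x <= t <= y -> Rderiv f t (df t)) ->
  (forall t, x <= t <= y -> is_derive B t (dB t)) ->
  (forall t, x <= t <= y -> Cmod (df t) <= dB t) ->
  Cmod (f y - f x) <= B y - B x.
Proof.
intros Hxy Hf HB Hd.
destruct (Ceq_dec (f y - f x) 0) as [E|E].
{ rewrite E, Cmod_0.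
  destruct (MVT_gen (fun t => B t) x y dB) as [c [Hc1 Hc2]].
  - rewrite Rmin_left, Rmax_right by easy; intros t Ht; apply HB; lra.
  - rewrite Rmin_left, Rmax_right by easy; intros t Ht.
    apply continuity_pt_filterlim.
    apply (ex_derive_continuous B); exists (dB t); now apply HB.
  - rewrite Rmin_left, Rmax_right in Hc1 by easy; rewrite Hc2.
    pose proof (Cmod_ge_0 (df c)); specialize (Hd c Hc1); nra. }
assert (Hp := proj1 (Cmod_gt_0 _) E).
(* The unit vector in the direction of the increment. *)
set (u := (Cconj (f y - f x) / Cmod (f y - f x))%C).
assert (Hu : Cmod u = 1).
{ unfold u; rewrite Cmod_div, Cmod_conj, Cmod_R, Rabs_pos_eq by
    (try apply Cmod_ge_0; intros H; apply RtoC_inj in H; lra); field; lra. }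
assert (Hinc : Re (u * (f y - f x)) = Cmod (f y - f x)).
{ unfold u; set (w := (f y - f x)%C) in *.
  replace (Cconj w / Cmod w * w)%C with (RtoC (Cmod w)); [easy|].
  assert (Hw : RtoC (Cmod w) <> 0) by (intros H; apply RtoC_inj in H; lra).
  replace (Cconj w / Cmod w * w)%C with (w * Cconj w / Cmod w)%C by (field; easy).
  rewrite <- Cmod2_conj, RtoC_pow; field; easy. }
destruct (MVT_gen (fun t => Re (u * f t) - B t) x y (fun t => Re (u * df t) - dB t))
  as [c [Hc1 Hc2]].
- rewrite Rmin_left, Rmax_right by easy; intros t Ht.
  apply @is_derive_minus; [apply Rderiv_comp_re; apply Hf; lra|apply HB; lra].
- rewrite Rmin_left, Rmax_right by easy; intros t Ht.
  apply continuity_pt_filterlim.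
  apply (ex_derive_continuous (fun t => Re (u * f t) - B t)).
  exists (Re (u * df t) - dB t).
  apply @is_derive_minus; [apply Rderiv_comp_re; now apply Hf|now apply HB].
- rewrite Rmin_left, Rmax_right in Hc1 by easy.
  rewrite <- Hinc.
  replace (Re (u * (f y - f x))) with (Re (u * f y) - Re (u * f x))
    by (destruct (f y), (f x), u; simpl; ring).
  assert (Hle : Re (u * df c) <= dB c).
  { eapply Rle_trans; [apply Rle_abs|]; eapply Rle_trans; [apply re_le_Cmod|].
    rewrite Cmod_mult, Hu, Rmult_1_l; now apply Hd. }
  assert (Hn : (Re (u * df c) - dB c) * (y - x) <= 0) by nra.
  cbv beta in Hc2; lra.
Qed.

Lemma exp_mono x y : x <= y -> exp x <= exp y.
Proof. intros [H| ->]; [left; now apply exp_increasing|apply Rle_refl]. Qed.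

Lemma Cexp_plus z w : Cexp (z + w) = (Cexp z * Cexp w)%C.
Proof.
destruct z as [x y], w as [u v]; unfold Cexp, Cmult; simpl.
rewrite exp_plus, cos_plus, sin_plus; f_equal; ring.
Qed.

Lemma Cexp_0 : Cexp 0 = 1.
Proof. unfold Cexp, RtoC; simpl; rewrite exp_0, cos_0, sin_0; f_equal; ring. Qed.

Lemma Cexp_opp z : Cexp (- z) = (/ Cexp z)%C.
Proof.
assert (H : (Cexp (- z) * Cexp z)%C = 1).
{ rewrite <- Cexp_plus; replace (- z + z)%C with (RtoC 0) by ring; apply Cexp_0. }
assert (H0 := Cexp_neq_0 z).
replace (Cexp (- z)) with (Cexp (- z) * Cexp z * / Cexp z)%C by (field; easy).
rewrite H; ring.
Qed.

Lemma Cexp_minus z w : Cexp (z - w) = (Cexp z / Cexp w)%C.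
Proof. unfold Cminus, Cdiv; now rewrite Cexp_plus, Cexp_opp. Qed.

Lemma Cmod_Cexp z : Cmod (Cexp z) = exp (Re z).
Proof.
unfold Cexp, Cmod; simpl.
pose proof (exp_pos (Re z)); pose proof (sin2_cos2 (Im z)) as H2; unfold Rsqr in H2.
replace (_ + _) with ((exp (Re z)) ^ 2 * (sin (Im z) * sin (Im z) + cos (Im z) * cos (Im z))) by ring.
rewrite H2, Rmult_1_r; apply sqrt_pow2; lra.
Qed.

Lemma Cexp_line (z : C) t : Rderiv (fun t => Cexp (t * z)) t (z * Cexp (t * z)).
Proof.
destruct z as [x y].
apply Rderiv_pair.
- apply (is_derive_ext (fun t => exp (t * x) * cos (t * y))).
  { intros u; unfold Cexp; simpl; f_equal; f_equal; ring. }
  unfold Cexp; simpl.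
  replace (t * x - 0 * y) with (t * x) by ring; replace (t * y + 0 * x) with (t * y) by ring.
  auto_derive; [easy|ring].
- apply (is_derive_ext (fun t => exp (t * x) * sin (t * y))).
  { intros u; unfold Cexp; simpl; f_equal; f_equal; ring. }
  unfold Cexp; simpl.
  replace (t * x - 0 * y) with (t * x) by ring; replace (t * y + 0 * x) with (t * y) by ring.
  auto_derive; [easy|ring].
Qed.

Lemma Cexp_bound1 h : Cmod (Cexp h - 1) <= Cmod h * exp (Cmod h).
Proof.
replace (Cexp h - 1)%C with (Cexp ((RtoC 1) * h) - Cexp ((RtoC 0) * h))%C
  by (rewrite Cmult_1_l, Cmult_0_l, Cexp_0; ring).
replace (Cmod h * exp (Cmod h)) with (1 * (Cmod h * exp (Cmod h)) - 0 * (Cmod h * exp (Cmod h))) by ring.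
apply (increment_dominated (fun t => Cexp (t * h)) (fun t => h * Cexp (t * h))%C
  (fun t => t * (Cmod h * exp (Cmod h))) (fun t => Cmod h * exp (Cmod h))); [lra| | |].
- intros t _; apply Cexp_line.
- intros t _; auto_derive; [easy|ring].
- intros t Ht; rewrite Cmod_mult, Cmod_Cexp; apply Rmult_le_compat_l; [apply Cmod_ge_0|].
  apply exp_mono; eapply Rle_trans; [apply Rle_abs|]; eapply Rle_trans; [apply re_le_Cmod|].
  rewrite Cmod_mult, Cmod_R, Rabs_pos_eq by lra; pose proof (Cmod_ge_0 h); nra.
Qed.

(** Integrating the first-order estimate along the segment from 0 to h. *)
Lemma Cexp_bound2 h : Cmod (Cexp h - 1 - h) <= Cmod h ^ 2 * exp (Cmod h).
Proof.
set (M := Cmod h ^ 2 * exp (Cmod h)).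
replace (Cexp h - 1 - h)%C with ((Cexp ((RtoC 1) * h) - RtoC 1 * h) - (Cexp ((RtoC 0) * h) - RtoC 0 * h))%C
  by (rewrite Cmult_1_l, !Cmult_0_l, Cexp_0; ring).
replace M with (1 * M - 0 * M) by ring.
apply (increment_dominated (fun t => Cexp (t * h) - t * h)%C (fun t => h * Cexp (t * h) - 1 * h)%C
  (fun t => t * M) (fun t => M)); [lra| | |].
- intros t _; apply Rderiv_minus; [apply Cexp_line|].
  eapply Rderiv_eq; [apply Rderiv_mult; [apply Rderiv_RtoC, is_derive_Reals, derivable_pt_lim_id|apply Rderiv_const]|].
  cbv beta; ring.
- intros t _; auto_derive; [easy|ring].
- intros t Ht; replace (h * Cexp (t * h) - 1 * h)%C with (h * (Cexp (t * h) - 1))%C by ring.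
  unfold M; rewrite Cmod_mult; simpl pow; rewrite Rmult_1_r, Rmult_assoc.
  pose proof (Cmod_ge_0 h); apply Rmult_le_compat_l; [easy|].
  eapply Rle_trans; [apply Cexp_bound1|].
  rewrite Cmod_mult, Cmod_R, Rabs_pos_eq by lra.
  apply Rmult_le_compat; [nra|left; apply exp_pos|nra|apply exp_mono; nra].
Qed.

Lemma Cderiv_Cexp z : Cderiv Cexp z (Cexp z).
Proof.
apply Cderiv_eps; intros eps He.
assert (P : 0 < eps / (Cmod (Cexp z) * exp 1)).
{ apply Rdiv_lt_0_compat; [easy|]; apply Rmult_lt_0_compat; [apply Cmod_gt_0, Cexp_neq_0|apply exp_pos]. }
exists (Rmin 1 (eps / (Cmod (Cexp z) * exp 1))); split; [apply Rmin_pos; lra|].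
intros y Hy.
assert (Hy1 := Rlt_le_trans _ _ _ Hy (Rmin_l _ _)).
assert (Hy2 := Rlt_le_trans _ _ _ Hy (Rmin_r _ _)).
set (h := (y - z)%C) in *.
replace y with (z + h)%C at 1 by (unfold h; ring).
rewrite Cexp_plus.
replace (Cexp z * Cexp h - Cexp z - h * Cexp z)%C with (Cexp z * (Cexp h - 1 - h))%C by ring.
rewrite Cmod_mult.
pose proof (Cmod_ge_0 h) as H0; pose proof (proj1 (Cmod_gt_0 _) (Cexp_neq_0 z)) as Hm.
pose proof (exp_pos 1).
apply Rle_trans with (Cmod (Cexp z) * (Cmod h * Cmod h * exp 1)).
- apply Rmult_le_compat_l; [lra|]; eapply Rle_trans; [apply Cexp_bound2|].
  simpl pow; rewrite Rmult_1_r; apply Rmult_le_compat_l; [nra|]; apply exp_mono; lra.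
- replace (Cmod (Cexp z) * (Cmod h * Cmod h * exp 1)) with
    (((Cmod (Cexp z) * exp 1) * Cmod h) * Cmod h) by ring.
  apply Rmult_le_compat_r; [easy|].
  apply (Rmult_lt_compat_l (Cmod (Cexp z) * exp 1)) in Hy2; [|nra].
  replace (Cmod (Cexp z) * exp 1 * (eps / (Cmod (Cexp z) * exp 1))) with eps in Hy2 by (field; lra).
  lra.
Qed.

(** * Integrals of complex functions of a real variable *)

Definition Ccont (f : R -> C) (x : R) : Prop := continuous (T:=R_UniformSpace) (U:=C_R_NormedModule) f x.
Definition CInt (f : R -> C) (a b : R) : C := @RInt C_R_CompleteNormedModule f a b.
Definition Cintegrable (f : R -> C) (a b : R) : Prop := @ex_RInt C_R_NormedModule f a b.
Definition is_CInt (f : R -> C) (a b : R) (l : C) : Prop := @is_RInt C_R_NormedModule f a b l.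

Lemma CInt_correct f a b : Cintegrable f a b -> is_CInt f a b (CInt f a b).
Proof. exact (RInt_correct (V:=C_R_CompleteNormedModule) f a b). Qed.

Lemma is_CInt_unique f a b l : is_CInt f a b l -> CInt f a b = l.
Proof. exact (is_RInt_unique (V:=C_R_CompleteNormedModule) f a b l). Qed.

Lemma Rderiv_Ccont f x l : Rderiv f x l -> Ccont f x.
Proof. exact (Rderiv_continuous f x l). Qed.

Lemma Ccont_integrable f a b : (forall t, Rmin a b <= t <= Rmax a b -> Ccont f t) -> Cintegrable f a b.
Proof. exact (ex_RInt_continuous (V:=C_R_CompleteNormedModule) f a b). Qed.

Lemma Ccont_integrable_le f a b : a <= b -> (forall t, a <= t <= b -> Ccont f t) -> Cintegrable f a b.
Proof. intros H Hf; apply Ccont_integrable; rewrite Rmin_left, Rmax_right by easy; exact Hf. Qed.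

Lemma is_CInt_plus f g a b l m : is_CInt f a b l -> is_CInt g a b m ->
  is_CInt (fun t => f t + g t)%C a b (l + m)%C.
Proof. exact (is_RInt_plus (V:=C_R_NormedModule) f g a b l m). Qed.

Lemma is_CInt_minus f g a b l m : is_CInt f a b l -> is_CInt g a b m ->
  is_CInt (fun t => f t - g t)%C a b (l - m)%C.
Proof. exact (is_RInt_minus (V:=C_R_NormedModule) f g a b l m). Qed.

Lemma is_CInt_ext f g a b l : (forall t, Rmin a b < t < Rmax a b -> f t = g t) ->
  is_CInt f a b l -> is_CInt g a b l.
Proof. exact (is_RInt_ext (V:=C_R_NormedModule) f g a b l). Qed.

Lemma is_CInt_Chasles f a b c l m : is_CInt f a b l -> is_CInt f b c m -> is_CInt f a c (l + m)%C.
Proof. exact (is_RInt_Chasles (V:=C_R_NormedModule) f a b c l m). Qed.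

Lemma is_CInt_swap f a b l : is_CInt f b a l -> is_CInt f a b (- l)%C.
Proof. exact (is_RInt_swap (V:=C_R_NormedModule) f a b l). Qed.

Lemma is_CInt_Re f a b l : is_CInt f a b l -> is_RInt (fun t => Re (f t)) a b (Re l).
Proof. exact (is_RInt_fct_extend_fst (U:=R_NormedModule) (V:=R_NormedModule) f a b l). Qed.

Lemma is_CInt_Im f a b l : is_CInt f a b l -> is_RInt (fun t => Im (f t)) a b (Im l).
Proof. exact (is_RInt_fct_extend_snd (U:=R_NormedModule) (V:=R_NormedModule) f a b l). Qed.

Lemma is_CInt_pair f a b l : is_RInt (fun t => Re (f t)) a b (Re l) ->
  is_RInt (fun t => Im (f t)) a b (Im l) -> is_CInt f a b l.
Proof.
destruct l as [l1 l2]; intros H1 H2.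
exact (is_RInt_fct_extend_pair (U:=R_NormedModule) (V:=R_NormedModule) f a b l1 l2 H1 H2).
Qed.

Lemma is_CInt_scal c f a b l : is_CInt f a b l -> is_CInt (fun t => c * f t)%C a b (c * l)%C.
Proof.
intros H; pose proof (is_CInt_Re _ _ _ _ H) as H1; pose proof (is_CInt_Im _ _ _ _ H) as H2.
apply is_CInt_pair.
- rewrite re_mult.
  apply (is_RInt_ext (fun t => minus (scal (Re c) (Re (f t))) (scal (Im c) (Im (f t))))).
  { intros t _; now rewrite re_mult. }
  exact (is_RInt_minus (V:=R_NormedModule) _ _ _ _ _ _ (is_RInt_scal (V:=R_NormedModule) _ _ _ (Re c) _ H1)
    (is_RInt_scal (V:=R_NormedModule) _ _ _ (Im c) _ H2)).
- rewrite im_mult.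
  apply (is_RInt_ext (fun t => plus (scal (Re c) (Im (f t))) (scal (Im c) (Re (f t))))).
  { intros t _; now rewrite im_mult. }
  exact (is_RInt_plus (V:=R_NormedModule) _ _ _ _ _ _ (is_RInt_scal (V:=R_NormedModule) _ _ _ (Re c) _ H2)
    (is_RInt_scal (V:=R_NormedModule) _ _ _ (Im c) _ H1)).
Qed.

Lemma is_CInt_derive F f a b : a <= b -> (forall t, a <= t <= b -> Rderiv F t (f t)) ->
  (forall t, a <= t <= b -> Ccont f t) -> is_CInt f a b (F b - F a)%C.
Proof.
intros Hab H1 H2; apply (is_RInt_derive (V:=C_R_CompleteNormedModule) F f a b);
  rewrite Rmin_left, Rmax_right by easy; assumption.
Qed.

Lemma is_CInt_const c a b : is_CInt (fun _ => c) a b ((b - a)%R * c)%C.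
Proof.
pose proof (is_RInt_const (V:=C_R_NormedModule) a b c) as H.
now rewrite scal_R_Cmult in H.
Qed.

(** Dominating the integrand by a derivative avoids a second integral in the bound. *)
Lemma is_CInt_bound f a b l B dB : a <= b -> is_CInt f a b l ->
  (forall t, a <= t <= b -> Cmod (f t) <= dB t) ->
  (forall t, a <= t <= b -> is_derive B t (dB t)) ->
  (forall t, a <= t <= b -> continuous dB t) ->
  Cmod l <= B b - B a.
Proof.
intros Hab Hf Hd HB Hc; rewrite Cmod_norm.
apply (norm_RInt_le (V:=C_R_NormedModule) f dB a b); try easy.
- intros t Ht; specialize (Hd t Ht); now rewrite Cmod_norm in Hd.
- apply (is_RInt_derive (V:=R_CompleteNormedModule)); now rewrite Rmin_left, Rmax_right.
Qed.

Lemma is_CInt_bound_const f a b l M : is_CInt f a b l ->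
  (forall t, Rmin a b <= t <= Rmax a b -> Cmod (f t) <= M) -> Cmod l <= Rabs (b - a) * M.
Proof.
assert (H : forall a b l, a <= b -> is_CInt f a b l -> (forall t, a <= t <= b -> Cmod (f t) <= M) ->
  Cmod l <= Rabs (b - a) * M).
{ intros a' b' l' Hab Hf Hd; rewrite Rabs_pos_eq by lra.
  replace ((b' - a') * M) with (b' * M - a' * M) by ring.
  apply (is_CInt_bound f a' b' l' (fun t => t * M) (fun _ => M)); try easy.
  - intros t _; auto_derive; [easy|ring].
  - intros t _; apply continuous_const. }
intros Hf Hd; destruct (Rle_dec a b) as [Hab|Hab].
- rewrite Rmin_left, Rmax_right in Hd by lra; now apply (H a b).
- rewrite Rmin_right, Rmax_left in Hd by lra; rewrite Rabs_minus_sym, <- Cmod_opp.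
  apply (H b a); [lra|now apply is_CInt_swap|easy].
Qed.

(** * Cauchy's theorem for rectangles *)

Definition Cdiff (f : C -> C) (z : C) : Prop := exists l, Cderiv f z l.

Lemma Cdiff_plus f g z : Cdiff f z -> Cdiff g z -> Cdiff (fun w => f w + g w)%C z.
Proof. intros [l Hl] [m Hm]; eexists; apply Cderiv_plus; eassumption. Qed.

Lemma Cdiff_minus f g z : Cdiff f z -> Cdiff g z -> Cdiff (fun w => f w - g w)%C z.
Proof. intros [l Hl] [m Hm]; eexists; apply Cderiv_minus; eassumption. Qed.

Lemma Cdiff_mult f g z : Cdiff f z -> Cdiff g z -> Cdiff (fun w => f w * g w)%C z.
Proof. intros [l Hl] [m Hm]; eexists; apply Cderiv_mult; eassumption. Qed.

Lemma Cdiff_const c z : Cdiff (fun _ => c) z.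
Proof. eexists; apply Cderiv_const. Qed.

Lemma Cdiff_id z : Cdiff (fun w => w) z.
Proof. eexists; apply Cderiv_id. Qed.

Lemma Cdiff_comp f g z : Cdiff f (g z) -> Cdiff g z -> Cdiff (fun w => f (g w)) z.
Proof. intros [l Hl] [m Hm]; eexists; apply Cderiv_comp; eassumption. Qed.

Definition Centire (f : C -> C) : Prop := forall z, Cdiff f z.

Lemma Centire_horizontal f y t : Centire f -> Ccont (fun u => f (u, y)) t.
Proof.
intros H; destruct (H (t, y)) as [l Hl].
apply (Rderiv_Ccont _ _ (l * 1)%C); apply (Cderiv_Rderiv_comp f (fun u => (u, y))); [exact Hl|].
apply Rderiv_pair; simpl; [exact (is_derive_id (K:=R_AbsRing) t)|exact (is_derive_const (V:=R_NormedModule) y t)].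
Qed.

Lemma Centire_vertical f x t : Centire f -> Ccont (fun u => f (x, u)) t.
Proof.
intros H; destruct (H (x, t)) as [l Hl].
apply (Rderiv_Ccont _ _ (l * Ci)%C); apply (Cderiv_Rderiv_comp f (fun u => (x, u))); [exact Hl|].
apply Rderiv_pair; simpl; [exact (is_derive_const (V:=R_NormedModule) x t)|exact (is_derive_id (K:=R_AbsRing) t)].
Qed.

Lemma is_CInt_horizontal f y a b : Centire f -> is_CInt (fun u => f (u, y)) a b (CInt (fun u => f (u, y)) a b).
Proof. intros H; apply CInt_correct, Ccont_integrable; intros t _; now apply Centire_horizontal. Qed.

Lemma is_CInt_vertical f x a b : Centire f -> is_CInt (fun u => f (x, u)) a b (CInt (fun u => f (x, u)) a b).
Proof. intros H; apply CInt_correct, Ccont_integrable; intros t _; now apply Centire_vertical. Qed.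

(** The integral of [f] around the rectangle with corners (x0, y0) and (x1, y1). *)
Definition boundary (f : C -> C) (x0 x1 y0 y1 : R) : C :=
  (CInt (fun t => f (t, y0)) x0 x1 - CInt (fun t => f (t, y1)) x0 x1
   + Ci * (CInt (fun t => f (x1, t)) y0 y1 - CInt (fun t => f (x0, t)) y0 y1))%C.

Lemma boundary_split_x f x0 x1 x2 y0 y1 : Centire f ->
  boundary f x0 x2 y0 y1 = (boundary f x0 x1 y0 y1 + boundary f x1 x2 y0 y1)%C.
Proof.
intros H; unfold boundary.
rewrite (is_CInt_unique _ _ _ _ (is_CInt_Chasles _ _ _ _ _ _ (is_CInt_horizontal f y0 x0 x1 H) (is_CInt_horizontal f y0 x1 x2 H))).
rewrite (is_CInt_unique _ _ _ _ (is_CInt_Chasles _ _ _ _ _ _ (is_CInt_horizontal f y1 x0 x1 H) (is_CInt_horizontal f y1 x1 x2 H))).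
ring.
Qed.

Lemma boundary_split_y f x0 x1 y0 y1 y2 : Centire f ->
  boundary f x0 x1 y0 y2 = (boundary f x0 x1 y0 y1 + boundary f x0 x1 y1 y2)%C.
Proof.
intros H; unfold boundary.
rewrite (is_CInt_unique _ _ _ _ (is_CInt_Chasles _ _ _ _ _ _ (is_CInt_vertical f x0 y0 y1 H) (is_CInt_vertical f x0 y1 y2 H))).
rewrite (is_CInt_unique _ _ _ _ (is_CInt_Chasles _ _ _ _ _ _ (is_CInt_vertical f x1 y0 y1 H) (is_CInt_vertical f x1 y1 y2 H))).
ring.
Qed.

Lemma boundary_minus f g x0 x1 y0 y1 : Centire f -> Centire g ->
  boundary (fun z => f z - g z)%C x0 x1 y0 y1 = (boundary f x0 x1 y0 y1 - boundary g x0 x1 y0 y1)%C.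
Proof.
intros Hf Hg; unfold boundary.
rewrite (is_CInt_unique _ _ _ _ (is_CInt_minus _ _ _ _ _ _ (is_CInt_vertical f x0 y0 y1 Hf) (is_CInt_vertical g x0 y0 y1 Hg))).
rewrite (is_CInt_unique _ _ _ _ (is_CInt_minus _ _ _ _ _ _ (is_CInt_vertical f x1 y0 y1 Hf) (is_CInt_vertical g x1 y0 y1 Hg))).
rewrite (is_CInt_unique _ _ _ _ (is_CInt_minus _ _ _ _ _ _ (is_CInt_horizontal f y0 x0 x1 Hf) (is_CInt_horizontal g y0 x0 x1 Hg))).
rewrite (is_CInt_unique _ _ _ _ (is_CInt_minus _ _ _ _ _ _ (is_CInt_horizontal f y1 x0 x1 Hf) (is_CInt_horizontal g y1 x0 x1 Hg))).
ring.
Qed.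

Lemma Rderiv_horizontal y t : Rderiv (fun u => (u, y)) t 1.
Proof. apply Rderiv_pair; simpl; [exact (is_derive_id (K:=R_AbsRing) t)|exact (is_derive_const (V:=R_NormedModule) y t)]. Qed.

Lemma Rderiv_vertical x t : Rderiv (fun u => (x, u)) t Ci.
Proof. apply Rderiv_pair; simpl; [exact (is_derive_const (V:=R_NormedModule) x t)|exact (is_derive_id (K:=R_AbsRing) t)]. Qed.

(** Each side of the rectangle integrates to an increment of the primitive. *)
Lemma boundary_primitive F f x0 x1 y0 y1 : x0 <= x1 -> y0 <= y1 ->
  (forall z, Cderiv F z (f z)) -> Centire f -> boundary f x0 x1 y0 y1 = 0.
Proof.
intros Hx Hy HF Hf.
assert (A : forall y, CInt (fun t => f (t, y)) x0 x1 = (F (x1, y) - F (x0, y))%C).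
{ intros y; apply is_CInt_unique; apply (is_CInt_derive (fun t => F (t, y))); [easy| |].
  - intros t _; eapply Rderiv_eq; [apply (Cderiv_Rderiv_comp F); [apply HF|apply Rderiv_horizontal]|ring].
  - intros t _; now apply Centire_horizontal. }
assert (B : forall x, (Ci * CInt (fun t => f (x, t)) y0 y1)%C = (F (x, y1) - F (x, y0))%C).
{ intros x; rewrite <- (is_CInt_unique _ _ _ _ (is_CInt_scal Ci _ _ _ _ (is_CInt_vertical f x y0 y1 Hf))).
  apply is_CInt_unique; apply (is_CInt_derive (fun t => F (x, t))); [easy| |].
  - intros t _; eapply Rderiv_eq; [apply (Cderiv_Rderiv_comp F); [apply HF|apply Rderiv_vertical]|ring].
  - intros t _.
    apply (Centire_vertical (fun z => Ci * f z)%C).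
    intros z; destruct (Hf z) as [l Hl]; exists (Ci * l)%C; now apply Cderiv_scal. }
unfold boundary; unfold Cminus at 2; rewrite Cmult_plus_distr_l.
replace (Ci * - CInt (fun t => f (x0, t)) y0 y1)%C with (- (Ci * CInt (fun t => f (x0, t)) y0 y1))%C by ring.
rewrite !A, !B; ring.
Qed.

Lemma boundary_bound f x0 x1 y0 y1 M : x0 <= x1 -> y0 <= y1 -> Centire f ->
  (forall x y, x0 <= x <= x1 -> y0 <= y <= y1 -> Cmod (f (x, y)) <= M) ->
  Cmod (boundary f x0 x1 y0 y1) <= 2 * ((x1 - x0) + (y1 - y0)) * M.
Proof.
intros Hx Hy Hf HM; unfold boundary, Cminus.
assert (A : forall y, y0 <= y <= y1 -> Cmod (CInt (fun t => f (t, y)) x0 x1) <= (x1 - x0) * M).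
{ intros y Hy'; rewrite <- (Rabs_pos_eq (x1 - x0)) by lra.
  apply (is_CInt_bound_const _ _ _ _ _ (is_CInt_horizontal f y x0 x1 Hf)).
  rewrite Rmin_left, Rmax_right by easy; intros; now apply HM. }
assert (B : forall x, x0 <= x <= x1 -> Cmod (CInt (fun t => f (x, t)) y0 y1) <= (y1 - y0) * M).
{ intros x Hx'; rewrite <- (Rabs_pos_eq (y1 - y0)) by lra.
  apply (is_CInt_bound_const _ _ _ _ _ (is_CInt_vertical f x y0 y1 Hf)).
  rewrite Rmin_left, Rmax_right by easy; intros; now apply HM. }
eapply Rle_trans; [apply Cmod_triangle|].
rewrite Cmod_mult, Cmod_Ci, Rmult_1_l.
eapply Rle_trans; [apply Rplus_le_compat; apply Cmod_triangle|].
rewrite !Cmod_opp.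
pose proof (A y0 ltac:(lra)); pose proof (A y1 ltac:(lra)).
pose proof (B x0 ltac:(lra)); pose proof (B x1 ltac:(lra)); lra.
Qed.

Lemma nested_point (u v : nat -> R) : (forall n, u n <= u (S n)) -> (forall n, v (S n) <= v n) ->
  (forall n, u n <= v n) -> exists c, forall n, u n <= c <= v n.
Proof.
intros Hu Hv Huv.
assert (Mu : forall n k, u n <= u (n + k)%nat).
{ intros n k; induction k as [|k IH]; [rewrite Nat.add_0_r; lra|rewrite Nat.add_succ_r; specialize (Hu (n + k)%nat); lra]. }
assert (Mv : forall n k, v (n + k)%nat <= v n).
{ intros n k; induction k as [|k IH]; [rewrite Nat.add_0_r; lra|rewrite Nat.add_succ_r; specialize (Hv (n + k)%nat); lra]. }
assert (Hm : forall n m, u n <= v m).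
{ intros n m; eapply Rle_trans; [apply (Mu n m)|]; eapply Rle_trans; [apply Huv|].
  rewrite Nat.add_comm; apply Mv. }
destruct (completeness (fun x => exists n, x = u n)) as [c [Hc1 Hc2]].
- exists (v 0%nat); intros x [n ->]; apply Hm.
- exists (u 0%nat); now exists 0%nat.
- exists c; intros n; split; [apply Hc1; now exists n|].
  apply Hc2; intros x [m ->]; apply Hm.
Qed.

Lemma Cmod_pair_le x y : Cmod (x, y) <= Rabs x + Rabs y.
Proof.
replace ((x, y) : C) with (RtoC x + Ci * RtoC y)%C
  by (unfold Cplus, Cmult, Ci, RtoC; simpl; f_equal; ring).
eapply Rle_trans; [apply Cmod_triangle|]; rewrite Cmod_mult, Cmod_Ci, !Cmod_R; lra.
Qed.

(** Bisection: a rectangle whose boundary integral is large compared with its area has a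
    quarter with the same property, and differentiability at the common point of a nested
    sequence of such rectangles forbids it. *)
Theorem Goursat_le f x0 x1 y0 y1 : Centire f -> x0 <= x1 -> y0 <= y1 -> boundary f x0 x1 y0 y1 = 0.
Proof.
intros Hf Hx Hy.
set (w := x1 - x0); set (h := y1 - y0).
assert (Hw : 0 <= w) by (unfold w; lra); assert (Hh : 0 <= h) by (unfold h; lra).
(* The bound scales like the area, so it holds for a rectangle once it holds for its quarters. *)
set (small := fun e n (p : R * R) => Cmod (boundary f (fst p) (fst p + w / 2 ^ n) (snd p) (snd p + h / 2 ^ n))
   <= e * ((w + h) / 2 ^ n) ^ 2).
assert (Hall : forall e, 0 < e -> small e O (x0, y0)).
2:{ apply Cmod_eq_0; apply Rle_antisym; [|apply Cmod_ge_0].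
  apply le_epsilon; intros e He; rewrite Rplus_0_l.
  assert (P : 0 < (w + h) ^ 2 + 1) by nra.
  specialize (Hall (e / ((w + h) ^ 2 + 1)) ltac:(now apply Rdiv_lt_0_compat)).
  assert (Hb : Cmod (boundary f x0 x1 y0 y1) <= e / ((w + h) ^ 2 + 1) * (w + h) ^ 2).
  { unfold small, fst, snd in Hall.
    replace (x0 + w / 2 ^ 0) with x1 in Hall by (unfold w; simpl; field).
    replace (y0 + h / 2 ^ 0) with y1 in Hall by (unfold h; simpl; field).
    replace ((w + h) / 2 ^ 0) with (w + h) in Hall by (simpl; field); exact Hall. }
  eapply Rle_trans; [exact Hb|].
  apply Rmult_le_reg_r with ((w + h) ^ 2 + 1); [lra|].
  replace (e / ((w + h) ^ 2 + 1) * (w + h) ^ 2 * ((w + h) ^ 2 + 1)) with (e * (w + h) ^ 2) by (field; lra).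
  nra. }
intros e He; apply NNPP; intros Hbad.
assert (Hstep : forall n p, exists q : R * R, ~ small e n p ->
  (fst p <= fst q <= fst p + w / 2 ^ n - w / 2 ^ S n) /\
  (snd p <= snd q <= snd p + h / 2 ^ n - h / 2 ^ S n) /\ ~ small e (S n) q).
{ intros n p; destruct (classic (small e n p)) as [Hs|Hs]; [exists p; tauto|].
  assert (P2 : 0 < 2 ^ n) by (apply pow_lt; lra).
  assert (Ew : w / 2 ^ n = w / 2 ^ S n + w / 2 ^ S n) by (simpl; field; lra).
  assert (Eh : h / 2 ^ n = h / 2 ^ S n + h / 2 ^ S n) by (simpl; field; lra).
  assert (Pw : 0 <= w / 2 ^ S n) by (apply Rdiv_le_0_compat; [easy|apply pow_lt; lra]).
  assert (Ph : 0 <= h / 2 ^ S n) by (apply Rdiv_le_0_compat; [easy|apply pow_lt; lra]).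
  apply NNPP; intros Hno; apply Hs.
  assert (Hq : forall q, (fst q = fst p \/ fst q = fst p + w / 2 ^ S n) ->
     (snd q = snd p \/ snd q = snd p + h / 2 ^ S n) -> small e (S n) q).
  { intros q H1 H2; apply NNPP; intros H3; apply Hno; exists q; intros _.
    split; [destruct H1; lra|split; [destruct H2; lra|exact H3]]. }
  clear Hno; destruct p as [x y]; simpl fst in *; simpl snd in *.
  pose proof (Hq (x, y) (or_introl eq_refl) (or_introl eq_refl)) as A1.
  pose proof (Hq (x + w / 2 ^ S n, y) (or_intror eq_refl) (or_introl eq_refl)) as A2.
  pose proof (Hq (x, y + h / 2 ^ S n) (or_introl eq_refl) (or_intror eq_refl)) as A3.
  pose proof (Hq (x + w / 2 ^ S n, y + h / 2 ^ S n) (or_intror eq_refl) (or_intror eq_refl)) as A4.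
  unfold small, fst, snd in A1, A2, A3, A4 |- *.
  rewrite Ew, Eh, <- !Rplus_assoc.
  rewrite (boundary_split_x f x (x + w / 2 ^ S n)) by easy.
  rewrite (boundary_split_y f x (x + w / 2 ^ S n) y (y + h / 2 ^ S n) (y + h / 2 ^ S n + h / 2 ^ S n)) by easy.
  rewrite (boundary_split_y f (x + w / 2 ^ S n) (x + w / 2 ^ S n + w / 2 ^ S n) y (y + h / 2 ^ S n)
    (y + h / 2 ^ S n + h / 2 ^ S n)) by easy.
  replace ((w + h) / 2 ^ n) with (2 * ((w + h) / 2 ^ S n)) by (simpl; field; lra).
  eapply Rle_trans; [apply Cmod_triangle|].
  eapply Rle_trans; [apply Rplus_le_compat; apply Cmod_triangle|].
  lra. }
destruct (choice (fun np q => let '(n, p) := np in ~ small e n p ->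
  (fst p <= fst q <= fst p + w / 2 ^ n - w / 2 ^ S n) /\
  (snd p <= snd q <= snd p + h / 2 ^ n - h / 2 ^ S n) /\ ~ small e (S n) q)) as [next Hnext].
{ intros [n p]; apply Hstep. }
set (sq := nat_rect (fun _ => (R * R)%type) (x0, y0) (fun n p => next (n, p))).
assert (Hsq : forall n, ~ small e n (sq n)).
{ induction n as [|n IH]; [exact Hbad|apply (Hnext (n, sq n) IH)]. }
assert (Hp2 : forall n, 0 < 2 ^ n) by (intros; apply pow_lt; lra).
destruct (nested_point (fun n => fst (sq n)) (fun n => fst (sq n) + w / 2 ^ n)) as [cx Hcx].
{ intros n; apply (Hnext (n, sq n) (Hsq n)). }
{ intros n; pose proof (Hnext (n, sq n) (Hsq n)) as T; simpl sq in *; lra. }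
{ intros n; pose proof (Rdiv_le_0_compat w (2 ^ n) Hw (Hp2 n)); lra. }
destruct (nested_point (fun n => snd (sq n)) (fun n => snd (sq n) + h / 2 ^ n)) as [cy Hcy].
{ intros n; exact (proj1 (proj1 (proj2 (Hnext (n, sq n) (Hsq n))))). }
{ intros n; pose proof (Hnext (n, sq n) (Hsq n)) as T; simpl sq in *; lra. }
{ intros n; pose proof (Rdiv_le_0_compat h (2 ^ n) Hh (Hp2 n)); lra. }
cbv beta in Hcx, Hcy.
destruct (Hf (cx, cy)) as [l Hl]; rewrite Cderiv_eps in Hl.
destruct (Hl (e / 2) ltac:(lra)) as [d [Hd Hl']].
assert (exists n, (w + h) / 2 ^ n < d) as [n Hn].
{ destruct (pow_lt_1_zero (/ 2) ltac:(rewrite Rabs_pos_eq; lra) (d / (w + h + 1))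
    ltac:(apply Rdiv_lt_0_compat; lra)) as [n Hn].
  exists n; specialize (Hn n (le_n n)).
  rewrite pow_inv, Rabs_pos_eq in Hn by (left; apply Rinv_0_lt_compat, Hp2).
  apply Rle_lt_trans with ((w + h + 1) * / 2 ^ n).
  - unfold Rdiv; apply Rmult_le_compat_r; [left; apply Rinv_0_lt_compat, Hp2|lra].
  - apply (Rmult_lt_compat_l (w + h + 1)) in Hn; [|lra].
    replace ((w + h + 1) * (d / (w + h + 1))) with d in Hn by (field; lra); lra. }
apply (Hsq n); unfold small.
pose proof (Rdiv_le_0_compat w (2 ^ n) Hw (Hp2 n)) as Pw.
pose proof (Rdiv_le_0_compat h (2 ^ n) Hh (Hp2 n)) as Ph.
(* The affine part has a primitive, so only the error term contributes. *)
set (g := fun z : C => (f (cx, cy) + (z - (cx, cy)) * l)%C).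
assert (Hg : Centire g).
{ intros z; eexists; unfold g.
  apply (Cderiv_plus (fun _ => f (cx, cy))); [apply Cderiv_const|].
  apply (Cderiv_mult (fun z => z - (cx, cy))%C (fun _ => l)); [|apply Cderiv_const].
  apply (Cderiv_minus (fun z => z)); [apply Cderiv_id|apply Cderiv_const]. }
assert (Hg0 : forall x0 x1 y0 y1, x0 <= x1 -> y0 <= y1 -> boundary g x0 x1 y0 y1 = 0).
{ intros; apply (boundary_primitive (fun z => f (cx, cy) * z + (z - (cx, cy)) * (z - (cx, cy)) * (l / 2))%C); try easy.
  intros z; eapply Cderiv_eq.
  - apply (Cderiv_plus (fun z => f (cx, cy) * z)%C); [apply Cderiv_scal, Cderiv_id|].
    apply (Cderiv_mult (fun z => (z - (cx, cy)) * (z - (cx, cy)))%C (fun _ => l / 2)%C); [|apply Cderiv_const].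
    apply (Cderiv_mult (fun z => z - (cx, cy))%C); (apply (Cderiv_minus (fun z => z)); [apply Cderiv_id|apply Cderiv_const]).
  - unfold g; field. }
replace (boundary f _ _ _ _) with
  (boundary (fun z => f z - g z)%C (fst (sq n)) (fst (sq n) + w / 2 ^ n) (snd (sq n)) (snd (sq n) + h / 2 ^ n)).
2:{ rewrite boundary_minus, Hg0 by (try easy; lra); ring. }
replace (e * ((w + h) / 2 ^ n) ^ 2) with
  (2 * ((fst (sq n) + w / 2 ^ n - fst (sq n)) + (snd (sq n) + h / 2 ^ n - snd (sq n))) *
   (e / 2 * ((w + h) / 2 ^ n))) by (field; pose proof (Hp2 n); lra).
apply boundary_bound; try lra.
- intros z; destruct (Hf z) as [l1 H1]; destruct (Hg z) as [l2 H2].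
  exists (l1 - l2)%C; now apply Cderiv_minus.
- intros x y Hx' Hy'; specialize (Hcx n); specialize (Hcy n).
  assert (Hz : Cmod ((x, y) - (cx, cy)) <= (w + h) / 2 ^ n).
  { replace ((x, y) - (cx, cy))%C with ((x - cx, y - cy) : C) by (unfold Cminus, Cplus, Copp; simpl; f_equal; ring).
    eapply Rle_trans; [apply Cmod_pair_le|].
    replace ((w + h) / 2 ^ n) with (w / 2 ^ n + h / 2 ^ n) by (field; pose proof (Hp2 n); lra).
    apply Rplus_le_compat; apply Rabs_le; lra. }
  unfold g; replace (f (x, y) - (f (cx, cy) + ((x, y) - (cx, cy)) * l))%C with
    (f (x, y) - f (cx, cy) - ((x, y) - (cx, cy)) * l)%C by ring.
  eapply Rle_trans; [apply Hl'; lra|]; apply Rmult_le_compat_l; lra.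
Qed.

(** Reversing an orientation changes the sign, so the order of the sides is immaterial. *)
Theorem Goursat f x0 x1 y0 y1 : Centire f -> boundary f x0 x1 y0 y1 = 0.
Proof.
intros Hf.
assert (H : forall x0 x1 y0 y1, x0 <= x1 -> boundary f x0 x1 y0 y1 = 0).
{ intros a b c d Hab; destruct (Rle_dec c d) as [H|H]; [now apply Goursat_le|].
  pose proof (boundary_split_y f a b c d c Hf) as E.
  rewrite (Goursat_le f a b c c Hf), (Goursat_le f a b d c Hf) in E by lra.
  replace (boundary f a b c d) with (boundary f a b c d + 0)%C by ring; now rewrite <- E. }
destruct (Rle_dec x0 x1) as [Hx|Hx]; [now apply H|].
pose proof (boundary_split_x f x0 x1 x0 y0 y1 Hf) as E.
rewrite (H x0 x0), (H x1 x0) in E by lra.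
replace (boundary f x0 x1 y0 y1) with (boundary f x0 x1 y0 y1 + 0)%C by ring; now rewrite <- E.
Qed.

(** An entire function has a primitive, its integral along a path with one horizontal and
    one vertical side. *)
Theorem Centire_primitive f : Centire f -> exists F, forall z, Cderiv F z (f z).
Proof.
intros Hf; exists (fun z => CInt (fun t => f (t, 0)) 0 (Re z) + Ci * CInt (fun t => f (Re z, t)) 0 (Im z))%C.
intros [x y]; apply Cderiv_eps; intros eps He.
destruct (Hf (x, y)) as [l Hl].
destruct (Cderiv_cont f (x, y) l Hl (eps / 2) ltac:(lra)) as [d [Hd Hc]].
exists (d / 2); split; [lra|]; intros [u v] Huv; simpl Re; simpl Im.
(* Both paths to the new point differ by the boundary of a rectangle. *)
pose proof (Goursat f x u 0 y Hf) as HG; unfold boundary in HG.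
pose proof (is_CInt_unique _ _ _ _ (is_CInt_Chasles _ _ _ _ _ _ (is_CInt_horizontal f 0 0 x Hf) (is_CInt_horizontal f 0 x u Hf))) as E1.
pose proof (is_CInt_unique _ _ _ _ (is_CInt_Chasles _ _ _ _ _ _ (is_CInt_vertical f u 0 y Hf) (is_CInt_vertical f u y v Hf))) as E2.
rewrite E1, E2.
set (A := CInt (fun t => f (t, y)) x u) in *; set (B := CInt (fun t => f (u, t)) y v) in *.
set (A0 := CInt (fun t => f (t, 0)) x u) in *; set (D1 := CInt (fun t => f (u, t)) 0 y) in *.
set (D0 := CInt (fun t => f (x, t)) 0 y) in *.
set (c := f (x, y)) in *.
assert (E : (((u, v) - (x, y)) * c = (u - x)%R * c + Ci * ((v - y)%R * c))%C).
{ destruct c; unfold Cmult, Cminus, Cplus, Copp, Ci, RtoC; simpl; f_equal; ring. }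
rewrite E.
assert (HA : Cmod (A - (u - x)%R * c) <= Rabs (u - x) * (eps / 2)).
{ apply (is_CInt_bound_const (fun t => f (t, y) - c)%C x u).
  - apply is_CInt_minus; [apply is_CInt_horizontal, Hf|apply is_CInt_const].
  - intros t Ht; left; apply Hc.
    replace ((t, y) - (x, y))%C with ((t - x, 0) : C) by (unfold Cminus, Cplus, Copp; simpl; f_equal; ring).
    eapply Rle_lt_trans; [apply Cmod_pair_le|]; rewrite Rabs_R0, Rplus_0_r.
    apply Rle_lt_trans with (Rabs (u - x)); [revert Ht; unfold Rmin, Rmax, Rabs; repeat destruct Rle_dec; repeat destruct Rcase_abs; lra|].
    eapply Rle_lt_trans; [apply (re_le_Cmod ((u, v) - (x, y)))|lra]. }
assert (HB : Cmod (B - (v - y)%R * c) <= Rabs (v - y) * (eps / 2)).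
{ apply (is_CInt_bound_const (fun t => f (u, t) - c)%C y v).
  - apply is_CInt_minus; [apply is_CInt_vertical, Hf|apply is_CInt_const].
  - intros t Ht; left; apply Hc.
    replace ((u, t) - (x, y))%C with ((u - x, t - y) : C) by (unfold Cminus, Cplus, Copp; simpl; f_equal; ring).
    eapply Rle_lt_trans; [apply Cmod_pair_le|].
    pose proof (re_le_Cmod ((u, v) - (x, y))) as T1; simpl in T1.
    pose proof (im_le_Cmod ((u, v) - (x, y))) as T2; simpl in T2.
    assert (Rabs (t - y) <= Rabs (v - y)) by (revert Ht; unfold Rmin, Rmax, Rabs; repeat destruct Rle_dec; repeat destruct Rcase_abs; lra).
    unfold Rminus in *; lra. }
replace (CInt (fun t => f (t, 0)) 0 x + A0 + Ci * (D1 + B) - (CInt (fun t => f (t, 0)) 0 x + Ci * D0) - ((u - x)%R * c + Ci * ((v - y)%R * c)))%C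
  with ((A0 - A + Ci * (D1 - D0)) + (A - (u - x)%R * c) + Ci * (B - (v - y)%R * c))%C by ring.
rewrite HG, Cplus_0_l.
eapply Rle_trans; [apply Cmod_triangle|]; rewrite Cmod_mult, Cmod_Ci, Rmult_1_l.
pose proof (re_le_Cmod ((u, v) - (x, y))) as T1; simpl in T1.
pose proof (im_le_Cmod ((u, v) - (x, y))) as T2; simpl in T2.
unfold Rminus in *; nra.
Qed.

(** * The maximum principle on circles and analytic continuation *)

Lemma Centire_comp f g : Centire f -> Centire g -> Centire (fun z => f (g z)).
Proof. intros Hf Hg z; now apply Cdiff_comp. Qed.

Lemma Centire_plus f g : Centire f -> Centire g -> Centire (fun z => f z + g z)%C.
Proof. intros Hf Hg z; now apply Cdiff_plus. Qed.

Lemma Centire_minus f g : Centire f -> Centire g -> Centire (fun z => f z - g z)%C.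
Proof. intros Hf Hg z; now apply Cdiff_minus. Qed.

Lemma Centire_mult f g : Centire f -> Centire g -> Centire (fun z => f z * g z)%C.
Proof. intros Hf Hg z; now apply Cdiff_mult. Qed.

Lemma Centire_const c : Centire (fun _ => c).
Proof. intros z; apply Cdiff_const. Qed.

Lemma Centire_id : Centire (fun z => z).
Proof. intros z; apply Cdiff_id. Qed.

Lemma Centire_Cexp : Centire Cexp.
Proof. intros z; exists (Cexp z); apply Cderiv_Cexp. Qed.

Lemma Centire_opp : Centire Copp.
Proof. intros z; eexists; apply (Cderiv_opp (fun z => z)), Cderiv_id. Qed.

(** In the coordinate z + e^w concentric circles about z are vertical segments of length
    2 pi, so Cauchy's theorem for rectangles yields the mean value property. *)
Theorem max_on_circle g z v M : Centire g ->
  (forall t, 0 <= t <= 2 * PI -> Cmod (g (z + Cexp (v, t))%C) <= M) -> Cmod (g z) <= M.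
Proof.
intros Hg HM.
assert (HH : Centire (fun w => g (z + Cexp w)%C)).
{ apply (Centire_comp g); [easy|]; apply (Centire_plus (fun _ => z)); [apply Centire_const|apply Centire_Cexp]. }
pose proof PI_RGT_0 as Hpi.
apply le_epsilon; intros eps He.
destruct (Hg z) as [l Hl]; destruct (Cderiv_cont g z l Hl eps He) as [d [Hd Hc]].
set (u := ln (d / 2)).
pose proof (Goursat _ u v 0 (2 * PI) HH) as HG; unfold boundary in HG.
set (A := CInt (fun t => g (z + Cexp (v, t))%C) 0 (2 * PI)) in *.
set (B := CInt (fun t => g (z + Cexp (u, t))%C) 0 (2 * PI)) in *.
assert (E : forall t, Cexp (t, (2 * PI)%R) = Cexp (t, 0)).
{ intros t; unfold Cexp; simpl; now rewrite cos_2PI, sin_2PI, cos_0, sin_0. }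
assert (EI : CInt (fun t => g (z + Cexp (t, (2 * PI)%R))%C) u v = CInt (fun t => g (z + Cexp (t, 0))%C) u v).
{ apply (is_CInt_unique); eapply is_CInt_ext; [|apply (is_CInt_horizontal _ 0 u v HH)].
  intros t _; cbv beta; now rewrite E. }
rewrite EI in HG.
assert (HAB : A = B).
{ assert (H : (Ci * (A - B))%C = 0) by (rewrite <- HG; ring).
  replace A with ((- Ci) * (Ci * (A - B)) + B)%C by
   (destruct A, B; unfold Ci, Cmult, Cplus, Cminus, Copp; simpl; f_equal; ring).
  rewrite H; ring. }
assert (HA : Cmod A <= 2 * PI * M).
{ replace (2 * PI) with (Rabs (2 * PI - 0)) by (rewrite Rabs_pos_eq; lra).
  apply (is_CInt_bound_const _ _ _ _ _ (is_CInt_vertical _ v 0 (2 * PI) HH)).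
  rewrite Rmin_left, Rmax_right by lra; exact HM. }
assert (HB : Cmod (B - (2 * PI - 0)%R * g z) <= 2 * PI * eps).
{ replace (2 * PI * eps) with (Rabs (2 * PI - 0) * eps) by (rewrite Rabs_pos_eq; lra).
  apply (is_CInt_bound_const (fun t => g (z + Cexp (u, t)) - g z)%C 0 (2 * PI)).
  - apply is_CInt_minus; [apply (is_CInt_vertical _ u 0 (2 * PI) HH)|apply is_CInt_const].
  - intros t _; left; apply Hc.
    replace (z + Cexp (u, t) - z)%C with (Cexp (u, t)) by ring.
    rewrite Cmod_Cexp; simpl; unfold u; rewrite exp_ln; lra. }
rewrite Rminus_0_r in HB.
assert (HC : 2 * PI * Cmod (g z) <= 2 * PI * M + 2 * PI * eps).
{ replace (2 * PI * Cmod (g z)) with (Cmod ((2 * PI)%R * g z)) by (rewrite Cmod_mult, Cmod_R, Rabs_pos_eq; lra).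
  replace ((2 * PI)%R * g z)%C with (B - (B - (2 * PI)%R * g z))%C by ring.
  unfold Cminus at 1; eapply Rle_trans; [apply Cmod_triangle|]; rewrite Cmod_opp, <- HAB; rewrite <- HAB in HB; lra. }
apply Rmult_le_reg_l with (2 * PI); lra.
Qed.

Lemma Rderiv_circle v t : Rderiv (fun t => Cexp (v, t)) t (Cexp (v, t) * Ci).
Proof. apply (Cderiv_Rderiv_comp Cexp (fun t => (v, t))); [apply Cderiv_Cexp|apply Rderiv_vertical]. Qed.

Lemma bounded_on_circle h z v : Centire h ->
  exists M, forall t, 0 <= t <= 2 * PI -> Cmod (h (z + Cexp (v, t))%C) <= M.
Proof.
intros Hh; pose proof PI_RGT_0 as Hpi.
destruct (continuity_ab_maj (fun t => Cmod (h (z + Cexp (v, t))%C)) 0 (2 * PI)) as [c [Hc _]]; [lra| |].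
- intros t _; apply continuity_pt_filterlim.
  destruct (Hh (z + Cexp (v, t))%C) as [l Hl].
  assert (H : Ccont (fun t => h (z + Cexp (v, t))%C) t).
  { eapply Rderiv_Ccont; apply (Cderiv_Rderiv_comp h); [exact Hl|].
    apply Rderiv_plus; [apply Rderiv_const|apply Rderiv_circle]. }
  apply (continuous_ext (T:=R_UniformSpace) (U:=R_UniformSpace) (fun t => @norm R_AbsRing C_R_NormedModule (h (z + Cexp (v, t))%C))).
  { intros u; symmetry; apply Cmod_norm. }
  apply (continuous_comp (U:=R_UniformSpace) (V:=C_R_NormedModule) (W:=R_UniformSpace) _
    (@norm R_AbsRing C_R_NormedModule) t H).
  exact (filterlim_norm (V:=C_R_NormedModule) (h (z + Cexp (v, t))%C)).
- exists (Cmod (h (z + Cexp (v, c))%C)); exact Hc.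
Qed.

(** Let z be measured from a point slightly below the centre of a circle. The real part of
    -z^2 + iAz, with A twice the radius, is larger at the centre than on the part of the
    circle in the half-plane Im z >= 0, so that a high power of the exponential of this
    function suppresses the values of [h] there; on the other part they are 0. *)
Lemma vanish_extends_upwards h c W : Centire h -> 0 < W ->
  (forall z, c - W < Im z < c -> h z = 0) ->
  forall z, c - W < Im z < c + W / 8 -> h z = 0.
Proof.
intros Hh HW H0 z [Hz1 Hz2].
destruct (Rlt_dec (Im z) c) as [Hz|Hz]; [apply H0; lra|apply Rnot_lt_le in Hz].
(* The circle has radius W/2 and so stays above Im = c - W; its centre is W/8 above the line
   Im = c', with c' < c, to which the exponential is adapted. *)
set (dl := W / 8); set (r := 4 * dl); assert (Hdl : 0 < dl) by (unfold dl; lra).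
set (m := (Re z, Im z - dl) : C).
set (phi := fun w : C => (- ((w - m) * (w - m)) + Ci * (2 * r)%R * (w - m))%C).
assert (Hphi : Centire phi).
{ unfold phi; apply (Centire_plus (fun w => - ((w - m) * (w - m)))%C).
  - apply (Centire_comp Copp); [apply Centire_opp|].
    apply Centire_mult; (apply (Centire_minus (fun z => z) (fun _ => m)); [apply Centire_id|apply Centire_const]).
  - apply (Centire_mult (fun _ => Ci * (2 * r)%R)%C); [apply Centire_const|].
    apply (Centire_minus (fun z => z) (fun _ => m)); [apply Centire_id|apply Centire_const]. }
assert (Ephi : forall w, Re (phi w) = - (Re w - Re z) ^ 2 + (Im w - Im z + dl) ^ 2 - 2 * r * (Im w - Im z + dl)).
{ intros [x y]; unfold phi, m, Ci, RtoC; simpl; ring. }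
destruct (bounded_on_circle h z (ln r) Hh) as [M HM].
assert (HM0 : 0 <= M).
{ eapply Rle_trans; [apply Cmod_ge_0|apply (HM 0)]; pose proof PI_RGT_0; lra. }
assert (Hkey : forall n, Cmod (h z) * exp (INR n * (dl ^ 2 - 2 * r * dl)) <= M * exp (INR n * (dl ^ 2 - r ^ 2))).
{ intros n.
  assert (HE : Centire (fun w => h w * Cexp (INR n * phi w))%C).
  { apply Centire_mult; [easy|]; apply (Centire_comp Cexp); [apply Centire_Cexp|].
    apply (Centire_mult (fun _ => RtoC (INR n))); [apply Centire_const|easy]. }
  replace (Cmod (h z) * exp (INR n * (dl ^ 2 - 2 * r * dl))) with (Cmod (h z * Cexp (INR n * phi z))).
  2:{ rewrite Cmod_mult, Cmod_Cexp, re_scal_l, Ephi; f_equal; f_equal; ring. }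
  apply (max_on_circle (fun w => h w * Cexp (INR n * phi w))%C z (ln r)); [exact HE|].
  intros t Ht; set (w := (z + Cexp (ln r, t))%C).
  assert (Ew : Re w = Re z + r * cos t /\ Im w = Im z + r * sin t).
  { unfold w, Cexp; simpl; rewrite exp_ln by (unfold r; lra); auto. }
  destruct Ew as [Ew1 Ew2].
  rewrite Cmod_mult, Cmod_Cexp, re_scal_l, Ephi.
  pose proof (sin2_cos2 t) as Hsc; unfold Rsqr in Hsc.
  pose proof (SIN_bound t) as Hs.
  destruct (Rlt_dec (Im w - Im z + dl) 0) as [Hn|Hn].
  - rewrite (H0 w), Cmod_0, Rmult_0_l.
    + apply Rmult_le_pos; [easy|left; apply exp_pos].
    + rewrite Ew2 in *; unfold r, dl in *; nra.
  - apply Rnot_lt_le in Hn.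
    apply Rmult_le_compat; [apply Cmod_ge_0|left; apply exp_pos|now apply HM|].
    apply exp_mono; apply Rmult_le_compat_l; [apply pos_INR|].
    rewrite Ew1, Ew2; rewrite Ew2 in Hn.
    set (Y := Im z + r * sin t - Im z + dl) in *.
    replace (- (Re z + r * cos t - Re z) ^ 2) with ((Y - dl) ^ 2 - r ^ 2).
    + assert (Y <= r + dl) by (unfold Y, r; nra). nra.
    + unfold Y; replace ((Im z + r * sin t - Im z + dl - dl) ^ 2 - r ^ 2) with
        (r * r * (sin t * sin t) - r * r * 1) by ring.
      rewrite <- Hsc; ring. }
apply Cmod_eq_0; apply Rle_antisym; [|apply Cmod_ge_0].
apply Rnot_lt_le; intros Hpos.
destruct (INR_unbounded (M / (8 * dl ^ 2 * Cmod (h z)))) as [n Hn].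
specialize (Hkey n).
replace (INR n * (dl ^ 2 - 2 * r * dl)) with (INR n * (dl ^ 2 - r ^ 2) + INR n * (8 * dl ^ 2)) in Hkey by (unfold r; ring).
rewrite exp_plus in Hkey.
set (E := exp (INR n * (dl ^ 2 - r ^ 2))) in *; assert (HE : 0 < E) by apply exp_pos.
assert (H1 : Cmod (h z) * exp (INR n * (8 * dl ^ 2)) <= M).
{ apply Rmult_le_reg_r with E; [easy|]; lra. }
pose proof (exp_ineq1_le (INR n * (8 * dl ^ 2))) as H2.
assert (P : 0 < 8 * dl ^ 2 * Cmod (h z)) by (repeat apply Rmult_lt_0_compat; lra).
apply Rgt_lt, (Rmult_lt_compat_r _ _ _ P) in Hn.
unfold Rdiv in Hn; rewrite Rmult_assoc, Rinv_l in Hn by lra.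
nra.
Qed.

(** Vanishing spreads upwards in steps proportional to the width of the strip, and downwards
    by the symmetry z -> -z. *)
Theorem identity_strip h b : Centire h -> 0 < b -> (forall z, Rabs (Im z) < b -> h z = 0) ->
  forall z, h z = 0.
Proof.
assert (H : forall h, Centire h -> 0 < b -> (forall z, Rabs (Im z) < b -> h z = 0) ->
  forall n z, - b < Im z < b + INR n * (b / 4) -> h z = 0).
{ clear h; intros h Hh Hb H0 n; induction n as [|n IH]; intros z Hz.
  - apply H0; simpl in Hz; apply Rabs_def1; lra.
  - rewrite S_INR in Hz; pose proof (pos_INR n).
    destruct (Rlt_dec (Im z) (b + INR n * (b / 4))) as [Hl|Hl]; [apply IH; lra|].
    apply (vanish_extends_upwards h (b + INR n * (b / 4)) (2 * b)); [easy|lra| |nra].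
    intros w Hw; apply IH; nra. }
intros Hh Hb H0.
assert (Hup : forall h, Centire h -> (forall z, Rabs (Im z) < b -> h z = 0) -> forall z, - b < Im z -> h z = 0).
{ clear h Hh H0; intros h Hh H0 z Hz.
  destruct (INR_unbounded (Im z / (b / 4))) as [n Hn].
  apply (H h Hh Hb H0 n); split; [easy|].
  apply Rgt_lt, (Rmult_lt_compat_r (b / 4)) in Hn; [|lra].
  replace (Im z / (b / 4) * (b / 4)) with (Im z) in Hn by (field; lra); lra. }
intros z; destruct (Rlt_dec (- b) (Im z)) as [Hz|Hz]; [now apply Hup|].
replace z with (- (- z))%C by ring.
apply (Hup (fun w => h (- w)%C)).
- apply (Centire_comp h Copp); [easy|apply Centire_opp].
- intros w Hw; apply H0; rewrite im_opp, Rabs_Ropp; easy.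
- rewrite im_opp; lra.
Qed.

(** The substitution s = 1 + e^w unwinds the punctured plane to the plane, and the half-plane
    to the strip |Im w| < pi/2 and its translates. *)
Theorem identity_punctured (f g : C -> C) :
  (forall s : C, s <> 1 -> exists l, Cderiv f s l) -> (forall s : C, s <> 1 -> exists l, Cderiv g s l) ->
  (forall s, 1 < Re s -> f s = g s) -> forall s : C, s <> 1 -> f s = g s.
Proof.
intros Hf Hg Hfg s Hs.
assert (H : forall w, (f (1 + Cexp w) - g (1 + Cexp w))%C = 0).
{ apply (identity_strip (fun w => f (1 + Cexp w) - g (1 + Cexp w))%C (PI / 2)).
  - intros w.
    assert (Hw : (1 + Cexp w)%C <> 1).
    { intros E; apply (Cexp_neq_0 w); replace (Cexp w) with ((1 + Cexp w) - 1)%C by ring; rewrite E; ring. }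
    assert (Hd : Cderiv (fun w => 1 + Cexp w)%C w (0 + Cexp w)%C).
    { apply (Cderiv_plus (fun _ => RtoC 1)); [apply Cderiv_const|apply Cderiv_Cexp]. }
    destruct (Hf _ Hw) as [l Hl]; destruct (Hg _ Hw) as [m Hm].
    eexists; apply Cderiv_minus.
    + apply (Cderiv_comp f (fun w => 1 + Cexp w)%C); [exact Hl|exact Hd].
    + apply (Cderiv_comp g (fun w => 1 + Cexp w)%C); [exact Hm|exact Hd].
  - pose proof PI_RGT_0; lra.
  - intros w Hw; apply Rabs_def2 in Hw; rewrite Hfg; [ring|].
    rewrite re_plus; unfold Cexp; simpl.
    pose proof (cos_gt_0 (Im w) ltac:(lra) ltac:(lra)); pose proof (exp_pos (Re w)); nra. }
assert (Hs1 : (s - 1)%C <> 0) by now apply Cminus_eq_contra.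
specialize (H (Clog (s - 1))); rewrite Cexp_Clog in H by easy.
replace (1 + (s - 1))%C with s in H by ring.
now apply Ceq_minus.
Qed.

(** * The principal logarithm along horizontal rays *)

Lemma Re_polar (z : C) : z <> 0 -> Re z = Cmod z * cos (Carg z).
Proof.
intros Hz; rewrite <- (Cexp_Clog z Hz) at 1; unfold Cexp, Clog; simpl.
rewrite exp_ln; [easy|now apply Cmod_gt_0].
Qed.

Lemma Im_polar (z : C) : z <> 0 -> Im z = Cmod z * sin (Carg z).
Proof.
intros Hz; rewrite <- (Cexp_Clog z Hz) at 1; unfold Cexp, Clog; simpl.
rewrite exp_ln; [easy|now apply Cmod_gt_0].
Qed.

(** In the upper half-plane the argument is pi/2 - atan(x/y), a form that is differentiable
    across x = 0. *)
Lemma acos_quotient x y : 0 < y -> acos (x / Cmod (x, y)) = PI / 2 - atan (x / y).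
Proof.
intros Hy; pose proof (atan_bound (x / y)) as [H1 H2].
rewrite <- (acos_cos (PI / 2 - atan (x / y))) by lra; f_equal.
rewrite cos_shift, sin_atan.
unfold Cmod, fst, snd; replace (x ^ 2 + y ^ 2) with (y ^ 2 * (1 + (x / y)²)) by (unfold Rsqr; field; lra).
rewrite sqrt_mult_alt, sqrt_pow2 by (try apply pow2_ge_0; lra).
assert (0 < sqrt (1 + (x / y)²)) by (apply sqrt_lt_R0; pose proof (Rle_0_sqr (x / y)); lra).
field; lra.
Qed.

Lemma Carg_upper x y : 0 < y -> Carg (x, y) = PI / 2 - atan (x / y).
Proof.
intros Hy; unfold Carg; simpl Im; simpl Re; destruct Rle_dec; [|lra]; now apply acos_quotient.
Qed.

Lemma Carg_lower x y : y < 0 -> Carg (x, y) = - (PI / 2) - atan (x / y).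
Proof.
intros Hy; unfold Carg; simpl Im; simpl Re; destruct Rle_dec; [lra|].
replace (Cmod (x, y)) with (Cmod (x, - y)) by (unfold Cmod; simpl; f_equal; ring).
rewrite acos_quotient by lra.
replace (x / - y) with (- (x / y)) by (field; lra); rewrite atan_opp; lra.
Qed.

Lemma Carg_positive x : 0 < x -> Carg (x, 0) = 0.
Proof.
intros Hx; unfold Carg; simpl Im; simpl Re; destruct Rle_dec; [|lra].
replace (x / Cmod (x, 0)) with 1; [apply acos_1|].
change (x, 0) with (RtoC x); rewrite Cmod_R, Rabs_pos_eq by lra; field; lra.
Qed.

Definition off_cut (z : C) : Prop := 0 < Re z \/ Im z <> 0.

Lemma off_cut_neq_0 (z : C) : off_cut z -> z <> 0.
Proof. intros [H|H] ->; simpl in H; lra. Qed.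

Lemma off_cut_arg (a : C) : a <> 0 -> Rabs (Carg a) < PI -> off_cut a.
Proof.
intros Ha H; destruct a as [x y]; unfold off_cut; simpl.
destruct (Req_dec y 0) as [->|Hy]; [left|now right].
apply Rnot_le_lt; intros Hx.
assert (Hx' : x < 0) by (destruct Hx as [Hx| ->]; [easy|exfalso; now apply Ha]).
revert H; unfold Carg; simpl Im; simpl Re; destruct Rle_dec; [|lra].
replace (x / Cmod (x, 0)) with (- (1)).
- rewrite acos_opp, acos_1, Rabs_pos_eq; pose proof PI_RGT_0; lra.
- change (x, 0) with (RtoC x); rewrite Cmod_R, Rabs_left by lra; field; lra.
Qed.

Lemma off_cut_shift (a : C) (x : R) : off_cut a -> 0 <= x -> off_cut (x + a).
Proof.
destruct a as [u v]; unfold off_cut; simpl; intros [H|H] Hx; [left; lra|right; lra].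
Qed.

Lemma Carg_off_cut z : off_cut z -> Rabs (Carg z) < PI.
Proof.
destruct z as [x y]; unfold off_cut; simpl; intros H.
pose proof PI_RGT_0; pose proof (atan_bound (x / y)).
destruct (Rtotal_order y 0) as [Hy|[->|Hy]].
- rewrite Carg_lower by easy; apply Rabs_def1; lra.
- rewrite Carg_positive, Rabs_R0 by lra; lra.
- rewrite Carg_upper by lra; apply Rabs_def1; lra.
Qed.

Lemma Clog_Cexp l : Rabs (Im l) < PI -> Clog (Cexp l) = l.
Proof.
destruct l as [x y]; simpl; intros Hy; apply Rabs_def2 in Hy.
unfold Clog; rewrite Cmod_Cexp; simpl; rewrite ln_exp; f_equal.
unfold Carg; rewrite Cmod_Cexp; unfold Cexp; simpl.
pose proof (exp_pos x).
replace (exp x * cos y / exp x) with (cos y) by (field; lra).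
destruct Rle_dec as [H1|H1].
- destruct (Rlt_dec y 0) as [Hn|Hn].
  + pose proof (sin_gt_0 (- y) ltac:(lra) ltac:(lra)) as H2; rewrite sin_neg in H2; nra.
  + apply acos_cos; lra.
- destruct (Rlt_dec 0 y) as [Hn|Hn].
  + exfalso; apply H1; pose proof (sin_gt_0 y ltac:(lra) ltac:(lra)); nra.
  + rewrite <- cos_neg, acos_cos; lra.
Qed.

Lemma Cexp_off_cut l : Rabs (Im l) < PI -> off_cut (Cexp l).
Proof.
destruct l as [x y]; simpl; intros Hy; apply Rabs_def2 in Hy.
unfold off_cut, Cexp; simpl; pose proof (exp_pos x).
destruct (Req_dec y 0) as [->|Hy0].
- left; rewrite cos_0; lra.
- right; apply Rmult_integral_contrapositive; split; [lra|].
  intros H0; destruct (Rtotal_order y 0) as [H1|[H1|H1]]; [|easy|].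
  + pose proof (sin_gt_0 (- y) ltac:(lra) ltac:(lra)) as H2; rewrite sin_neg in H2; lra.
  + pose proof (sin_gt_0 y ltac:(lra) ltac:(lra)); lra.
Qed.

Lemma Rderiv_Clog (a : C) (x : R) : off_cut (x + a) -> Rderiv (fun t => Clog (t + a)) x (/ (x + a))%C.
Proof.
destruct a as [u v]; intros H.
pose proof (off_cut_neq_0 _ H) as H0.
assert (P : 0 < (x + u) ^ 2 + v ^ 2).
{ destruct (Req_dec v 0) as [Hv|Hv].
  - destruct H as [H|H]; simpl in H; [|lra]; nra.
  - pose proof (pow2_gt_0 v Hv); pose proof (pow2_ge_0 (x + u)); lra. }
assert (E : (/ (x + (u, v)))%C = ((x + u) / ((x + u) ^ 2 + v ^ 2), - v / ((x + u) ^ 2 + v ^ 2))).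
{ unfold Cinv, Cplus, RtoC; simpl; f_equal; field; simpl in P; lra. }
rewrite E; clear E; apply Rderiv_pair; unfold Clog.
- apply (is_derive_ext (fun t => ln (sqrt ((t + u) ^ 2 + v ^ 2)))).
  { intros t; cbv beta; unfold Cmod, Cplus, RtoC, Re, fst, snd; f_equal; f_equal; ring. }
  assert (Hs : 0 < sqrt ((x + u) ^ 2 + v ^ 2)) by now apply sqrt_lt_R0.
  unfold Re, fst; auto_derive; [simpl in P, Hs |- *; split; [|split]; try easy; lra|].
  pose proof (sqrt_sqrt ((x + u) ^ 2 + v ^ 2) ltac:(lra)) as Hss.
  set (q := sqrt ((x + u) ^ 2 + v ^ 2)) in *.
  replace ((x + u) * ((x + u) * 1) + v * (v * 1)) with ((x + u) ^ 2 + v ^ 2) by ring.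
  fold q; rewrite <- Hss; field; lra.
- unfold Im, snd.
  apply (is_derive_ext (fun t => Carg (t + u, v))).
  { intros t; cbv beta; unfold Cplus, RtoC, fst, snd; f_equal; f_equal; ring. }
  destruct (Rtotal_order v 0) as [Hv|[Hv|Hv]].
  + apply (is_derive_ext (fun t => - (PI / 2) - atan ((t + u) / v))).
    { intros t; now rewrite Carg_lower. }
    auto_derive; [easy|].
    field; repeat split; try lra; simpl in P; nra.
  + subst v; destruct H as [H|H]; simpl in H; [|lra].
    apply (is_derive_ext_loc (fun _ => 0)).
    * exists (mkposreal _ H); intros t Ht.
      change (Rabs (t - x) < x + u) in Ht; apply Rabs_def2 in Ht.
      rewrite Carg_positive; lra.
    * replace (- 0 / _) with 0 by (field; simpl in P |- *; nra).
      exact (is_derive_const (V:=R_NormedModule) 0 x).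
  + apply (is_derive_ext (fun t => PI / 2 - atan ((t + u) / v))).
    { intros t; now rewrite Carg_upper. }
    auto_derive; [easy|].
    field; repeat split; try lra; simpl in P; nra.
Qed.

(** By the arctangent formulas, in which the imaginary part fixes the branch. *)
Lemma Carg_shift (a : C) (x : R) : off_cut a -> 0 <= x ->
  (0 <= Carg (x + a) <= Carg a) \/ (Carg a <= Carg (x + a) <= 0).
Proof.
destruct a as [u v]; intros H Hx.
replace (x + (u, v))%C with ((x + u, v) : C) by (unfold Cplus, RtoC; simpl; f_equal; ring).
destruct (Rtotal_order v 0) as [Hv|[Hv|Hv]].
- right; rewrite !Carg_lower by easy.
  pose proof (atan_bound ((x + u) / v)).
  assert (Hle : (x + u) / v <= u / v).
  { unfold Rdiv; pose proof (Rinv_lt_0_compat v Hv); nra. }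
  destruct Hle as [Hle|Hle]; [apply atan_increasing in Hle; lra|rewrite Hle in *; lra].
- subst v; destruct H as [H|H]; simpl in H; [|lra]; left.
  rewrite !Carg_positive by lra; lra.
- left; rewrite !Carg_upper by easy.
  pose proof (atan_bound ((x + u) / v)).
  assert (Hle : u / v <= (x + u) / v).
  { unfold Rdiv; pose proof (Rinv_0_lt_compat v Hv); nra. }
  destruct Hle as [Hle|Hle]; [apply atan_increasing in Hle; lra|rewrite <- Hle in *; lra].
Qed.

Lemma Cmod2_shift (a : C) (x : R) : a <> 0 -> Cmod (x + a) ^ 2 = x ^ 2 + 2 * x * Cmod a * cos (Carg a) + Cmod a ^ 2.
Proof.
intros Ha; rewrite Cmod2_alt, re_plus, im_plus; simpl Re; simpl Im.
rewrite Re_polar, Im_polar by easy.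
pose proof (sin2_cos2 (Carg a)) as H; unfold Rsqr in H.
replace (x ^ 2 + 2 * x * Cmod a * cos (Carg a) + Cmod a ^ 2) with
  (x ^ 2 + 2 * x * Cmod a * cos (Carg a) + Cmod a ^ 2 * 1) by ring.
rewrite <- H; ring.
Qed.

Lemma cos_half_arg_pos a : Rabs (Carg a) < PI -> 0 < cos (Carg a / 2).
Proof. intros H; apply Rabs_def2 in H; apply cos_gt_0; lra. Qed.

(** The difference of the squares is sin^2(arg a / 2) (x - |a|)^2. *)
Lemma Cmod_shift_ge (a : C) (x : R) : a <> 0 -> Rabs (Carg a) < PI -> 0 <= x ->
  (x + Cmod a) * cos (Carg a / 2) <= Cmod (x + a).
Proof.
intros Ha Harg Hx.
assert (H0 := cos_half_arg_pos a Harg); assert (Hp := proj1 (Cmod_gt_0 a) Ha).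
apply Rsqr_incr_0; [|apply Rmult_le_pos; lra|apply Cmod_ge_0].
rewrite !Rsqr_pow2, Cmod2_shift by easy.
replace (cos (Carg a)) with (2 * (cos (Carg a / 2)) ^ 2 - 1).
2:{ replace (Carg a) with (2 * (Carg a / 2)) at 2 by field; rewrite cos_2a_cos; ring. }
set (c := cos (Carg a / 2)) in *.
assert (Hc : c <= 1) by (apply COS_bound).
assert (P : 0 <= (1 - c ^ 2) * (x - Cmod a) ^ 2).
{ apply Rmult_le_pos; [nra|apply pow2_ge_0]. }
nra.
Qed.

Lemma Cmod_shift_le (a : C) (x : R) : 0 <= x -> Cmod (x + a) <= x + Cmod a.
Proof.
intros Hx; eapply Rle_trans; [apply Cmod_triangle|]; rewrite Cmod_R, Rabs_pos_eq; lra.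
Qed.

(** Since |x + a| lies between two positive multiples of 1 + x, powers of x + a may be
    compared with powers of 1 + x. *)
Lemma Clog_shift_bound (a : C) : a <> 0 -> Rabs (Carg a) < PI ->
  exists D, 0 < D /\ forall x, 0 <= x ->
    Rabs (Re (Clog (x + a)) - ln (1 + x)) <= D /\ Rabs (Im (Clog (x + a))) <= D.
Proof.
intros Ha Harg.
assert (H0 := cos_half_arg_pos a Harg); assert (Hp := proj1 (Cmod_gt_0 a) Ha).
set (c := cos (Carg a / 2)) in *.
set (m := Rmin 1 (Cmod a) * c); set (M := Rmax 1 (Cmod a)).
assert (Hm : 0 < m) by (apply Rmult_lt_0_compat; [apply Rmin_pos; lra|easy]).
assert (HM : 1 <= M) by apply Rmax_l.
exists (Rabs (ln m) + Rabs (ln M) + PI).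
pose proof PI_RGT_0 as Q1; pose proof (Rabs_pos (ln m)) as Q2; pose proof (Rabs_pos (ln M)) as Q3.
split; [lra|]; intros x Hx; split.
- assert (H1 : m * (1 + x) <= Cmod (x + a)).
  { eapply Rle_trans; [|now apply Cmod_shift_ge]; fold c; unfold m.
    rewrite (Rmult_assoc), (Rmult_comm c), <- Rmult_assoc; apply Rmult_le_compat_r; [lra|].
    pose proof (Rmin_l 1 (Cmod a)); pose proof (Rmin_r 1 (Cmod a)); nra. }
  assert (H2 : Cmod (x + a) <= M * (1 + x)).
  { eapply Rle_trans; [now apply Cmod_shift_le|]; unfold M.
    pose proof (Rmax_l 1 (Cmod a)); pose proof (Rmax_r 1 (Cmod a)); nra. }
  assert (H3 : 0 < m * (1 + x)) by nra.
  assert (H4 : 0 < Cmod (x + a)) by lra.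
  unfold Clog; simpl Re.
  apply ln_le in H1; [|easy]; rewrite ln_mult in H1 by lra.
  apply ln_le in H2; [|lra]; rewrite ln_mult in H2 by lra.
  pose proof (Rle_abs (ln M)); pose proof (Rle_abs (- ln m)) as H6; rewrite Rabs_Ropp in H6.
  apply Rabs_le; lra.
- change (Rabs (Carg (x + a)) <= Rabs (ln m) + Rabs (ln M) + PI).
  pose proof (Carg_off_cut _ (off_cut_shift a x (off_cut_arg a Ha Harg) Hx)); lra.
Qed.

(** The principal value of (x + a)^(-z). *)
Definition shifted_power (a z : C) (x : R) : C := Cexp (- (z * Clog (x + a))).

Lemma shifted_power_deriv a z x : off_cut a -> 0 <= x ->
  Rderiv (shifted_power a z) x (- z * shifted_power a (z + 1) x).
Proof.
intros Ha Hx; assert (H := off_cut_shift a x Ha Hx).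
eapply Rderiv_eq.
- apply (Cderiv_Rderiv_comp Cexp (fun t : R => - (z * Clog (t + a)))%C); [apply Cderiv_Cexp|].
  apply Rderiv_opp, Rderiv_scal, Rderiv_Clog, H.
- unfold shifted_power.
  replace (- ((z + 1) * Clog (x + a)))%C with (- (z * Clog (x + a)) + - Clog (x + a))%C by ring.
  rewrite Cexp_plus, (Cexp_opp (Clog (x + a))), Cexp_Clog by now apply off_cut_neq_0.
  ring.
Qed.

Lemma Cmod_shifted_power a z x :
  Cmod (shifted_power a z x) = exp (- Re z * Re (Clog (x + a)) + Im z * Im (Clog (x + a))).
Proof.
unfold shifted_power; rewrite Cmod_Cexp; f_equal; rewrite re_opp, re_mult; ring.
Qed.

Lemma shifted_power_bound (a : C) : a <> 0 -> Rabs (Carg a) < PI ->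
  exists D, 0 < D /\ forall z x, 0 <= x ->
    Cmod (shifted_power a z x) <= exp ((Rabs (Re z) + Rabs (Im z)) * D) * exp (- Re z * ln (1 + x)).
Proof.
intros Ha Harg; destruct (Clog_shift_bound a Ha Harg) as [D [HD H]].
exists D; split; [easy|]; intros z x Hx; specialize (H x Hx) as [H1 H2].
rewrite Cmod_shifted_power, <- exp_plus; apply exp_mono.
set (p := Re (Clog (x + a))) in *; set (q := Im (Clog (x + a))) in *.
replace (- Re z * p + Im z * q) with ((- Re z * (p - ln (1 + x)) + Im z * q) + - Re z * ln (1 + x)) by ring.
apply Rplus_le_compat_r; eapply Rle_trans; [apply Rle_abs|]; eapply Rle_trans; [apply Rabs_triang|].
rewrite !Rabs_mult, Rabs_Ropp.
pose proof (Rabs_pos (Re z)); pose proof (Rabs_pos (Im z)); nra.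
Qed.

(** * Sequences and finite sums of complex numbers *)

Definition Cconv (u : nat -> C) (l : C) : Prop :=
  forall eps, 0 < eps -> exists N, forall n, (N <= n)%nat -> Cmod (u n - l) < eps.

Lemma Cconv_unique u l m : Cconv u l -> Cconv u m -> l = m.
Proof.
intros Hl Hm; apply Ceq_minus, Cmod_eq_0; apply Rle_antisym; [|apply Cmod_ge_0].
apply le_epsilon; intros eps He.
destruct (Hl (eps / 2) ltac:(lra)) as [N1 H1]; destruct (Hm (eps / 2) ltac:(lra)) as [N2 H2].
specialize (H1 (N1 + N2)%nat ltac:(lia)); specialize (H2 (N1 + N2)%nat ltac:(lia)).
pose proof (Cmod_triangle' l (u (N1 + N2)%nat) m) as T; rewrite (Cmod_sub_sym l (u _)) in T; lra.
Qed.

Lemma Cconv_plus u v l m : Cconv u l -> Cconv v m -> Cconv (fun n => u n + v n)%C (l + m)%C.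
Proof.
intros Hl Hm eps He.
destruct (Hl (eps / 2) ltac:(lra)) as [N1 H1]; destruct (Hm (eps / 2) ltac:(lra)) as [N2 H2].
exists (N1 + N2)%nat; intros n Hn; specialize (H1 n ltac:(lia)); specialize (H2 n ltac:(lia)).
replace (u n + v n - (l + m))%C with ((u n - l) + (v n - m))%C by ring.
eapply Rle_lt_trans; [apply Cmod_triangle|lra].
Qed.

Lemma Cconv_scal c u l : Cconv u l -> Cconv (fun n => c * u n)%C (c * l)%C.
Proof.
intros Hl eps He; pose proof (Cmod_ge_0 c).
destruct (Hl (eps / (Cmod c + 1)) ltac:(apply Rdiv_lt_0_compat; lra)) as [N HN].
exists N; intros n Hn; specialize (HN n Hn).
replace (c * u n - c * l)%C with (c * (u n - l))%C by ring; rewrite Cmod_mult.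
apply (Rmult_lt_compat_l (Cmod c + 1)) in HN; [|lra].
replace ((Cmod c + 1) * (eps / (Cmod c + 1))) with eps in HN by (field; lra).
pose proof (Cmod_ge_0 (u n - l)); nra.
Qed.

Lemma Cconv_const c : Cconv (fun _ => c) c.
Proof. intros eps He; exists O; intros n _; replace (c - c)%C with (RtoC 0) by ring; rewrite Cmod_0; lra. Qed.

Lemma Cconv_ext u v l : (forall n, u n = v n) -> Cconv u l -> Cconv v l.
Proof. intros H Hu eps He; destruct (Hu eps He) as [N HN]; exists N; intros n Hn; rewrite <- H; now apply HN. Qed.

Lemma Cconv_minus u v l m : Cconv u l -> Cconv v m -> Cconv (fun n => u n - v n)%C (l - m)%C.
Proof.
intros Hu Hv; replace (l - m)%C with (l + (- (1)) * m)%C by ring.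
eapply Cconv_ext; [|apply Cconv_plus; [exact Hu|apply (Cconv_scal (- (1))%C _ _ Hv)]].
intros n; cbv beta; ring.
Qed.

Lemma Cconv_dominated u l (tau : nat -> R) : is_lim_seq tau 0 ->
  (forall n, Cmod (u n - l) <= tau n) -> Cconv u l.
Proof.
intros Ht H eps He; apply is_lim_seq_spec in Ht; destruct (Ht (mkposreal eps He)) as [N HN].
exists N; intros n Hn; specialize (HN n Hn); simpl in HN.
eapply Rle_lt_trans; [apply H|]; rewrite Rminus_0_r in HN; pose proof (Rle_abs (tau n)); lra.
Qed.

Lemma Cconv_bound u l B : Cconv u l -> (forall n, Cmod (u n) <= B) -> Cmod l <= B.
Proof.
intros H HB; apply le_epsilon; intros eps He; destruct (H eps He) as [N HN].
specialize (HN N (le_n N)); specialize (HB N).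
replace l with (u N - (u N - l))%C by ring; unfold Cminus at 1.
eapply Rle_trans; [apply Cmod_triangle|]; rewrite Cmod_opp; lra.
Qed.

Lemma Cconv_complete u : (forall eps, 0 < eps -> exists N, forall n m, (n >= N)%nat -> (m >= N)%nat ->
  Cmod (u n - u m) < eps) -> exists l, Cconv u l.
Proof.
intros HC.
destruct (Rcomplete.R_complete (fun n => Re (u n))) as [x Hx].
{ intros eps He; destruct (HC eps He) as [N HN]; exists N; intros n m Hn Hm.
  eapply Rle_lt_trans; [apply (re_le_Cmod (u n - u m))|now apply HN]. }
destruct (Rcomplete.R_complete (fun n => Im (u n))) as [y Hy].
{ intros eps He; destruct (HC eps He) as [N HN]; exists N; intros n m Hn Hm.
  eapply Rle_lt_trans; [apply (im_le_Cmod (u n - u m))|now apply HN]. }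
exists (x, y); intros eps He.
destruct (Hx (eps / 2) ltac:(lra)) as [N1 H1]; destruct (Hy (eps / 2) ltac:(lra)) as [N2 H2].
exists (N1 + N2)%nat; intros n Hn; specialize (H1 n ltac:(lia)); specialize (H2 n ltac:(lia)).
unfold Rdist in H1, H2.
replace (u n - (x, y))%C with ((Re (u n) - x, Im (u n) - y) : C)
  by (destruct (u n); unfold Cminus, Cplus, Copp; simpl; f_equal; ring).
eapply Rle_lt_trans; [apply Cmod_pair_le|]; lra.
Qed.

Lemma Cconv_Cauchy u (tau : nat -> R) : is_lim_seq tau 0 ->
  (forall n m, (n <= m)%nat -> Cmod (u m - u n) <= tau n) ->
  exists l, Cconv u l /\ forall n, Cmod (u n - l) <= tau n.
Proof.
intros Ht H.
destruct (Cconv_complete u) as [l Hc].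
{ intros eps He; apply is_lim_seq_spec in Ht; destruct (Ht (mkposreal _ He)) as [N HN].
  exists N; intros n m Hn Hm; simpl in HN.
  pose proof (HN n Hn) as H1; pose proof (HN m Hm) as H2; rewrite Rminus_0_r in H1, H2.
  destruct (Nat.le_ge_cases n m) as [Hnm|Hnm].
  - rewrite Cmod_sub_sym; eapply Rle_lt_trans; [now apply H|]; pose proof (Rle_abs (tau n)); lra.
  - eapply Rle_lt_trans; [now apply H|]; pose proof (Rle_abs (tau m)); lra. }
exists l; split; [easy|]; intros n.
apply le_epsilon; intros eps He; destruct (Hc eps He) as [N HN].
specialize (HN (n + N)%nat ltac:(lia)); specialize (H n (n + N)%nat ltac:(lia)).
pose proof (Cmod_triangle' (u n) (u (n + N)%nat) l) as T; rewrite (Cmod_sub_sym (u n) (u _)) in T; lra.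
Qed.

Definition Csum (f : nat -> C) (n : nat) : C := @sum_n C_AbelianMonoid f n.

Lemma Csum_O f : Csum f 0 = f O.
Proof. exact (sum_O (G:=C_AbelianMonoid) f). Qed.

Lemma Csum_S f n : Csum f (S n) = (Csum f n + f (S n))%C.
Proof. exact (sum_Sn (G:=C_AbelianMonoid) f n). Qed.

Lemma Csum_ext f g n : (forall k, (k <= n)%nat -> f k = g k) -> Csum f n = Csum g n.
Proof. exact (sum_n_ext_loc (G:=C_AbelianMonoid) f g n). Qed.

Lemma Csum_plus f g n : Csum (fun k => f k + g k)%C n = (Csum f n + Csum g n)%C.
Proof. exact (sum_n_plus (G:=C_AbelianMonoid) f g n). Qed.

Lemma Csum_scal c f n : Csum (fun k => c * f k)%C n = (c * Csum f n)%C.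
Proof. induction n as [|n IH]; [now rewrite !Csum_O|rewrite !Csum_S, IH; ring]. Qed.

Lemma Csum_minus f g n : Csum (fun k => f k - g k)%C n = (Csum f n - Csum g n)%C.
Proof. induction n as [|n IH]; [now rewrite !Csum_O|rewrite !Csum_S, IH; ring]. Qed.

Definition Rsum (f : nat -> R) (n : nat) : R := sum_f_R0 f n.

Lemma Csum_weighted_bound (c : nat -> R) (u : nat -> C) B n : (forall k, 0 <= c k) ->
  (forall k, (k <= n)%nat -> Cmod (u k) <= B) -> Cmod (Csum (fun k => c k * u k)%C n) <= Rsum c n * B.
Proof.
intros Hc; induction n as [|n IH]; intros HB.
- rewrite Csum_O, Cmod_mult, Cmod_R, Rabs_pos_eq by easy; simpl.
  apply Rmult_le_compat_l; [easy|apply HB; lia].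
- rewrite Csum_S; simpl; eapply Rle_trans; [apply Cmod_triangle|].
  rewrite Cmod_mult, Cmod_R, (Rabs_pos_eq (c (S n))), Rmult_plus_distr_r by easy.
  apply Rplus_le_compat; [apply IH; intros; apply HB; lia|].
  apply Rmult_le_compat_l; [easy|apply HB; lia].
Qed.

Lemma Csum_weighted_tail (c : nat -> R) (u : nat -> C) B n m : (forall k, 0 <= c k) -> (n <= m)%nat ->
  (forall k, Cmod (u k) <= B) ->
  Cmod (Csum (fun k => c k * u k)%C m - Csum (fun k => c k * u k)%C n) <= (Rsum c m - Rsum c n) * B.
Proof.
intros Hc Hnm HB; induction Hnm as [|m Hm IH].
- replace (_ - _)%C with (RtoC 0) by ring; rewrite Cmod_0; lra.
- rewrite Csum_S; simpl.
  replace (Csum (fun k => c k * u k) m + c (S m) * u (S m) - Csum (fun k => c k * u k) n)%C with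
    ((Csum (fun k => c k * u k) m - Csum (fun k => c k * u k) n) + c (S m) * u (S m))%C by ring.
  eapply Rle_trans; [apply Cmod_triangle|]; rewrite Cmod_mult, Cmod_R, (Rabs_pos_eq (c (S m))) by easy.
  specialize (HB (S m)); specialize (Hc (S m)); unfold Rsum in *; nra.
Qed.

Lemma is_CInt_weighted_sum (c : nat -> R) (f : nat -> R -> C) (l : nat -> C) a b n :
  (forall k, is_CInt (f k) a b (l k)) ->
  is_CInt (fun x => Csum (fun k => c k * f k x)%C n) a b (Csum (fun k => c k * l k)%C n).
Proof.
intros H; induction n as [|n IH].
- rewrite Csum_O; eapply is_CInt_ext; [|apply is_CInt_scal, H]; intros; now rewrite Csum_O.
- rewrite Csum_S; eapply is_CInt_ext; [|apply is_CInt_plus; [exact IH|apply is_CInt_scal, H]].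
  intros; now rewrite Csum_S.
Qed.

(** Locally uniform second-order Taylor bounds pass to a pointwise limit, without any
    assumption on the sequence of derivatives. *)
Lemma Cderiv_limit (G : nat -> C -> C) (F : C -> C) z d K : 0 < d -> 0 <= K ->
  (forall y, Cmod (y - z) < d -> Cconv (fun n => G n y) (F y)) ->
  (forall n, exists D, forall y, Cmod (y - z) < d ->
     Cmod (G n y - G n z - (y - z) * D) <= K * Cmod (y - z) ^ 2) ->
  exists l, Cderiv F z l.
Proof.
intros Hd HK Hconv HD.
apply choice in HD; destruct HD as [D HD].
assert (Hz : Cmod (z - z) < d) by (replace (z - z)%C with (RtoC 0) by ring; rewrite Cmod_0; easy).
assert (HDC : forall eps, 0 < eps -> exists N, forall n m, (n >= N)%nat -> (m >= N)%nat -> Cmod (D n - D m) < eps).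
{ intros eps He.
  (* A real increment small enough for the quadratic error to be a quarter of eps h. *)
  set (h := Rmin (d / 2) (eps / (4 * (K + 1)))).
  assert (Hh : 0 < h) by (apply Rmin_pos; [lra|apply Rdiv_lt_0_compat; lra]).
  assert (Hh1 : h < d) by (eapply Rle_lt_trans; [apply Rmin_l|lra]).
  assert (Hh2 : (K + 1) * h <= eps / 4).
  { replace (eps / 4) with ((K + 1) * (eps / (4 * (K + 1)))) by (field; lra).
    apply Rmult_le_compat_l; [lra|apply Rmin_r]. }
  assert (Hy : Cmod (z + h - z) = h).
  { replace (z + h - z)%C with (RtoC h) by ring; rewrite Cmod_R, Rabs_pos_eq; lra. }
  destruct (Hconv z Hz (eps * h / 16) ltac:(nra)) as [N1 H1].
  destruct (Hconv (z + h)%C ltac:(lra) (eps * h / 16) ltac:(nra)) as [N2 H2].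
  exists (N1 + N2)%nat; intros n m Hn Hm.
  pose proof (HD n (z + h)%C ltac:(lra)) as A1; pose proof (HD m (z + h)%C ltac:(lra)) as A2.
  rewrite Hy in A1, A2; replace (z + h - z)%C with (RtoC h) in A1, A2 by ring.
  pose proof (H1 n ltac:(lia)) as B1; pose proof (H1 m ltac:(lia)) as B2.
  pose proof (H2 n ltac:(lia)) as B3; pose proof (H2 m ltac:(lia)) as B4.
  apply Rmult_lt_reg_l with h; [easy|].
  replace (h * Cmod (D n - D m)) with (Cmod (h * (D n - D m))) by (rewrite Cmod_mult, Cmod_R, Rabs_pos_eq; lra).
  replace (h * (D n - D m))%C with
    ((G m (z + h) - G m z - h * D m) + - (G n (z + h) - G n z - h * D n)
     + ((G n (z + h) - F (z + h)) + - (G m (z + h) - F (z + h)) + ((G m z - F z) + - (G n z - F z))))%C by ring.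
  eapply Rle_lt_trans; [apply Cmod_triangle|].
  eapply Rle_lt_trans; [apply Rplus_le_compat; apply Cmod_triangle|].
  eapply Rle_lt_trans; [apply Rplus_le_compat_l; apply Rplus_le_compat; apply Cmod_triangle|].
  rewrite !Cmod_opp; nra. }
destruct (Cconv_complete D HDC) as [l Hc].
exists l; apply Cderiv_eps; intros eps He.
exists (Rmin d (eps / (K + 1))); split; [apply Rmin_pos; [easy|apply Rdiv_lt_0_compat; lra]|].
intros w Hw.
assert (Hw1 := Rlt_le_trans _ _ _ Hw (Rmin_l _ _)); assert (Hw2 := Rlt_le_trans _ _ _ Hw (Rmin_r _ _)).
apply Rle_trans with (K * Cmod (w - z) ^ 2).
- apply (Cconv_bound (fun n => G n w - G n z - (w - z) * D n)%C).
  + apply Cconv_minus; [apply Cconv_minus; now apply Hconv|now apply Cconv_scal].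
  + intros n; now apply HD.
- pose proof (Cmod_ge_0 (w - z)).
  apply (Rmult_lt_compat_l (K + 1)) in Hw2; [|lra].
  replace ((K + 1) * (eps / (K + 1))) with eps in Hw2 by (field; lra).
  simpl; rewrite Rmult_1_r, <- Rmult_assoc; apply Rmult_le_compat_r; nra.
Qed.

(** * Oscillating integrals of shifted powers *)

Definition freq (k : nat) : R := 2 * PI * (INR k + 1).

Lemma freq_pos k : 0 < freq k.
Proof. unfold freq; pose proof PI_RGT_0; pose proof (pos_INR k); nra. Qed.

Lemma freq_int k n : cos (freq k * INR n) = 1 /\ sin (freq k * INR n) = 0.
Proof.
replace (freq k * INR n) with (0 + 2 * INR (S k * n) * PI) by (unfold freq; rewrite mult_INR, S_INR; ring).
rewrite cos_period, sin_period, cos_0, sin_0; auto.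
Qed.

Definition osc (k : nat) (x : R) : R := 1 - cos (freq k * x).

Lemma osc_bounds k x : 0 <= osc k x <= 2.
Proof. unfold osc; pose proof (COS_bound (freq k * x)); lra. Qed.

Lemma Rderiv_osc k x : Rderiv (fun x => RtoC (osc k x)) x (freq k * sin (freq k * x))%R.
Proof. apply (Rderiv_RtoC (osc k)); unfold osc; auto_derive; [easy|ring]. Qed.

Definition osc_integrand (a z : C) (k : nat) (x : R) : C := (osc k x * shifted_power a z x)%C.

(** The upper limit is an integer, where the kernel and the sine vanish. *)
Definition osc_integral (a z : C) (k n : nat) : C := CInt (osc_integrand a z k) 0 (INR n).

Lemma osc_integrand_deriv a z k x : off_cut a -> 0 <= x -> exists l, Rderiv (osc_integrand a z k) x l.
Proof.
intros Ha Hx; eexists; apply Rderiv_mult; [apply Rderiv_osc|now apply shifted_power_deriv].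
Qed.

Lemma osc_integrand_cont a z k x : off_cut a -> 0 <= x -> Ccont (osc_integrand a z k) x.
Proof. intros Ha Hx; destruct (osc_integrand_deriv a z k x Ha Hx) as [l Hl]; now apply (Rderiv_Ccont _ _ l). Qed.

Lemma is_CInt_osc a z k u v : off_cut a -> 0 <= u <= v ->
  is_CInt (osc_integrand a z k) u v (CInt (osc_integrand a z k) u v).
Proof.
intros Ha Huv; apply CInt_correct, Ccont_integrable_le; [lra|].
intros t Ht; apply osc_integrand_cont; [easy|lra].
Qed.

Lemma osc_integral_diff a z k n m : off_cut a -> (n <= m)%nat ->
  is_CInt (osc_integrand a z k) (INR n) (INR m) (osc_integral a z k m - osc_integral a z k n)%C.
Proof.
intros Ha Hnm; unfold osc_integral; pose proof (pos_INR n); pose proof (le_INR _ _ Hnm).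
assert (H1 := is_CInt_osc a z k (INR n) (INR m) Ha ltac:(lra)).
assert (H2 := is_CInt_osc a z k 0 (INR n) Ha ltac:(lra)).
rewrite (is_CInt_unique _ _ _ _ (is_CInt_Chasles _ _ _ _ _ _ H2 H1)).
now replace (CInt (osc_integrand a z k) 0 (INR n) + CInt (osc_integrand a z k) (INR n) (INR m) -
  CInt (osc_integrand a z k) 0 (INR n))%C with (CInt (osc_integrand a z k) (INR n) (INR m)) by ring.
Qed.

Lemma Cmod_osc_integrand a z k x : Cmod (osc_integrand a z k x) = osc k x * Cmod (shifted_power a z x).
Proof. unfold osc_integrand; rewrite Cmod_mult, Cmod_R, Rabs_pos_eq; [easy|apply osc_bounds]. Qed.

Lemma is_CInt_power_bound f u v l eta K : is_CInt f u v l -> 0 <= u <= v -> 0 < eta ->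
  (forall x, u <= x <= v -> Cmod (f x) <= K * exp (- (1 + eta) * ln (1 + x))) -> 0 <= K ->
  Cmod l <= K / eta * exp (- eta * ln (1 + u)).
Proof.
intros Hf Huv He HK HK0.
apply Rle_trans with (- (K / eta * exp (- eta * ln (1 + v))) - - (K / eta * exp (- eta * ln (1 + u)))).
- apply (is_CInt_bound f u v l (fun x => - (K / eta * exp (- eta * ln (1 + x))))
    (fun x => K * exp (- (1 + eta) * ln (1 + x)))); try easy.
  + intros t Ht; auto_derive; [lra|].
    replace (- (1 + eta) * ln (1 + t)) with (- eta * ln (1 + t) + - ln (1 + t)) by ring.
    rewrite exp_plus, exp_Ropp, exp_ln by lra; field; lra.
  + intros t Ht; apply (ex_derive_continuous (fun x => K * exp (- (1 + eta) * ln (1 + x)))).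
    auto_derive; lra.
- pose proof (exp_pos (- eta * ln (1 + v))).
  assert (0 <= K / eta) by (apply Rdiv_le_0_compat; lra); nra.
Qed.

Lemma power_tail_lim eta : 0 < eta -> is_lim_seq (fun n => exp (- eta * ln (1 + INR n))) 0.
Proof.
intros He; apply is_lim_seq_spec; intros eps.
destruct (INR_unbounded (exp (- (ln eps / eta)))) as [N HN].
exists N; intros n Hn; rewrite Rminus_0_r, Rabs_pos_eq by (left; apply exp_pos).
rewrite <- (exp_ln eps) by apply cond_pos; apply exp_increasing.
assert (H : exp (- (ln eps / eta)) < 1 + INR n) by (apply le_INR in Hn; lra).
apply ln_increasing in H; [|apply exp_pos]; rewrite ln_exp in H.
apply (Rmult_lt_compat_l eta) in H; [|easy].
replace (eta * - (ln eps / eta)) with (- ln eps) in H by (field; lra); lra.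
Qed.

Lemma osc_integral_bound (a z : C) : a <> 0 -> Rabs (Carg a) < PI -> 1 < Re z ->
  exists K, 0 <= K /\ (forall k n m, (n <= m)%nat ->
    Cmod (osc_integral a z k m - osc_integral a z k n) <= K * exp (- (Re z - 1) * ln (1 + INR n))) /\
    (forall k n, Cmod (osc_integral a z k n) <= K).
Proof.
intros Ha Harg Hz.
assert (Hc := off_cut_arg a Ha Harg).
destruct (shifted_power_bound a Ha Harg) as [D [HD HB]].
set (M := exp ((Rabs (Re z) + Rabs (Im z)) * D)).
assert (HM : 0 < M) by apply exp_pos.
assert (H : forall k n m, (n <= m)%nat -> Cmod (osc_integral a z k m - osc_integral a z k n) <=
   (2 * M) / (Re z - 1) * exp (- (Re z - 1) * ln (1 + INR n))).
{ intros k n m Hnm; pose proof (pos_INR n); pose proof (le_INR _ _ Hnm).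
  eapply is_CInt_power_bound; [now apply osc_integral_diff|lra|lra| |lra].
  intros x Hx; rewrite Cmod_osc_integrand.
  replace (- (1 + (Re z - 1))) with (- Re z) by ring.
  specialize (HB z x ltac:(lra)); fold M in HB; pose proof (osc_bounds k x).
  pose proof (Cmod_ge_0 (shifted_power a z x)); nra. }
exists (2 * M / (Re z - 1)); split; [apply Rdiv_le_0_compat; lra|split; [exact H|]].
intros k n; specialize (H k O n ltac:(lia)).
simpl INR in H; rewrite Rplus_0_r, ln_1, Rmult_0_r, exp_0, Rmult_1_r in H.
replace (osc_integral a z k 0) with (RtoC 0) in H.
- replace (osc_integral a z k n - 0)%C with (osc_integral a z k n) in H by ring; exact H.
- unfold osc_integral; simpl; symmetry; apply is_CInt_unique.
  exact (is_RInt_point (V:=C_R_NormedModule) _ 0).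
Qed.

(** From exp t >= (1 + t/2)^2. *)
Lemma sqr_le_exp d y : 0 < d -> 0 <= y -> y ^ 2 <= 4 / d ^ 2 * exp (d * y).
Proof.
intros Hd Hy; pose proof (exp_ineq1_le (d * y / 2)) as H.
assert (P : 0 <= d * y) by nra.
replace (exp (d * y)) with (exp (d * y / 2) * exp (d * y / 2)) by (rewrite <- exp_plus; f_equal; field).
apply Rmult_le_reg_r with (d ^ 2 / 4); [pose proof (pow_lt d 2 Hd); lra|].
replace (4 / d ^ 2 * (exp (d * y / 2) * exp (d * y / 2)) * (d ^ 2 / 4)) with
  (exp (d * y / 2) * exp (d * y / 2)) by (field; lra).
nra.
Qed.

(** Differentiating under the integral costs a factor quadratic in the logarithm, which is
    absorbed by an arbitrarily small power. *)
Lemma osc_integral_taylor (a z : C) : a <> 0 -> Rabs (Carg a) < PI -> 1 < Re z ->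
  exists d K, 0 < d /\ 0 <= K /\ forall k n, exists D, forall y, Cmod (y - z) < d ->
    Cmod (osc_integral a y k n - osc_integral a z k n - (y - z) * D) <= K * Cmod (y - z) ^ 2.
Proof.
intros Ha Harg Hz.
assert (Hc := off_cut_arg a Ha Harg).
destruct (shifted_power_bound a Ha Harg) as [D [HD HB]].
destruct (Clog_shift_bound a Ha Harg) as [D' [HD' HL]].
(* Half of the excess of Re z over 1 is spent on the factor exp(|h| |L|) and on |L|^2. *)
set (eta := (Re z - 1) / 2); assert (He : 0 < eta) by (unfold eta; lra).
set (d := eta / 2); assert (Hd : 0 < d) by (unfold d; lra).
set (M := exp ((Rabs (Re z) + Rabs (Im z)) * D)).
assert (HM : 0 < M) by apply exp_pos.
set (M' := 4 / d ^ 2 * exp (2 * d * (2 * D'))).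
assert (HM' : 0 < M').
{ apply Rmult_lt_0_compat; [apply Rdiv_lt_0_compat; [lra|now apply pow_lt]|apply exp_pos]. }
exists d, (2 * M * M' / eta); split; [easy|split; [apply Rdiv_le_0_compat; nra|]].
intros k n; pose proof (pos_INR n) as Hn.
assert (Hint : Cintegrable (fun x => - Clog (x + a) * osc_integrand a z k x)%C 0 (INR n)).
{ apply Ccont_integrable_le; [easy|]; intros t Ht.
  eapply Rderiv_Ccont; apply Rderiv_mult.
  - apply Rderiv_opp, Rderiv_Clog, off_cut_shift; [easy|lra].
  - apply Rderiv_mult; [apply Rderiv_osc|apply shifted_power_deriv; [easy|lra]]. }
exists (CInt (fun x => - Clog (x + a) * osc_integrand a z k x)%C 0 (INR n)).
intros y Hy; set (h := (y - z)%C) in *.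
assert (HI := is_CInt_minus _ _ _ _ _ _ (is_CInt_minus _ _ _ _ _ _
   (is_CInt_osc a y k 0 (INR n) Hc ltac:(lra)) (is_CInt_osc a z k 0 (INR n) Hc ltac:(lra)))
   (is_CInt_scal h _ _ _ _ (CInt_correct _ _ _ Hint))).
apply Rle_trans with ((2 * M * M' * Cmod h ^ 2) / eta * exp (- eta * ln (1 + 0))).
- pose proof (Cmod_ge_0 h) as Hh.
  refine (is_CInt_power_bound _ _ _ _ eta (2 * M * M' * Cmod h ^ 2) HI ltac:(lra) He _ _).
  2:{ apply Rmult_le_pos; [nra|apply pow2_ge_0]. }
  intros x Hx; specialize (HL x ltac:(lra)) as [HL1 HL2]; specialize (HB z x ltac:(lra)); fold M in HB.
  set (L := Clog (x + a)) in *.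
  assert (Hl : 0 <= ln (1 + x)) by (rewrite <- ln_1; apply ln_le; lra).
  assert (HLm : Cmod L <= ln (1 + x) + 2 * D').
  { destruct L as [p q]; eapply Rle_trans; [apply Cmod_pair_le|]; simpl in HL1, HL2.
    replace p with ((p - ln (1 + x)) + ln (1 + x)) by ring.
    pose proof (Rabs_triang (p - ln (1 + x)) (ln (1 + x))); rewrite (Rabs_pos_eq (ln (1 + x))) in *; lra. }
  assert (E : (osc_integrand a y k x - osc_integrand a z k x - h * (- L * osc_integrand a z k x))%C =
     (osc_integrand a z k x * (Cexp (- (h * L)) - 1 - - (h * L)))%C).
  { unfold osc_integrand, shifted_power; fold L.
    replace (- (y * L))%C with (- (z * L) + - (h * L))%C by (unfold h; ring).
    rewrite Cexp_plus; ring. }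
  rewrite E, Cmod_mult, Cmod_osc_integrand.
  pose proof (Cexp_bound2 (- (h * L))) as H2; rewrite Cmod_opp, Cmod_mult in H2.
  pose proof (Cmod_ge_0 L) as HL0.
  assert (H3 : Cmod (Cexp (- (h * L)) - 1 - - (h * L)) <= Cmod h ^ 2 * (M' * exp (eta * ln (1 + x)))).
  { eapply Rle_trans; [exact H2|]; rewrite Rpow_mult_distr, Rmult_assoc.
    apply Rmult_le_compat_l; [apply pow2_ge_0|].
    apply Rle_trans with (4 / d ^ 2 * exp (d * Cmod L) * exp (d * Cmod L)).
    - apply Rmult_le_compat; [apply pow2_ge_0|left; apply exp_pos|now apply sqr_le_exp|].
      apply exp_mono; apply Rmult_le_compat_r; lra.
    - unfold M'; rewrite !Rmult_assoc, <- !exp_plus.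
      apply Rmult_le_compat_l; [left; apply Rdiv_lt_0_compat; [lra|now apply pow_lt]|].
      apply exp_mono; unfold d; nra. }
  replace (- (1 + eta) * ln (1 + x)) with (- Re z * ln (1 + x) + eta * ln (1 + x)) by (unfold eta; field).
  rewrite exp_plus.
  pose proof (osc_bounds k x) as Ho; pose proof (Cmod_ge_0 (shifted_power a z x)) as Hp.
  set (e1 := exp (- Re z * ln (1 + x))) in *; set (e2 := exp (eta * ln (1 + x))) in *.
  replace (2 * M * M' * Cmod h ^ 2 * (e1 * e2)) with ((2 * (M * e1)) * (Cmod h ^ 2 * (M' * e2))) by ring.
  apply Rmult_le_compat; [apply Rmult_le_pos; lra|apply Cmod_ge_0| |exact H3].
  apply Rmult_le_compat; lra.
- rewrite Rplus_0_r, ln_1, Rmult_0_r, exp_0, Rmult_1_r; right; field; lra.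
Qed.

(** Two integrations by parts, with boundary terms evaluated at integers. *)
Lemma osc_integral_recurrence (a p : C) k n : off_cut a ->
  (p * osc_integral a (p + 1) k n + p * (p + 1) * (p + 2) / (freq k ^ 2)%R * osc_integral a (p + 3) k n)%C
  = (shifted_power a p 0 - shifted_power a p (INR n))%C.
Proof.
intros Ha; pose proof (pos_INR n) as Hn; pose proof (freq_pos k) as Hw.
assert (H := is_CInt_plus _ _ _ _ _ _
  (is_CInt_scal p _ _ _ _ (is_CInt_osc a (p + 1) k 0 (INR n) Ha ltac:(lra)))
  (is_CInt_scal (p * (p + 1) * (p + 2) / (freq k ^ 2)%R)%C _ _ _ _ (is_CInt_osc a (p + 3) k 0 (INR n) Ha ltac:(lra)))).
unfold osc_integral; rewrite <- (is_CInt_unique _ _ _ _ H).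
set (w := freq k) in *.
(* With e = (x + a)^(-p) this is -e - e''/w^2 + sin(wx) e'/w + cos(wx) e''/w^2, whose
   derivative is -(1 - cos(wx)) (e' + e'''/w^2). *)
set (F := fun x => (- shifted_power a p x - p * (p + 1) * shifted_power a (p + 2) x * / (w ^ 2)%R
  + (/ w * sin (w * x))%R * (- p * shifted_power a (p + 1) x)
  + (/ w ^ 2 * cos (w * x))%R * (p * (p + 1) * shifted_power a (p + 2) x))%C).
assert (Hw0 : RtoC w <> 0) by (intros E; apply RtoC_inj in E; lra).
assert (Hw2 : RtoC (w ^ 2) <> 0) by (intros E; apply RtoC_inj in E; nra).
assert (EF : (shifted_power a p 0 - shifted_power a p (INR n))%C = (F (INR n) - F 0)%C).
{ unfold F; destruct (freq_int k n) as [E1 E2]; fold w in E1, E2; rewrite E1, E2;  rewrite !Rmult_0_r, cos_0, sin_0, !Rmult_0_r, Rmult_1_r.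
  rewrite (RtoC_inv (w ^ 2)) by nra; ring. }
rewrite EF; apply is_CInt_unique, is_CInt_derive; [easy| |].
- intros x [Hx _].
  assert (D0 := shifted_power_deriv a p x Ha Hx).
  assert (D1 := shifted_power_deriv a (p + 1) x Ha Hx).
  assert (D2 := shifted_power_deriv a (p + 2) x Ha Hx).
  replace (p + 1 + 1)%C with (p + 2)%C in D1 by ring.
  replace (p + 2 + 1)%C with (p + 3)%C in D2 by ring.
  assert (Ds : Rderiv (fun x => RtoC (/ w * sin (w * x))) x (cos (w * x))).
  { apply (Rderiv_RtoC (fun x => / w * sin (w * x))); auto_derive; [easy|field; lra]. }
  assert (Dc : Rderiv (fun x => RtoC (/ w ^ 2 * cos (w * x))) x (- / w * sin (w * x))%R).
  { apply (Rderiv_RtoC (fun x => / w ^ 2 * cos (w * x))); auto_derive; [easy|field; lra]. }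
  unfold F; eapply Rderiv_eq.
  + apply Rderiv_plus; [apply Rderiv_plus; [apply Rderiv_minus|]|].
    * apply Rderiv_opp, D0.
    * apply Rderiv_mult; [apply Rderiv_scal, D2|apply Rderiv_const].
    * apply Rderiv_mult; [exact Ds|apply Rderiv_scal, D1].
    * apply Rderiv_mult; [exact Dc|apply Rderiv_scal, D2].
  + unfold osc_integrand, osc; fold w.
    rewrite !RtoC_mult, RtoC_minus, RtoC_opp, !RtoC_inv by (try apply pow_nonzero; lra).
    rewrite RtoC_pow in *; field; easy.
- intros x [Hx _].
  destruct (osc_integrand_deriv a (p + 1) k x Ha Hx) as [l1 H1].
  destruct (osc_integrand_deriv a (p + 3) k x Ha Hx) as [l2 H2].
  exact (Rderiv_Ccont _ _ _ (Rderiv_plus _ _ _ _ _ (Rderiv_scal p _ _ _ H1)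
    (Rderiv_scal (p * (p + 1) * (p + 2) / (freq k ^ 2)%R)%C _ _ _ H2))).
Qed.

(** * The incomplete gamma function *)

(** ln t <= t - 1 at t = d y, with d chosen so that b d <= e. *)
Lemma log_absorb b e : 0 <= b -> 0 < e -> exists K, forall y, 0 < y -> b * ln y <= e * y + K.
Proof.
intros Hb He; set (d := e / (b + 1)); assert (Hd : 0 < d) by (apply Rdiv_lt_0_compat; lra).
exists (- b * ln d); intros y Hy.
pose proof (exp_ineq1_le (ln (d * y))) as H; rewrite exp_ln in H by nra.
rewrite ln_mult in H by lra.
assert (H1 : ln y <= d * y - ln d) by lra.
apply Rle_trans with (b * (d * y - ln d)); [now apply Rmult_le_compat_l|].
assert (b * d <= e).
{ unfold d; apply Rmult_le_reg_r with (b + 1); [lra|].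
  replace (b * (e / (b + 1)) * (b + 1)) with (b * e) by (field; lra); nra. }
nra.
Qed.

Lemma cos_Carg (w : C) : w <> 0 -> cos (Carg w) = Re w / Cmod w.
Proof. intros H; rewrite (Re_polar w H); field; apply Rgt_not_eq, Cmod_gt_0, H. Qed.

Lemma Carg_lt_of_cos (w : C) c : w <> 0 -> 0 <= c <= PI -> cos c < Re w / Cmod w -> Rabs (Carg w) < c.
Proof.
intros Hw Hc H; rewrite <- cos_Carg in H by easy.
apply Rnot_le_lt; intros Hle.
assert (E : cos (Carg w) = cos (Rabs (Carg w))).
{ unfold Rabs; destruct Rcase_abs; [now rewrite cos_neg|easy]. }
pose proof (Carg_bounds w Hw) as Hb.
assert (Rabs (Carg w) <= PI) by (apply Rabs_le; lra).
rewrite E in H; pose proof (cos_decr_1 c (Rabs (Carg w)) ltac:(lra) ltac:(lra) ltac:(lra) ltac:(lra) Hle); lra.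
Qed.

Lemma Carg_right_half_plane (w : C) : 0 < Re w -> Rabs (Carg w) < PI / 2.
Proof.
intros H; assert (Hw : w <> 0) by (intros ->; simpl in H; lra).
apply Carg_lt_of_cos; [easy|pose proof PI_RGT_0; lra|].
rewrite cos_PI2; apply Rdiv_lt_0_compat; [easy|now apply Cmod_gt_0].
Qed.

(** The derivative of the incomplete gamma function in the logarithmic variable. *)
Definition gamma_density (al l : C) : C := (- Cexp (al * l - Cexp l))%C.

Lemma Centire_gamma_density al : Centire (gamma_density al).
Proof.
apply (Centire_comp Copp); [apply Centire_opp|].
apply (Centire_comp Cexp); [apply Centire_Cexp|].
apply (Centire_minus (fun l => al * l)%C); [|apply Centire_Cexp].
apply (Centire_mult (fun _ => al)); [apply Centire_const|apply Centire_id].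
Qed.

Definition gamma_integrand (al z : C) (t : R) : C := (Cpower (z + t) (al - 1) * Cexp (- (z + t)))%C.

Lemma gamma_integrand_alt al z t :
  gamma_integrand al z t = (shifted_power z (1 - al) t * Cexp (- (z + t)))%C.
Proof.
unfold gamma_integrand, Cpower, shifted_power; do 2 f_equal.
replace (z + t)%C with (t + z)%C by ring; ring.
Qed.

Lemma gamma_integrand_cont al z t : off_cut z -> 0 <= t -> Ccont (gamma_integrand al z) t.
Proof.
intros Hz Ht; eapply Rderiv_Ccont.
apply (Rderiv_ext (fun t => shifted_power z (1 - al) t * Cexp (- (z + t)))%C).
{ intros u; symmetry; apply gamma_integrand_alt. }
apply Rderiv_mult; [now apply shifted_power_deriv|].
apply (Cderiv_Rderiv_comp Cexp (fun t : R => - (z + t))%C); [apply Cderiv_Cexp|].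
apply Rderiv_opp, Rderiv_plus; [apply Rderiv_const|].
apply (Rderiv_RtoC (fun t => t)), (is_derive_id (K:=R_AbsRing)).
Qed.

Lemma gamma_primitive_deriv al F z t : (forall l, Cderiv F l (gamma_density al l)) -> off_cut z -> 0 <= t ->
  Rderiv (fun t => F (Clog (t + z))) t (- gamma_integrand al z t).
Proof.
intros HF Hz Ht; assert (H := off_cut_shift z t Hz Ht); assert (H0 := off_cut_neq_0 _ H).
eapply Rderiv_eq.
- apply (Cderiv_Rderiv_comp F (fun t => Clog (t + z))); [apply HF|now apply Rderiv_Clog].
- unfold gamma_density, gamma_integrand, Cpower.
  replace (z + t)%C with (t + z)%C by ring.
  rewrite Cexp_Clog by easy.
  replace ((al - 1) * Clog (t + z))%C with (al * Clog (t + z) - Clog (t + z))%C by ring.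
  rewrite !Cexp_minus, Cexp_opp, Cexp_Clog by easy; field.
  repeat split; first [exact H0|apply Cexp_neq_0].
Qed.

Lemma Rderiv_half_exp K t : is_derive (fun t => - (2 * K * exp (- t / 2))) t (K * exp (- t / 2)).
Proof. auto_derive; [easy|]; unfold Rdiv; field. Qed.

Lemma half_exp_lim K : is_lim_seq (fun n => K * exp (- INR n / 2)) 0.
Proof.
apply is_lim_seq_spec; intros eps.
destruct (INR_unbounded (2 * ((Rabs K + 1) / eps))) as [N HN].
exists N; intros n Hn; apply le_INR in Hn; rewrite Rminus_0_r, Rabs_mult, (Rabs_pos_eq (exp _)) by (left; apply exp_pos).
pose proof (cond_pos eps) as He; pose proof (Rabs_pos K).
assert (H1 : (Rabs K + 1) / eps < INR n / 2) by lra.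
assert (H2 : Rabs K + 1 < eps * exp (INR n / 2)).
{ apply Rlt_le_trans with (eps * (INR n / 2)).
  - apply (Rmult_lt_compat_l eps) in H1; [|easy].
    replace (eps * ((Rabs K + 1) / eps)) with (Rabs K + 1) in H1 by (field; lra); easy.
  - apply Rmult_le_compat_l; [lra|]; pose proof (exp_ineq1_le (INR n / 2)); lra. }
replace (- INR n / 2) with (- (INR n / 2)) by field; rewrite exp_Ropp.
pose proof (exp_pos (INR n / 2)) as Hp.
apply Rmult_lt_reg_r with (exp (INR n / 2)); [easy|].
rewrite Rmult_assoc, Rinv_l, Rmult_1_r by lra; lra.
Qed.

(** The integrand decays exponentially, so the primitive has a limit along each ray. *)
Lemma gamma_primitive_limit al F z : (forall l, Cderiv F l (gamma_density al l)) -> off_cut z ->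
  exists c K, 0 <= K /\ forall t, 0 <= t -> Cmod (F (Clog (t + z)) - c) <= K * exp (- t / 2).
Proof.
intros HF Hz; assert (Hz0 := off_cut_neq_0 _ Hz).
destruct (shifted_power_bound z Hz0 (Carg_off_cut z Hz)) as [D [HD HB]].
destruct (log_absorb (Rabs (Re al - 1)) (1/2) (Rabs_pos _) ltac:(lra)) as [K0 HK0].
set (K := exp ((Rabs (Re (1 - al)) + Rabs (Im (1 - al))) * D) * exp (K0 + 1/2 - Re z)).
assert (HK : 0 < K) by (apply Rmult_lt_0_compat; apply exp_pos).
assert (Hinc : forall s t, 0 <= s <= t -> Cmod (F (Clog (t + z)) - F (Clog (s + z))) <= 2 * K * exp (- s / 2)).
{ intros s t Hst.
  apply Rle_trans with (- (2 * K * exp (- t / 2)) - - (2 * K * exp (- s / 2))).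
  - apply (increment_dominated (fun t => F (Clog (t + z))) (fun t => - gamma_integrand al z t)%C
      (fun t => - (2 * K * exp (- t / 2))) (fun t => K * exp (- t / 2))); [lra| | |].
    + intros u Hu; apply gamma_primitive_deriv; [easy|easy|lra].
    + intros u Hu; apply Rderiv_half_exp.
    + intros u Hu; rewrite Cmod_opp, gamma_integrand_alt, Cmod_mult, Cmod_Cexp.
      eapply Rle_trans; [apply Rmult_le_compat_r; [left; apply exp_pos|apply HB; lra]|].
      unfold K; rewrite !Rmult_assoc; apply Rmult_le_compat_l; [left; apply exp_pos|].
      rewrite <- !exp_plus; apply exp_mono.
      specialize (HK0 (1 + u) ltac:(lra)).
      assert (Hl : 0 <= ln (1 + u)) by (rewrite <- ln_1; apply ln_le; lra).
      replace (- Re (1 - al)) with (Re al - 1) by (destruct al; simpl; ring).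
      rewrite re_opp, re_plus; simpl Re.
      pose proof (Rle_abs (Re al - 1)); nra.
  - pose proof (exp_pos (- t / 2)); nra. }
destruct (Cconv_Cauchy (fun n => F (Clog (INR n + z))) (fun n => 2 * K * exp (- INR n / 2))) as [c [Hc _]].
{ apply half_exp_lim. }
{ intros n m Hnm; apply Hinc; split; [apply pos_INR|now apply le_INR]. }
exists c, (2 * K); split; [lra|]; intros t Ht.
apply le_epsilon; intros eps He; destruct (Hc eps He) as [N HN].
destruct (INR_unbounded t) as [n Hn].
specialize (HN (N + n)%nat ltac:(lia)).
assert (Hn2 : t <= INR (N + n)) by (rewrite plus_INR; pose proof (pos_INR N); lra).
specialize (Hinc t (INR (N + n)) ltac:(lra)).
pose proof (Cmod_triangle' (F (Clog (t + z))) (F (Clog (INR (N + n) + z))) c) as T.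
rewrite (Cmod_sub_sym (F (Clog (t + z))) (F _)) in T; lra.
Qed.

Lemma Cmod_shift_ge_diff (z : C) T : T - Cmod z <= Cmod (T + z).
Proof.
pose proof (Cmod_triangle (T + z) (- z)) as H; rewrite Cmod_opp in H.
replace (T + z + - z)%C with (RtoC T) in H by ring; rewrite Cmod_R in H.
pose proof (Rle_abs T); lra.
Qed.

(** Far to the right the logarithm of T + z is that of T up to ln 2, and its argument is at
    most pi/3, which keeps the real part of T + z comparable with T. *)
Lemma Clog_far (z : C) T : 3 * Cmod z < T -> 2 <= T ->
  ln (T / 2) <= Re (Clog (T + z)) <= ln (2 * T) /\ Rabs (Im (Clog (T + z))) <= PI / 3.
Proof.
intros HT HT2; pose proof (Cmod_shift_ge_diff z T) as H1; pose proof (Cmod_ge_0 z) as H0.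
pose proof (Cmod_shift_le z T ltac:(lra)) as H2.
change (Re (Clog (T + z))) with (ln (Cmod (T + z))); change (Im (Clog (T + z))) with (Carg (T + z)).
split; [split; apply ln_le; lra|].
left; apply Carg_lt_of_cos.
- apply Cmod_gt_0; lra.
- pose proof PI_RGT_0; lra.
- rewrite cos_PI3; apply Rmult_lt_reg_r with (Cmod (T + z)); [lra|].
  replace (Re (T + z) / Cmod (T + z) * Cmod (T + z)) with (Re (T + z)) by (field; lra).
  rewrite re_plus; simpl Re; pose proof (re_le_Cmod z) as Hr.
  pose proof (Rle_abs (- Re z)) as Ha; rewrite Rabs_Ropp in Ha; lra.
Qed.

(** The limit is the same along all rays, because far to the right the density is small on
    segments of bounded length in the logarithmic variable. *)
Lemma gamma_primitive_limit_unique al F z1 z2 c1 c2 K1 K2 : (forall l, Cderiv F l (gamma_density al l)) ->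
  (forall t, 0 <= t -> Cmod (F (Clog (t + z1)) - c1) <= K1 * exp (- t / 2)) ->
  (forall t, 0 <= t -> Cmod (F (Clog (t + z2)) - c2) <= K2 * exp (- t / 2)) -> c1 = c2.
Proof.
intros HF H1 H2.
destruct (log_absorb (Cmod al) (1/16) (Cmod_ge_0 _) ltac:(lra)) as [K0 HK0].
set (M := exp (K0 + Cmod al * 2)).
assert (HM : 0 < M) by apply exp_pos.
assert (Hfar : forall T, 3 * Cmod z1 < T -> 3 * Cmod z2 < T -> 2 <= T ->
   Cmod (F (Clog (T + z2)) - F (Clog (T + z1))) <= (2 * ln 2 + PI) * M * exp (- (T / 8))).
{ intros T HT1 HT2 HT.
  destruct (Clog_far z1 T HT1 HT) as [A1 B1]; destruct (Clog_far z2 T HT2 HT) as [A2 B2].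
  set (l1 := Clog (T + z1)) in *; set (l2 := Clog (T + z2)) in *.
  apply Rabs_le_between in B1; apply Rabs_le_between in B2.
  pose proof PI_RGT_0 as Hpi; pose proof PI_4 as Hpi4.
  assert (Hln2 : ln (2 * T) = ln 2 + ln T) by (apply ln_mult; lra).
  assert (Hlnh : ln (T / 2) = ln T - ln 2) by (apply ln_div; lra).
  assert (Hl0 : 0 <= ln (T / 2)) by (rewrite <- ln_1; apply ln_le; lra).
  assert (Hd : Cmod (l2 - l1) <= 2 * ln 2 + PI).
  { replace (l2 - l1)%C with ((Re l2 - Re l1, Im l2 - Im l1) : C)
      by (destruct l1, l2; unfold Cminus, Cplus, Copp; simpl; f_equal; ring).
    eapply Rle_trans; [apply Cmod_pair_le|]; apply Rplus_le_compat; apply Rabs_le; lra. }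
  pose proof (Cmod_ge_0 (l2 - l1)) as Hd0.
  set (B := (2 * ln 2 + PI) * M * exp (- (T / 8))).
  replace (F l2 - F l1)%C with (F (l1 + RtoC 1 * (l2 - l1)) - F (l1 + RtoC 0 * (l2 - l1)))%C
    by (f_equal; [|f_equal]; f_equal; ring).
  replace B with (1 * B - 0 * B) by ring.
  apply (increment_dominated (fun s => F (l1 + s * (l2 - l1))%C)
    (fun s => gamma_density al (l1 + s * (l2 - l1)) * (0 + (1 * (l2 - l1) + s * 0)))%C (fun s => s * B) (fun _ => B)); [lra| | |].
  - intros s _; apply (Cderiv_Rderiv_comp F); [apply HF|].
    apply Rderiv_plus; [apply Rderiv_const|].
    apply Rderiv_mult; [|apply Rderiv_const].
    apply (Rderiv_RtoC (fun s => s)), (is_derive_id (K:=R_AbsRing)).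
  - intros s _; auto_derive; [easy|ring].
  - intros s Hs; unfold B.
    replace (0 + (1 * (l2 - l1) + s * 0))%C with (l2 - l1)%C by ring.
    rewrite Cmod_mult, Rmult_comm, Rmult_assoc; apply Rmult_le_compat; [easy|apply Cmod_ge_0|easy|].
    set (l := (l1 + s * (l2 - l1))%C).
    assert (Er : ln (T / 2) <= Re l <= ln (2 * T)).
    { unfold l; replace (Re (l1 + s * (l2 - l1))) with ((1 - s) * Re l1 + s * Re l2) by (destruct l1, l2; simpl; ring); nra. }
    assert (Ei : - (PI / 3) <= Im l <= PI / 3).
    { unfold l; replace (Im (l1 + s * (l2 - l1))) with ((1 - s) * Im l1 + s * Im l2) by (destruct l1, l2; simpl; ring); nra. }
    unfold gamma_density, M; rewrite Cmod_opp, Cmod_Cexp, <- exp_plus; apply exp_mono.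
    unfold Cminus; rewrite re_plus, re_opp.
    assert (Hal : Re (al * l) <= Cmod al * (ln (2 * T) + 2)).
    { eapply Rle_trans; [apply Rle_abs|]; eapply Rle_trans; [apply re_le_Cmod|]; rewrite Cmod_mult.
      apply Rmult_le_compat_l; [apply Cmod_ge_0|].
      destruct l as [x y]; simpl in Er, Ei; eapply Rle_trans; [apply Cmod_pair_le|].
      apply Rplus_le_compat; apply Rabs_le; lra. }
    assert (He : T / 4 <= Re (Cexp l)).
    { change (T / 4 <= exp (Re l) * cos (Im l)).
      assert (E1 : T / 2 <= exp (Re l)) by (rewrite <- (exp_ln (T / 2)) by lra; apply exp_mono; lra).
      assert (E2 : 1 / 2 <= cos (Im l)).
      { rewrite <- cos_PI3.
        replace (cos (Im l)) with (cos (Rabs (Im l))) by (unfold Rabs; destruct Rcase_abs; [apply cos_neg|easy]).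
        apply cos_decr_1; try lra; try apply Rabs_pos.
        - apply Rabs_le; lra.
        - apply Rabs_le; lra. }
      apply Rle_trans with (T / 2 * (1 / 2)); [lra|apply Rmult_le_compat; lra]. }
    specialize (HK0 (2 * T) ltac:(lra)); lra. }
apply Ceq_minus, Cmod_eq_0; apply Rle_antisym; [|apply Cmod_ge_0].
apply le_epsilon; intros eps Heps; rewrite Rplus_0_l.
(* The three errors at T sum to at most Q exp(-T/8). *)
set (Q := Rabs K1 + Rabs K2 + (2 * ln 2 + PI) * M + 1).
assert (HQ0 : 0 < (2 * ln 2 + PI) * M).
{ apply Rmult_lt_0_compat; [|easy]; pose proof PI_RGT_0; pose proof (ln_lt_2); lra. }
assert (HQ : 0 < Q) by (unfold Q; pose proof (Rabs_pos K1); pose proof (Rabs_pos K2); lra).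
assert (exists T, 3 * Cmod z1 < T /\ 3 * Cmod z2 < T /\ 2 <= T /\ Q * exp (- (T / 8)) <= eps) as [T [T1 [T2 [T3 T4]]]].
{ set (T := 3 * Cmod z1 + 3 * Cmod z2 + 2 + 8 * (Q / eps)).
  pose proof (Cmod_ge_0 z1); pose proof (Cmod_ge_0 z2).
  assert (0 < Q / eps) by now apply Rdiv_lt_0_compat.
  exists T; unfold T; repeat split; try lra; fold T.
  rewrite exp_Ropp; pose proof (exp_ineq1_le (T / 8)) as He; pose proof (exp_pos (T / 8)).
  apply Rmult_le_reg_r with (exp (T / 8)); [easy|].
  rewrite Rmult_assoc, Rinv_l, Rmult_1_r by lra.
  apply Rle_trans with (eps * (Q / eps)); [right; field; lra|]; apply Rmult_le_compat_l; [lra|].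
  unfold T in He |- *; lra. }
specialize (H1 T ltac:(lra)); specialize (H2 T ltac:(lra)); specialize (Hfar T T1 T2 T3).
assert (E : exp (- T / 2) <= exp (- (T / 8))) by (apply exp_mono; lra).
pose proof (exp_pos (- T / 2)); pose proof (Rle_abs K1); pose proof (Rle_abs K2).
pose proof (Rabs_pos K1); pose proof (Rabs_pos K2).
replace (c1 - c2)%C with ((F (Clog (T + z2)) - c2) - (F (Clog (T + z2)) - F (Clog (T + z1))) - (F (Clog (T + z1)) - c1))%C by ring.
unfold Cminus at 1 2.
eapply Rle_trans; [apply Cmod_triangle|]; rewrite Cmod_opp.
eapply Rle_trans; [apply Rplus_le_compat_r; apply Cmod_triangle|]; rewrite Cmod_opp.
eapply Rle_trans; [|exact T4]; unfold Q.
assert (K1 * exp (- T / 2) <= Rabs K1 * exp (- (T / 8))) by (apply Rle_trans with (Rabs K1 * exp (- T / 2)); nra).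
assert (K2 * exp (- T / 2) <= Rabs K2 * exp (- (T / 8))) by (apply Rle_trans with (Rabs K2 * exp (- T / 2)); nra).
pose proof (exp_pos (- (T / 8))).
unfold Cminus in *; lra.
Qed.

(** * Existence of the incomplete gamma function and the terminant *)

Lemma is_CInt_gen_intro f l : (forall T, 0 <= T -> Cintegrable f 0 T) ->
  (forall eps, 0 < eps -> exists M, forall T I, M < T -> 0 <= T -> is_CInt f 0 T I -> Cmod (I - l) < eps) ->
  is_RInt_gen (V := C_R_NormedModule) f (at_point 0) (Rbar_locally p_infty) l.
Proof.
intros Hex Hlim P [eps HP].
destruct (Hlim eps (cond_pos eps)) as [M HM].
exists (fun x => x = 0) (fun x => Rmax M 0 < x).
- easy.
- exists (Rmax M 0); easy.
- intros x T -> HT; simpl.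
  pose proof (Rmax_l M 0); pose proof (Rmax_r M 0).
  destruct (Hex T ltac:(lra)) as [I HI]; exists I; split; [exact HI|].
  apply HP; specialize (HM T I ltac:(lra) ltac:(lra) HI).
  split.
  + eapply Rle_lt_trans; [apply (re_le_Cmod (I - l))|exact HM].
  + eapply Rle_lt_trans; [apply (im_le_Cmod (I - l))|exact HM].
Qed.

(** The derivative in the logarithmic variable is entire, so it has an entire primitive;
    subtracting the limit at +oo makes it the integral on the principal sheet. *)
Theorem incomplete_gamma_exists al : exists F : C -> C,
  (forall l, Cderiv F l (gamma_density al l)) /\ is_incomplete_gamma al F /\
  (forall z, off_cut z -> forall eps, 0 < eps -> exists M, forall T, M < T -> 0 <= T ->
     Cmod (F (Clog (T + z))) < eps).
Proof.
destruct (Centire_primitive _ (Centire_gamma_density al)) as [F0 HF0].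
assert (H1 : off_cut 1) by (left; simpl; lra).
destruct (gamma_primitive_limit al F0 1 HF0 H1) as [c [K [HK Hc]]].
set (F := fun l => (F0 l - c)%C).
assert (HF : forall l, Cderiv F l (gamma_density al l)).
{ intros l; eapply Cderiv_eq; [apply Cderiv_minus; [apply HF0|apply Cderiv_const]|ring]. }
assert (Hlim : forall z, off_cut z -> exists K, 0 <= K /\ forall t, 0 <= t -> Cmod (F (Clog (t + z))) <= K * exp (- t / 2)).
{ intros z Hz; destruct (gamma_primitive_limit al F0 z HF0 Hz) as [c' [K' [HK' Hc']]].
  rewrite <- (gamma_primitive_limit_unique al F0 1 z c c' K K' HF0 Hc Hc') in Hc'.
  now exists K'. }
assert (Hlim2 : forall z, off_cut z -> forall eps, 0 < eps -> exists M, forall T, M < T -> 0 <= T ->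
     Cmod (F (Clog (T + z))) < eps).
{ intros z Hz eps He; destruct (Hlim z Hz) as [K' [HK' H]].
  exists (2 * ((K' + 1) / eps)); intros T HT HT0.
  eapply Rle_lt_trans; [now apply H|].
  replace (- T / 2) with (- (T / 2)) by field; rewrite exp_Ropp.
  pose proof (exp_ineq1_le (T / 2)) as H2; pose proof (exp_pos (T / 2)) as Hp.
  apply Rmult_lt_reg_r with (exp (T / 2)); [easy|].
  rewrite Rmult_assoc, Rinv_l, Rmult_1_r by lra.
  apply Rlt_le_trans with (eps * ((K' + 1) / eps)); [|apply Rmult_le_compat_l; lra].
  replace (eps * ((K' + 1) / eps)) with (K' + 1) by (field; lra); lra. }
exists F; split; [exact HF|split; [|exact Hlim2]].
split; [|intros l; exists (gamma_density al l); apply HF].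
intros l Hl; set (z := Cexp l); assert (Hz : off_cut z) by now apply Cexp_off_cut.
assert (HI : forall T, 0 <= T -> is_CInt (gamma_integrand al z) 0 T (F l - F (Clog (T + z)))%C).
{ intros T HT.
  replace (F l - F (Clog (T + z)))%C with (- F (Clog (T + z)) - - F (Clog (0 + z)))%C.
  - apply (is_CInt_derive (fun t => - F (Clog (t + z)))%C); [easy| |].
    + intros t Ht; eapply Rderiv_eq; [apply Rderiv_opp, (gamma_primitive_deriv al F z t HF Hz); lra|ring].
    + intros t Ht; apply gamma_integrand_cont; [easy|lra].
  - unfold z at 2; rewrite Cplus_0_l, Clog_Cexp by easy; ring. }
apply is_CInt_gen_intro.
- intros T HT; eexists; exact (HI T HT).
- intros eps He; destruct (Hlim2 z Hz eps He) as [M HM]; exists M; intros T I HT HT0 HIT.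
  rewrite <- (is_CInt_unique _ _ _ _ HIT).
  change (fun t : R => (Cpower (z + t) (al - 1) * Cexp (- (z + t)))%C) with (gamma_integrand al z).
  rewrite (is_CInt_unique _ _ _ _ (HI T HT0)).
  replace (F l - F (Clog (T + z)) - F l)%C with (- F (Clog (T + z)))%C by ring.
  rewrite Cmod_opp; now apply HM.
Qed.

(** Two functions with the defining properties agree on the principal sheet, so everywhere. *)
Theorem incomplete_gamma_spec al :
  (forall l, Cderiv (incomplete_gamma al) l (gamma_density al l)) /\
  (forall z, off_cut z -> forall eps, 0 < eps -> exists M, forall T, M < T -> 0 <= T ->
     Cmod (incomplete_gamma al (Clog (T + z))) < eps).
Proof.
destruct (incomplete_gamma_exists al) as [F [HF [HiF Hlim]]].
assert (HG : is_incomplete_gamma al (incomplete_gamma al)).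
{ apply (epsilon_spec (inhabits (fun _ : C => RtoC 0)) (is_incomplete_gamma al)); now exists F. }
assert (E : forall l, incomplete_gamma al l = F l).
{ intros l; apply Ceq_minus; revert l.
  destruct HG as [HG1 HG2]; destruct HiF as [HF1 HF2].
  apply (identity_strip (fun l => incomplete_gamma al l - F l)%C PI).
  - apply Centire_minus; intros l; [apply HG2|apply HF2].
  - apply PI_RGT_0.
  - intros l Hl; apply (proj1 (Ceq_minus _ _)).
    exact (eq_trans (eq_sym (is_RInt_gen_unique (V:=C_R_CompleteNormedModule) _ _ (HG1 l Hl)))
      (is_RInt_gen_unique (V:=C_R_CompleteNormedModule) _ _ (HF1 l Hl))). }
split.
- intros l; apply (Cderiv_ext F); [intros; now rewrite E|apply HF].
- intros z Hz eps He; destruct (Hlim z Hz eps He) as [M HM]; exists M; intros T; rewrite E; apply HM.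
Qed.

(** Along a horizontal ray the modulus of z + t stays above |Im z|. *)
Lemma incomplete_gamma_bound (p l : C) : 0 < Re p -> Rabs (Im l) < PI -> Im (Cexp l) <> 0 ->
  Cmod (incomplete_gamma (1 - p) l) <=
    exp (- Re p * ln (Rabs (Im (Cexp l)))) * exp (Rabs (Im p) * PI) * exp (- Re (Cexp l)).
Proof.
intros Hp Hl HY; destruct (incomplete_gamma_spec (1 - p)) as [HF Hlim].
set (F := incomplete_gamma (1 - p)) in *.
set (z := Cexp l) in *; assert (Hz : off_cut z) by now apply Cexp_off_cut.
set (K := exp (- Re p * ln (Rabs (Im z))) * exp (Rabs (Im p) * PI) * exp (- Re z)).
assert (HK : 0 < K) by (unfold K; repeat apply Rmult_lt_0_compat; apply exp_pos).
assert (HY' : 0 < Rabs (Im z)) by now apply Rabs_pos_lt.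
assert (Hinc : forall T, 0 <= T -> Cmod (F (Clog (T + z)) - F l) <= K).
{ intros T HT.
  apply Rle_trans with (- (K * exp (- T)) - - (K * exp (- 0))).
  2:{ rewrite Ropp_0, exp_0; pose proof (exp_pos (- T)); nra. }
  replace (F l) with (F (Clog (0 + z))) by (unfold z; rewrite Cplus_0_l, Clog_Cexp; easy).
  apply (increment_dominated (fun t => F (Clog (t + z))) (fun t => - gamma_integrand (1 - p) z t)%C
     (fun t => - (K * exp (- t))) (fun t => K * exp (- t))); [easy| | |].
  - intros t Ht; apply gamma_primitive_deriv; [exact HF|easy|lra].
  - intros t Ht; auto_derive; [easy|ring].
  - intros t Ht; rewrite Cmod_opp, gamma_integrand_alt, Cmod_mult, Cmod_shifted_power, Cmod_Cexp.
    replace (Re (1 - (1 - p))) with (Re p) by (destruct p; simpl; ring).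
    replace (Im (1 - (1 - p))) with (Im p) by (destruct p; simpl; ring).
    unfold K; rewrite <- !exp_plus; apply exp_mono.
    rewrite re_opp, re_plus; simpl (Re (RtoC t)).
    assert (Hoff := off_cut_shift z t Hz ltac:(lra)).
    assert (A1 : ln (Rabs (Im z)) <= Re (Clog (t + z))).
    { change (Re (Clog (t + z))) with (ln (Cmod (t + z))); apply ln_le; [easy|].
      replace (Im z) with (Im (t + z)) by (rewrite im_plus; simpl; ring); apply im_le_Cmod. }
    assert (A2 : Rabs (Im (Clog (t + z))) <= PI) by (left; apply (Carg_off_cut _ Hoff)).
    assert (A3 : Im p * Im (Clog (t + z)) <= Rabs (Im p) * PI).
    { eapply Rle_trans; [apply Rle_abs|]; rewrite Rabs_mult; apply Rmult_le_compat_l; [apply Rabs_pos|easy]. }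
    nra. }
apply le_epsilon; intros eps He; destruct (Hlim z Hz eps He) as [M HM].
set (T := Rmax M 0 + 1); pose proof (Rmax_l M 0); pose proof (Rmax_r M 0).
specialize (HM T ltac:(unfold T; lra) ltac:(unfold T; lra)).
specialize (Hinc T ltac:(unfold T; lra)); rewrite Cmod_sub_sym in Hinc.
replace (F l) with ((F l - F (Clog (T + z))) + F (Clog (T + z)))%C by ring.
eapply Rle_trans; [apply Cmod_triangle|]; lra.
Qed.

Lemma Cexp_half_pi : Cexp (PI / 2 * Ci) = Ci.
Proof.
replace (PI / 2 * Ci)%C with ((0, PI / 2) : C).
- unfold Cexp; simpl; rewrite exp_0, cos_PI2, sin_PI2; unfold Ci; f_equal; ring.
- unfold Ci; rewrite <- RtoC_div by lra; unfold Cmult, RtoC; simpl; f_equal; ring.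
Qed.

Lemma Cexp_Ci x : Cexp (Ci * RtoC x) = (cos x + Ci * sin x)%C.
Proof.
unfold Cexp, Ci, Cmult, Cplus, RtoC; simpl.
replace (0 * x - 1 * 0) with 0 by ring; replace (0 * 0 + 1 * x) with x by ring.
rewrite exp_0; f_equal; ring.
Qed.

(** The point of the surface of the logarithm over 2 pi (k+1) (x + a). *)
Definition log_point (a : C) (k : nat) (x : R) : C := (RtoC (ln (freq k)) + Clog (x + a))%C.

Lemma Cexp_log_point a k x : off_cut a -> 0 <= x -> Cexp (log_point a k x) = (freq k * (x + a))%C.
Proof.
intros Ha Hx; unfold log_point; rewrite Cexp_plus, Cexp_Clog by now apply off_cut_neq_0, off_cut_shift.
f_equal; unfold Cexp, RtoC; simpl; rewrite exp_ln by apply freq_pos; rewrite cos_0, sin_0; f_equal; ring.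
Qed.

Lemma log_point_0 a k : off_cut a -> log_point a k 0 = Clog (2 * PI * a * RtoC (INR k + 1)).
Proof.
intros Ha; pose proof (freq_pos k) as Hw; unfold log_point.
replace (2 * PI * a * RtoC (INR k + 1))%C with (freq k * a)%C.
2:{ unfold freq; rewrite !RtoC_mult; ring. }
rewrite <- (Clog_Cexp (RtoC (ln (freq k)) + Clog (0 + a))).
- f_equal; assert (H := Cexp_log_point a k 0 Ha ltac:(lra)); unfold log_point in H; rewrite H; ring.
- rewrite im_plus; simpl (Im (RtoC _)); rewrite Rplus_0_l.
  apply (Carg_off_cut (0 + a)), off_cut_shift; [easy|lra].
Qed.

(** The terminant with its two incomplete gamma functions slid vertically. *)
Definition terminant_shift (a p : C) (k : nat) (x : R) : C :=
  (Cexp (p * log_point a k 0) / 2 *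
    (Cexp (PI / 2 * Ci * p) * Cexp (Ci * Cexp (log_point a k 0))
       * incomplete_gamma (1 - p) (log_point a k x + PI / 2 * Ci)
     + Cexp (- (PI / 2 * Ci * p)) * Cexp (- (Ci * Cexp (log_point a k 0)))
       * incomplete_gamma (1 - p) (log_point a k x - PI / 2 * Ci)))%C.

Lemma terminant_shift_0 a p k : off_cut a ->
  terminant_shift a p k 0 = terminant p (Clog (2 * PI * a * RtoC (INR k + 1))).
Proof. intros Ha; unfold terminant_shift, terminant; now rewrite log_point_0. Qed.

(** The exponential prefactors cancel the growth of the two densities, leaving
    i w (e^(iwx) - e^(-iwx)) / 2 = -w sin(wx). *)
Lemma terminant_shift_deriv a p k x : off_cut a -> 0 <= x ->
  Rderiv (terminant_shift a p k) x
    (- (freq k * sin (freq k * x))%R * (Cexp (p * Clog a) * shifted_power a p x))%C.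
Proof.
intros Ha Hx; assert (Hoff := off_cut_shift a x Ha Hx); assert (H0 := off_cut_neq_0 _ Hoff).
destruct (incomplete_gamma_spec (1 - p)) as [HG _].
set (w := freq k); set (G := incomplete_gamma (1 - p)) in *; set (lp := log_point a k).
assert (Hl : Rderiv lp x (0 + / (x + a))%C).
{ apply Rderiv_plus; [apply Rderiv_const|now apply Rderiv_Clog]. }
assert (Hlp : forall c, Rderiv (fun x => lp x + c)%C x (0 + / (x + a) + 0)%C).
{ intros c; apply Rderiv_plus; [exact Hl|apply Rderiv_const]. }
set (c := (PI / 2 * Ci)%C).
eapply Rderiv_eq.
- unfold terminant_shift; fold lp G c; apply Rderiv_scal, Rderiv_plus.
  + apply Rderiv_scal; apply (Cderiv_Rderiv_comp G (fun x => lp x + c)%C); [apply HG|apply Hlp].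
  + apply Rderiv_scal; apply (Cderiv_Rderiv_comp G (fun x => lp x + - c)%C); [apply HG|apply Hlp].
- assert (E0 := Cexp_log_point a k 0 Ha ltac:(lra)); assert (Ex := Cexp_log_point a k x Ha Hx).
  fold lp w in E0, Ex; rewrite Cplus_0_l in E0.
  assert (Ec : Cexp c = Ci) by apply Cexp_half_pi.
  assert (Eq : (Cexp (p * Clog a) * shifted_power a p x)%C = (Cexp (p * lp 0%R) / Cexp (p * lp x))%C).
  { unfold shifted_power, lp, log_point; rewrite <- Cexp_minus, <- Cexp_plus; f_equal; rewrite Cplus_0_l; ring. }
  assert (S1 : gamma_density (1 - p) (lp x + c) = (- (w * (x + a) * Ci / Cexp (p * lp x) / Cexp (c * p)
     / Cexp (Ci * (w * a)) / Cexp (Ci * (w * x)%R)))%C).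
  { unfold gamma_density; rewrite (Cexp_plus (lp x) c), Ex, Ec.
    replace ((1 - p) * (lp x + c) - w * (x + a) * Ci)%C with
      (lp x + c - p * lp x - c * p - Ci * (w * a) - Ci * (w * x)%R)%C by (rewrite RtoC_mult; ring).
    now rewrite !Cexp_minus, Cexp_plus, Ex, Ec. }
  assert (S2 : gamma_density (1 - p) (lp x + - c) = (- (w * (x + a) / Ci / Cexp (p * lp x) * Cexp (c * p)
     * Cexp (Ci * (w * a)) * Cexp (Ci * (w * x)%R)))%C).
  { unfold gamma_density; fold (lp x - c)%C; rewrite (Cexp_minus (lp x) c), Ex, Ec.
    replace ((1 - p) * (lp x - c) - w * (x + a) / Ci)%C with
      (lp x - c - p * lp x + c * p + Ci * (w * a) + Ci * (w * x)%R)%C.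
    - now rewrite !Cexp_plus, !Cexp_minus, Ex, Ec.
    - unfold Cdiv; rewrite Ci_inv, RtoC_mult; ring. }
  rewrite S1, S2, Eq, E0, !Cexp_opp.
  pose proof (Cexp_neq_0 (Ci * (w * x)%R)) as N1; pose proof (Cexp_neq_0 (Ci * (w * a))) as N2.
  pose proof (Cexp_neq_0 (c * p)) as N3; pose proof (Cexp_neq_0 (p * lp x)) as N4.
  assert (Esin : RtoC (w * sin (w * x)) = (w * ((Cexp (Ci * (w * x)%R) - / Cexp (Ci * (w * x)%R)) / (2 * Ci)))%C).
  { rewrite <- Cexp_opp.
    replace (- (Ci * (w * x)%R))%C with (Ci * RtoC (- (w * x)))%C by (rewrite RtoC_opp; ring).
    rewrite !Cexp_Ci, cos_neg, sin_neg, RtoC_mult, RtoC_opp; field; exact Ci_nz. }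
  rewrite Esin.
  set (X := Cexp (Ci * (w * x)%R)) in *; set (A := Cexp (Ci * (w * a))) in *.
  set (Q := Cexp (c * p)) in *; set (P := Cexp (p * lp x)) in *.
  set (P0 := Cexp (p * lp 0%R)).
  transitivity (P0 / P * w / 2 * (- Ci / X - X / Ci))%C.
  + field; repeat split; first [exact Ci_nz|assumption].
  + assert (Ei : (Ci * Ci)%C = (- (1))%C) by (unfold Ci, Cmult, Copp, RtoC; simpl; f_equal; ring).
    unfold Cdiv; rewrite Ci_inv.
    replace (/ (2 * Ci))%C with (- Ci / 2)%C.
    * field; auto.
    * transitivity (- (Ci * Ci) / (2 * Ci))%C; [field; exact Ci_nz|rewrite Ei; field; exact Ci_nz].
Qed.

Lemma power_decay q : 0 < q -> forall eps, 0 < eps -> exists Y0, 0 < Y0 /\ forall Y, Y0 <= Y -> exp (- q * ln Y) < eps.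
Proof.
intros Hq eps He; exists (exp (- ln eps / q + 1)); split; [apply exp_pos|]; intros Y HY.
apply ln_le in HY; [|apply exp_pos]; rewrite ln_exp in HY.
rewrite <- (exp_ln eps) by easy; apply exp_increasing.
apply (Rmult_le_compat_l q) in HY; [|lra].
replace (q * (- ln eps / q + 1)) with (- ln eps + q) in HY by (field; lra); lra.
Qed.

(** The slid points tend to infinity along the directions +i and -i, on the principal sheet
    as soon as Re(x + a) > 0, whatever the sheet they started from. *)
Lemma terminant_shift_lim a p k : off_cut a -> 0 < Re p -> forall eps, 0 < eps ->
  exists N, forall n, (N <= n)%nat -> Cmod (terminant_shift a p k (INR n)) < eps.
Proof.
intros Ha Hp eps He; set (w := freq k); assert (Hw : 0 < w) by apply freq_pos.
set (A1 := Cmod (Cexp (p * log_point a k 0) / 2)%C).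
set (A2 := Cmod (Cexp (PI / 2 * Ci * p) * Cexp (Ci * Cexp (log_point a k 0)))%C).
set (A3 := Cmod (Cexp (- (PI / 2 * Ci * p)) * Cexp (- (Ci * Cexp (log_point a k 0))))%C).
set (B := exp (Rabs (Im p) * PI) * (exp (w * Im a) + exp (- (w * Im a)))).
assert (HA1 : 0 <= A1) by apply Cmod_ge_0; assert (HA2 : 0 <= A2) by apply Cmod_ge_0.
assert (HA3 : 0 <= A3) by apply Cmod_ge_0.
assert (HB : 0 < B) by (unfold B; apply Rmult_lt_0_compat; [apply exp_pos|pose proof (exp_pos (w * Im a)); pose proof (exp_pos (- (w * Im a))); lra]).
set (K := A1 * ((A2 + A3) * B)).
assert (HK : 0 <= K) by (unfold K; apply Rmult_le_pos; [easy|apply Rmult_le_pos; lra]).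
destruct (power_decay (Re p) Hp (eps / (K + 1))) as [Y0 [HY0 HY]]; [apply Rdiv_lt_0_compat; lra|].
destruct (INR_unbounded (Y0 / w + Rabs (Re a))) as [N HN].
exists N; intros n Hn; apply le_INR in Hn.
pose proof (Rle_abs (- Re a)) as Hr; rewrite Rabs_Ropp in Hr.
pose proof (Rdiv_lt_0_compat _ _ HY0 Hw) as HYw.
assert (HRe : Y0 / w < INR n + Re a) by lra.
set (Y := w * (INR n + Re a)).
assert (HYY : Y0 <= Y).
{ unfold Y; replace Y0 with (w * (Y0 / w)) by (field; lra); apply Rmult_le_compat_l; lra. }
assert (Hn0 := pos_INR n).
assert (El := Cexp_log_point a k (INR n) Ha Hn0); fold w in El.
assert (HarR : Rabs (Carg (INR n + a)) < PI / 2).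
{ apply Carg_right_half_plane; rewrite re_plus; simpl Re at 1; lra. }
apply Rabs_def2 in HarR.
assert (Him : Im (log_point a k (INR n)) = Carg (INR n + a)).
{ unfold log_point; rewrite im_plus; simpl (Im (RtoC _)); rewrite Rplus_0_l; easy. }
assert (Hc : (PI / 2 * Ci)%C = ((0, PI / 2) : C)).
{ unfold Ci; rewrite <- RtoC_div by lra; unfold Cmult, RtoC; simpl; f_equal; ring. }
pose proof PI_RGT_0 as Hpi.
assert (G1 : Cmod (incomplete_gamma (1 - p) (log_point a k (INR n) + PI / 2 * Ci)) <= exp (- Re p * ln Y) * B).
{ assert (Ez : Cexp (log_point a k (INR n) + PI / 2 * Ci) = ((- (w * Im a), Y) : C)).
  { rewrite Cexp_plus, El, Cexp_half_pi; unfold Y; destruct a; unfold Ci, Cmult, Cplus, RtoC; simpl; f_equal; ring. }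
  eapply Rle_trans; [apply incomplete_gamma_bound; [easy| |]|].
  - rewrite im_plus, Him, Hc; simpl Im; apply Rabs_def1; lra.
  - rewrite Ez; simpl; lra.
  - rewrite Ez; simpl; rewrite Rabs_pos_eq, Rmult_assoc by lra.
    apply Rmult_le_compat_l; [left; apply exp_pos|]; unfold B; apply Rmult_le_compat_l; [left; apply exp_pos|].
    rewrite Ropp_involutive; pose proof (exp_pos (- (w * Im a))); unfold Im in *; lra. }
assert (G2 : Cmod (incomplete_gamma (1 - p) (log_point a k (INR n) - PI / 2 * Ci)) <= exp (- Re p * ln Y) * B).
{ assert (Ez : Cexp (log_point a k (INR n) - PI / 2 * Ci) = ((w * Im a, - Y) : C)).
  { rewrite Cexp_minus, El, Cexp_half_pi; unfold Cdiv; rewrite Ci_inv; unfold Y; destruct a; unfold Ci, Cmult, Cplus, Copp, RtoC; simpl; f_equal; ring. }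
  eapply Rle_trans; [apply incomplete_gamma_bound; [easy| |]|].
  - unfold Cminus; rewrite im_plus, im_opp, Him, Hc; simpl Im; apply Rabs_def1; lra.
  - rewrite Ez; simpl; lra.
  - rewrite Ez; simpl; rewrite Rabs_Ropp, Rabs_pos_eq, Rmult_assoc by lra.
    apply Rmult_le_compat_l; [left; apply exp_pos|]; unfold B; apply Rmult_le_compat_l; [left; apply exp_pos|].
    pose proof (exp_pos (w * Im a)); unfold Im in *; lra. }
unfold terminant_shift; rewrite Cmod_mult; fold A1.
eapply Rle_lt_trans.
{ apply Rmult_le_compat_l; [easy|]; eapply Rle_trans; [apply Cmod_triangle|].
  rewrite (Cmod_mult (_ * _) (incomplete_gamma _ _)), (Cmod_mult (Cexp (- (PI / 2 * Ci * p)) * _) _).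
  fold A2 A3; apply Rplus_le_compat; apply Rmult_le_compat_l; [easy|exact G1|easy|exact G2]. }
replace (A1 * (A2 * (exp (- Re p * ln Y) * B) + A3 * (exp (- Re p * ln Y) * B))) with (K * exp (- Re p * ln Y)) by (unfold K; ring).
specialize (HY Y HYY); pose proof (exp_pos (- Re p * ln Y)).
apply (Rmult_lt_compat_l (K + 1)) in HY; [|lra].
replace ((K + 1) * (eps / (K + 1))) with eps in HY by (field; lra); nra.
Qed.

(** Integration by parts turns the conditionally convergent sine integral obtained from the
    slide into an absolutely convergent one with a nonnegative kernel. *)
Theorem terminant_osc_integral a p k : off_cut a -> 0 < Re p ->
  Cconv (fun n => p * Cexp (p * Clog a) * osc_integral a (p + 1) k n)%C
    (terminant p (Clog (2 * PI * a * RtoC (INR k + 1)))).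
Proof.
intros Ha Hp; rewrite <- terminant_shift_0 by easy.
set (ap := Cexp (p * Clog a)).
assert (H : forall n, (p * ap * osc_integral a (p + 1) k n)%C = (terminant_shift a p k 0 - terminant_shift a p k (INR n))%C).
{ intros n; pose proof (pos_INR n) as Hn.
  (* Subtracting (1 - cos) (x + a)^(-p) absorbs the sine term, and vanishes at the integers. *)
  set (F := fun x => (- terminant_shift a p k x - ap * shifted_power a p x * osc k x)%C).
  assert (E : (terminant_shift a p k 0 - terminant_shift a p k (INR n))%C = (F (INR n) - F 0)%C).
  { unfold F, osc; destruct (freq_int k n) as [E _]; rewrite E, Rmult_0_r, cos_0, !Rminus_diag; ring. }
  rewrite E; unfold osc_integral.
  rewrite <- (is_CInt_unique _ _ _ _ (is_CInt_scal (p * ap) _ _ _ _ (is_CInt_osc a (p + 1) k 0 (INR n) Ha ltac:(lra)))).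
  apply is_CInt_unique, is_CInt_derive; [easy| |].
  - intros x [Hx _]; unfold F; eapply Rderiv_eq.
    + apply Rderiv_minus; [apply Rderiv_opp, terminant_shift_deriv; easy|].
      apply Rderiv_mult; [apply Rderiv_scal, shifted_power_deriv; easy|apply Rderiv_osc].
    + fold ap; unfold osc_integrand; ring.
  - intros x [Hx _]; destruct (osc_integrand_deriv a (p + 1) k x Ha Hx) as [l Hl].
    exact (Rderiv_Ccont _ _ _ (Rderiv_scal (p * ap)%C _ _ _ Hl)). }
intros eps He; destruct (terminant_shift_lim a p k Ha Hp eps He) as [N HN].
exists N; intros n Hn; rewrite H.
replace (terminant_shift a p k 0 - terminant_shift a p k (INR n) - terminant_shift a p k 0)%C
  with (- terminant_shift a p k (INR n))%C by ring.
rewrite Cmod_opp; now apply HN.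
Qed.

(** * Even zeta values as sums of weights *)

Lemma is_derive_linear c v : is_derive (fun v => v * c) v c.
Proof. auto_derive; [easy|ring]. Qed.

Definition weight (N k : nat) : R := 2 / freq k ^ (2 * N).

Lemma freq_ge k : 2 * (INR k + 1) <= freq k.
Proof. unfold freq; pose proof PI2_1; pose proof (pos_INR k); nra. Qed.

Lemma weight_pos N k : 0 < weight N k.
Proof. apply Rdiv_lt_0_compat; [lra|apply pow_lt, freq_pos]. Qed.

Lemma weight_S N k : weight (S N) k = weight N k / freq k ^ 2.
Proof.
unfold weight; replace (2 * S N)%nat with (2 * N + 2)%nat by lia.
pose proof (freq_pos k); rewrite pow_add; field; repeat split; try apply pow_nonzero; lra.
Qed.

Lemma weight_le N k : (1 <= N)%nat -> weight N k <= 1 / (INR k + 1) ^ 2.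
Proof.
intros HN; induction HN as [|N HN IH].
- unfold weight; simpl (2 * 1)%nat; pose proof (freq_ge k) as Hf; pose proof (pos_INR k).
  apply Rle_trans with (2 / (2 * (INR k + 1)) ^ 2).
  + apply Rmult_le_compat_l; [lra|]; apply Rinv_le_contravar; [apply pow_lt; lra|apply pow_incr; lra].
  + apply Rmult_le_reg_r with ((INR k + 1) ^ 2); [apply pow_lt; lra|]; field_simplify; lra.
- eapply Rle_trans; [|exact IH]; rewrite weight_S.
  pose proof (freq_ge k) as Hf; pose proof (pos_INR k); pose proof (weight_pos N k).
  apply Rmult_le_reg_r with (freq k ^ 2); [apply pow_lt; lra|].
  unfold Rdiv; rewrite Rmult_assoc, Rinv_l, Rmult_1_r by (apply pow_nonzero; lra).
  assert (1 <= freq k ^ 2) by (rewrite <- (pow1 2); apply pow_incr; lra); nra.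
Qed.

(** Comparison with the telescoping series of 1/(m(m+1)). *)
Lemma weight_tail N n m : (1 <= N)%nat -> (n <= m)%nat ->
  0 <= Rsum (weight N) m - Rsum (weight N) n <= / (INR n + 1) - / (INR m + 1).
Proof.
intros HN Hnm; induction Hnm as [|m Hm IH]; [lra|].
unfold Rsum in *; simpl sum_f_R0; pose proof (weight_pos N (S m)); pose proof (weight_le N (S m) HN) as Hw.
rewrite S_INR in *; pose proof (pos_INR m).
assert (E : 1 / (INR m + 1 + 1) ^ 2 <= / (INR m + 1) - / (INR m + 1 + 1)).
{ replace (/ (INR m + 1) - / (INR m + 1 + 1)) with (1 / ((INR m + 1) * (INR m + 1 + 1))) by (field; lra).
  apply Rmult_le_compat_l; [lra|]; apply Rinv_le_contravar; nra. }
lra.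
Qed.

(** 2 zeta(2N) / (2 pi)^(2N). *)
Definition weight_sum (N : nat) : R := Series (weight N).

Lemma weight_sum_lim N : (1 <= N)%nat -> is_lim_seq (Rsum (weight N)) (weight_sum N).
Proof.
intros HN.
assert (H : ex_series (weight N)).
{ apply ex_series_Reals_1.
  destruct (growing_cv (Rsum (weight N))) as [l Hl].
  - intros n; unfold Rsum; simpl; pose proof (weight_pos N (S n)); lra.
  - exists (Rsum (weight N) 0 + 1); intros x [n ->].
    pose proof (weight_tail N 0 n HN ltac:(lia)) as H; simpl INR in H.
    rewrite Rplus_0_l, Rinv_1 in H; pose proof (pos_INR n).
    assert (0 < / (INR n + 1)) by (apply Rinv_0_lt_compat; lra); lra.
  - now exists l. }
apply (is_lim_seq_ext (sum_n (weight N))); [intros; apply sum_n_Reals|].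
now apply Series_correct.
Qed.

Lemma weight_sum_tail N n : (1 <= N)%nat -> 0 <= weight_sum N - Rsum (weight N) n <= / (INR n + 1).
Proof.
intros HN; assert (H := weight_sum_lim N HN).
split.
- assert (H2 : Rbar_le (Rsum (weight N) n) (weight_sum N)); [|simpl in H2; lra].
  refine (is_lim_seq_le_loc (fun _ => Rsum (weight N) n) (Rsum (weight N)) _ _ _ (is_lim_seq_const _) H).
  exists n; intros m Hm; pose proof (weight_tail N n m HN Hm); lra.
- assert (H2 : Rbar_le (weight_sum N) (Rsum (weight N) n + / (INR n + 1))); [|simpl in H2; lra].
  refine (is_lim_seq_le_loc (Rsum (weight N)) (fun _ => Rsum (weight N) n + / (INR n + 1)) _ _ _ H (is_lim_seq_const _)).
  exists n; intros m Hm; pose proof (weight_tail N n m HN Hm); pose proof (pos_INR m).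
  assert (0 < / (INR m + 1)) by (apply Rinv_0_lt_compat; lra); lra.
Qed.

Lemma inv_INR_lim c : is_lim_seq (fun n => c * / (INR n + 1)) 0.
Proof.
apply is_lim_seq_spec; intros eps; pose proof (cond_pos eps) as He.
destruct (INR_unbounded ((Rabs c + 1) / eps)) as [N HN]; exists N; intros n Hn; apply le_INR in Hn.
pose proof (pos_INR n); rewrite Rminus_0_r, Rabs_mult, (Rabs_pos_eq (/ _)) by (left; apply Rinv_0_lt_compat; lra).
apply Rmult_lt_reg_r with (INR n + 1); [lra|]; rewrite Rmult_assoc, Rinv_l, Rmult_1_r by lra.
pose proof (Rabs_pos c).
apply Rlt_trans with (eps * ((Rabs c + 1) / eps)); [replace (eps * ((Rabs c + 1) / eps)) with (Rabs c + 1) by (field; lra); lra|].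
apply Rmult_lt_compat_l; lra.
Qed.

(** * The Fourier series of x(1 - x)/2 *)

Definition saw_sum (n : nat) (x : R) : R := Rsum (fun k => weight 1 k * osc k x) n.

Lemma saw_sum_tail n m x : (n <= m)%nat -> 0 <= saw_sum m x - saw_sum n x <= 2 * / (INR n + 1).
Proof.
intros Hnm; pose proof (weight_tail 1 n m ltac:(lia) Hnm) as H.
assert (H2 : 0 <= saw_sum m x - saw_sum n x <= 2 * (Rsum (weight 1) m - Rsum (weight 1) n)).
{ clear H; induction Hnm as [|m Hm IH]; [lra|].
  unfold saw_sum, Rsum in *; simpl sum_f_R0; pose proof (weight_pos 1 (S m)); pose proof (osc_bounds (S m) x); nra. }
pose proof (pos_INR m); assert (0 < / (INR m + 1)) by (apply Rinv_0_lt_compat; lra); lra.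
Qed.

Lemma saw_sum_lim x : exists l, forall n, 0 <= l - saw_sum n x <= 2 * / (INR n + 1).
Proof.
destruct (growing_cv (fun n => saw_sum n x)) as [l Hl].
- intros n; pose proof (saw_sum_tail n (S n) x ltac:(lia)); lra.
- exists (saw_sum 0 x + 2); intros y [n ->].
  pose proof (saw_sum_tail 0 n x ltac:(lia)) as H; simpl INR in H; rewrite Rplus_0_l, Rinv_1 in H; lra.
- exists l; intros n; assert (Hl' := proj2 (is_lim_seq_Reals _ _) Hl); split.
  + assert (H2 : Rbar_le (saw_sum n x) l); [|simpl in H2; lra].
    refine (is_lim_seq_le_loc (fun _ => saw_sum n x) _ _ _ _ (is_lim_seq_const _) Hl').
    exists n; intros m Hm; pose proof (saw_sum_tail n m x Hm); lra.
  + assert (H2 : Rbar_le l (saw_sum n x + 2 * / (INR n + 1))); [|simpl in H2; lra].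
    refine (is_lim_seq_le_loc _ (fun _ => saw_sum n x + 2 * / (INR n + 1)) _ _ _ Hl' (is_lim_seq_const _)).
    exists n; intros m Hm; pose proof (saw_sum_tail n m x Hm); lra.
Qed.

Definition saw_error (n : nat) (x : R) : R := saw_sum n x - x * (1 - x) / 2.
Definition saw_error1 (n : nat) (x : R) : R := Rsum (fun k => 2 / freq k * sin (freq k * x)) n - 1 / 2 + x.

Lemma saw_error_deriv n x : is_derive (saw_error n) x (saw_error1 n x).
Proof.
assert (H : is_derive (saw_sum n) x (Rsum (fun k => 2 / freq k * sin (freq k * x)) n)).
{ unfold saw_sum, Rsum.
  assert (D : forall k, is_derive (fun x => weight 1 k * osc k x) x (2 / freq k * sin (freq k * x))).
  { intros k; unfold weight, osc; pose proof (freq_pos k); simpl (2 * 1)%nat; auto_derive; [easy|field; lra]. }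
  induction n as [|n IH]; simpl; [apply D|].
  apply (is_derive_plus (V:=R_NormedModule)); [exact IH|apply D]. }
unfold saw_error, saw_error1.
replace (Rsum (fun k => 2 / freq k * sin (freq k * x)) n - 1 / 2 + x) with
  (minus (Rsum (fun k => 2 / freq k * sin (freq k * x)) n) (1 / 2 - x)) by (unfold minus, plus, opp; simpl; ring).
apply (is_derive_minus (V:=R_NormedModule)); [exact H|auto_derive; [easy|field]].
Qed.

Definition dirichlet (n : nat) (x : R) : R := 1 + Rsum (fun k => 2 * cos (freq k * x)) n.

Lemma saw_error1_deriv n x : is_derive (saw_error1 n) x (dirichlet n x).
Proof.
assert (H : is_derive (fun x => Rsum (fun k => 2 / freq k * sin (freq k * x)) n) x (Rsum (fun k => 2 * cos (freq k * x)) n)).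
{ unfold Rsum.
  assert (D : forall k, is_derive (fun x => 2 / freq k * sin (freq k * x)) x (2 * cos (freq k * x))).
  { intros k; pose proof (freq_pos k); auto_derive; [easy|field; lra]. }
  induction n as [|n IH]; simpl; [apply D|].
  apply (is_derive_plus (V:=R_NormedModule)); [exact IH|apply D]. }
unfold saw_error1, dirichlet.
apply (is_derive_ext (fun x => plus (x - 1 / 2) (Rsum (fun k => 2 / freq k * sin (freq k * x)) n))).
{ intros t; unfold plus; simpl; ring. }
apply (is_derive_plus (V:=R_NormedModule)); [auto_derive; [easy|ring]|exact H].
Qed.

Lemma dirichlet_kernel n x : sin (PI * x) * dirichlet n x = sin ((2 * INR n + 3) * PI * x).
Proof.
assert (E : forall b c, 2 * cos b * sin c = sin (b + c) - sin (b - c)) by (intros; rewrite sin_plus, sin_minus; ring).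
unfold dirichlet, Rsum; induction n as [|n IH].
- simpl sum_f_R0; rewrite Rmult_plus_distr_l, Rmult_1_r, (Rmult_comm _ (2 * _)), E.
  unfold freq; simpl INR; replace (2 * PI * (0 + 1) * x - PI * x) with (PI * x) by ring.
  replace (2 * PI * (0 + 1) * x + PI * x) with ((2 * 0 + 3) * PI * x) by ring; ring.
- simpl sum_f_R0; rewrite <- Rplus_assoc, Rmult_plus_distr_l, IH, (Rmult_comm _ (2 * _)), E.
  unfold freq; rewrite S_INR.
  replace (2 * PI * (INR n + 1 + 1) * x - PI * x) with ((2 * INR n + 3) * PI * x) by ring.
  replace (2 * PI * (INR n + 1 + 1) * x + PI * x) with ((2 * (INR n + 1) + 3) * PI * x) by ring; ring.
Qed.

Lemma saw_error1_half n : saw_error1 n (1 / 2) = 0.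
Proof.
unfold saw_error1.
assert (H : Rsum (fun k => 2 / freq k * sin (freq k * (1 / 2))) n = 0); [|rewrite H; lra].
unfold Rsum; apply sum_eq_R0; intros k _.
replace (freq k * (1 / 2)) with (INR (S k) * PI) by (unfold freq; rewrite S_INR; field).
replace (sin (INR (S k) * PI)) with 0; [ring|].
symmetry; apply sin_eq_0_1; exists (Z.of_nat (S k)); now rewrite INR_IZR_INZ.
Qed.

(** One integration by parts against the rapidly oscillating Dirichlet kernel. *)
Lemma saw_error1_bound n x u : 0 < x -> x <= u <= 1 / 2 ->
  Rabs (saw_error1 n u) <= (1 + / sin (PI * x) + PI / sin (PI * x) ^ 2) / (2 * INR n + 3).
Proof.
intros Hx Hu; pose proof (pos_INR n) as Hn; pose proof PI_RGT_0 as Hpi; pose proof PI2_1 as Hpi1.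
set (s := sin (PI * x)); assert (Hs : 0 < s) by (apply sin_gt_0; nra).
assert (Hsu : forall v, x <= v <= 1 / 2 -> s <= sin (PI * v)).
{ intros v Hv; apply sin_incr_1; nra. }
set (M := (2 * INR n + 3) * PI); assert (HM : 0 < M) by (unfold M; nra).
assert (HMs : 0 < M * s ^ 2) by exact (Rmult_lt_0_compat _ _ HM (pow_lt s 2 Hs)).
(* The leading term of the integral of sin(Mv)/sin(pi v). *)
set (A := fun v => - cos (M * v) / (M * sin (PI * v))).
assert (HD : forall v, u <= v <= 1 / 2 -> is_derive (fun v => saw_error1 n v - A v) v
   (- (PI * cos (PI * v) * cos (M * v)) / (M * sin (PI * v) ^ 2))).
{ intros v Hv; assert (Hv' := Hsu v ltac:(lra)).
  assert (HA : is_derive A v (sin (M * v) / sin (PI * v) + PI * cos (PI * v) * cos (M * v) / (M * sin (PI * v) ^ 2))).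
  { unfold A; auto_derive; [nra|field; lra]. }
  replace (- (PI * cos (PI * v) * cos (M * v)) / (M * sin (PI * v) ^ 2)) with
    (minus (dirichlet n v) (sin (M * v) / sin (PI * v) + PI * cos (PI * v) * cos (M * v) / (M * sin (PI * v) ^ 2))).
  - apply (is_derive_minus (V:=R_NormedModule)); [apply saw_error1_deriv|exact HA].
  - unfold M at 1; rewrite <- dirichlet_kernel; unfold minus, plus, opp; simpl; field; lra. }
assert (Hb : Cmod (RtoC (saw_error1 n (1 / 2) - A (1 / 2)) - RtoC (saw_error1 n u - A u)) <=
   (1 / 2) * (PI / (M * s ^ 2)) - u * (PI / (M * s ^ 2))).
{ apply (increment_dominated (fun v => RtoC (saw_error1 n v - A v))
     (fun v => RtoC (- (PI * cos (PI * v) * cos (M * v)) / (M * sin (PI * v) ^ 2)))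
     (fun v => v * (PI / (M * s ^ 2))) (fun _ => PI / (M * s ^ 2))); [lra| | |].
  - intros v Hv; apply (Rderiv_RtoC (fun v => saw_error1 n v - A v)), HD, Hv.
  - intros v _; apply is_derive_linear.
  - intros v Hv; assert (Hv' := Hsu v ltac:(lra)).
    assert (Hq : 0 < M * sin (PI * v) ^ 2) by (apply Rmult_lt_0_compat; [easy|apply pow_lt; lra]).
    rewrite Cmod_R; unfold Rdiv; rewrite Rabs_mult, Rabs_Ropp, (Rabs_pos_eq (/ _))
      by (left; now apply Rinv_0_lt_compat).
    apply Rmult_le_compat; [apply Rabs_pos|left; now apply Rinv_0_lt_compat| |].
    + rewrite !Rabs_mult, (Rabs_pos_eq PI) by lra.
      pose proof (COS_bound (PI * v)); pose proof (COS_bound (M * v)).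
      assert (Rabs (cos (PI * v)) <= 1) by (apply Rabs_le; lra).
      assert (Rabs (cos (M * v)) <= 1) by (apply Rabs_le; lra).
      pose proof (Rabs_pos (cos (PI * v))); pose proof (Rabs_pos (cos (M * v))).
      rewrite Rmult_assoc; apply Rle_trans with (PI * 1); [apply Rmult_le_compat_l; [lra|nra]|lra].
    + apply Rinv_le_contravar; [exact HMs|]; apply Rmult_le_compat_l; [lra|]; apply pow_incr; lra. }
rewrite <- RtoC_minus, Cmod_R, saw_error1_half in Hb.
assert (HAb : forall v, x <= v <= 1 / 2 -> Rabs (A v) <= 1 / (M * sin (PI * v))).
{ intros v Hv; assert (Hv' := Hsu v Hv); unfold A, Rdiv; rewrite Rabs_mult, Rabs_Ropp, (Rabs_pos_eq (/ _))
    by (left; apply Rinv_0_lt_compat; nra).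
  apply Rmult_le_compat_r; [left; apply Rinv_0_lt_compat; nra|].
  pose proof (COS_bound (M * v)); apply Rabs_le; lra. }
assert (H1 := HAb (1 / 2) ltac:(lra)); assert (H2 := HAb u ltac:(lra)).
replace (PI * (1 / 2)) with (PI / 2) in H1 by field; rewrite sin_PI2, Rmult_1_r in H1.
assert (H3 : 1 / (M * sin (PI * u)) <= 1 / (M * s)).
{ apply Rmult_le_compat_l; [lra|]; apply Rinv_le_contravar; [nra|]; apply Rmult_le_compat_l; [lra|now apply Hsu]. }
assert (P : 0 < PI / (M * s ^ 2)) by (apply Rdiv_lt_0_compat; [lra|exact HMs]).
assert (H4 : Rabs (saw_error1 n u) <= 1 / M + 1 / (M * s) + PI / (M * s ^ 2)).
{ replace (saw_error1 n u) with (A u + (- A (1 / 2) - (0 - A (1 / 2) - (saw_error1 n u - A u)))) by ring.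
  eapply Rle_trans; [apply Rabs_triang|].
  eapply Rle_trans; [apply Rplus_le_compat_l, Rabs_triang|]; rewrite !Rabs_Ropp.
  assert ((1 / 2 - u) * (PI / (M * s ^ 2)) <= PI / (M * s ^ 2)) by nra; lra. }
eapply Rle_trans; [exact H4|].
replace (1 / M + 1 / (M * s) + PI / (M * s ^ 2)) with ((1 + / s + PI / s ^ 2) / M) by (field; lra).
assert (0 < 1 + / s + PI / s ^ 2).
{ pose proof (Rinv_0_lt_compat s Hs); assert (0 < PI / s ^ 2) by (apply Rdiv_lt_0_compat; [lra|nra]); lra. }
apply Rmult_le_compat_l; [lra|]; apply Rinv_le_contravar; [lra|]; unfold M; nra.
Qed.

Lemma osc_le k x : osc k x <= (freq k * x) ^ 2 / 2.
Proof.
unfold osc; replace (freq k * x) with (2 * (freq k * x / 2)) at 1 by field; rewrite cos_2a_sin.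
set (t := freq k * x / 2); replace (freq k * x) with (2 * t) by (unfold t; field).
assert (H : sin t ^ 2 <= t ^ 2).
{ assert (Hp : forall t, 0 <= t -> - t <= sin t <= t).
  { intros v Hv; destruct (Req_dec v 0) as [->|Hv0]; [rewrite sin_0; lra|].
    pose proof (sin_lt_x v ltac:(lra)).
    destruct (Rle_dec v 1) as [H1|H1].
    - pose proof (sin_ge_0 v ltac:(lra) ltac:(pose proof PI2_1; lra)); lra.
    - pose proof (SIN_bound v); lra. }
  destruct (Rle_dec 0 t) as [Ht|Ht]; [specialize (Hp t Ht); nra|].
  specialize (Hp (- t) ltac:(lra)); rewrite sin_neg in Hp; nra. }
simpl in *; lra.
Qed.

Lemma saw_sum_small n x : saw_sum n x <= (INR n + 1) * x ^ 2.
Proof.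
unfold saw_sum, Rsum.
assert (H : forall k, weight 1 k * osc k x <= x ^ 2).
{ intros k; pose proof (osc_le k x) as H; pose proof (freq_pos k) as Hf; pose proof (weight_pos 1 k) as Hw.
  apply Rle_trans with (weight 1 k * ((freq k * x) ^ 2 / 2)); [apply Rmult_le_compat_l; lra|].
  unfold weight; simpl (2 * 1)%nat; right; field; lra. }
induction n as [|n IH]; [simpl; specialize (H 0%nat); simpl in *; lra|].
rewrite S_INR; simpl sum_f_R0; specialize (H (S n)); lra.
Qed.

(** The limit minus x(1-x)/2 is constant on (0,1/2], because the derivative of the error tends
    to 0 away from 0; the constant is 0 because both functions are small near 0. *)
Theorem saw_fourier n x : 0 <= x <= 1 -> Rabs (x * (1 - x) / 2 - saw_sum n x) <= 2 * / (INR n + 1).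
Proof.
assert (Hhalf : forall x, 0 < x <= 1 / 2 -> forall n, 0 <= x * (1 - x) / 2 - saw_sum n x <= 2 * / (INR n + 1)).
{ clear x n.
  assert (Hc : forall x, 0 < x <= 1 / 2 -> forall l l0, (forall n, 0 <= l - saw_sum n x <= 2 * / (INR n + 1)) ->
     (forall n, 0 <= l0 - saw_sum n (1 / 2) <= 2 * / (INR n + 1)) -> l - x * (1 - x) / 2 = l0 - 1 / 8).
  { intros x Hx l l0 Hl Hl0.
    set (B := 1 + / sin (PI * x) + PI / sin (PI * x) ^ 2).
    assert (H : forall n, Rabs ((l - x * (1 - x) / 2) - (l0 - 1 / 8)) <= (4 + B) * / (INR n + 1)).
    { intros n; specialize (Hl n); specialize (Hl0 n); pose proof (pos_INR n).
      assert (HB0 : 0 <= B / (2 * INR n + 3)).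
      { eapply Rle_trans; [apply Rabs_pos|apply (saw_error1_bound n x x)]; lra. }
      assert (HB : 0 <= B).
      { apply Rmult_le_reg_r with (/ (2 * INR n + 3)); [apply Rinv_0_lt_compat; lra|]; unfold Rdiv in HB0; lra. }
      assert (Hd : Cmod (RtoC (saw_error n (1 / 2)) - RtoC (saw_error n x)) <=
         1 / 2 * (B / (2 * INR n + 3)) - x * (B / (2 * INR n + 3))).
      { apply (increment_dominated (fun v => RtoC (saw_error n v)) (fun v => RtoC (saw_error1 n v))
          (fun v => v * (B / (2 * INR n + 3))) (fun _ => B / (2 * INR n + 3))); [lra| | |].
        - intros v _; apply (Rderiv_RtoC (saw_error n)), saw_error_deriv.
        - intros v _; apply is_derive_linear.
        - intros v Hv; rewrite Cmod_R; apply saw_error1_bound; lra. }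
      rewrite <- RtoC_minus, Cmod_R in Hd; unfold saw_error in Hd.
      assert (HBn : B / (2 * INR n + 3) <= B * / (INR n + 1)).
      { apply Rmult_le_compat_l; [easy|]; apply Rinv_le_contravar; lra. }
      apply Rabs_le_between in Hd; apply Rabs_le.
      replace (1 / 2 * (1 - 1 / 2) / 2) with (1 / 8) in Hd by field.
      assert (x * (B / (2 * INR n + 3)) >= 0) by nra.
      lra. }
    apply Rminus_diag_uniq.
    assert (HR : Rbar_le (Rabs (l - x * (1 - x) / 2 - (l0 - 1 / 8))) 0).
    { refine (is_lim_seq_le (fun _ => _) (fun n => (4 + B) * / (INR n + 1)) _ _ H (is_lim_seq_const _) (inv_INR_lim _)). }
    simpl in HR; apply Rabs_eq_0; apply Rle_antisym; [exact HR|apply Rabs_pos]. }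
  intros x0 Hx0.
  destruct (saw_sum_lim (1 / 2)) as [l0 Hl0].
  assert (E0 : l0 - 1 / 8 = 0).
  { assert (H : forall n, Rabs (l0 - 1 / 8) <= 5 * / (INR n + 1)).
    { intros n; pose proof (pos_INR n); set (y := / (INR n + 1)).
      assert (Hy : 0 < y) by (apply Rinv_0_lt_compat; lra).
      assert (Hy1 : (INR n + 1) * y = 1) by (unfold y; field; lra).
      assert (Hyle : y <= 1) by nra.
      (* So close to 0 that n + 1 terms of size z^2 still sum to at most 1/(n+1). *)
      set (z := y ^ 2 / 2); assert (Hz : 0 < z <= 1 / 2) by (unfold z; nra).
      destruct (saw_sum_lim z) as [l Hl].
      rewrite <- (Hc z Hz l l0 Hl Hl0); specialize (Hl n); fold y in Hl.
      pose proof (saw_sum_small n z) as Hs.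
      assert (Hs0 : 0 <= saw_sum n z).
      { unfold saw_sum, Rsum; apply cond_pos_sum; intros k; pose proof (weight_pos 1 k); pose proof (osc_bounds k z); nra. }
      assert (Ez : (INR n + 1) * z ^ 2 <= y).
      { unfold z; replace ((INR n + 1) * (y ^ 2 / 2) ^ 2) with (((INR n + 1) * y) * (y ^ 3 / 4)) by field.
        rewrite Hy1; assert (y ^ 3 <= y) by (simpl; nra); assert (0 < y ^ 3) by (apply pow_lt; lra); lra. }
      assert (Hz2 : z <= y) by (unfold z; nra).
      apply Rabs_le; nra. }
    assert (HR : Rbar_le (Rabs (l0 - 1 / 8)) 0).
    { refine (is_lim_seq_le (fun _ => _) (fun n => 5 * / (INR n + 1)) _ _ H (is_lim_seq_const _) (inv_INR_lim _)). }
    simpl in HR; apply Rabs_eq_0; apply Rle_antisym; [exact HR|apply Rabs_pos]. }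
  destruct (saw_sum_lim x0) as [l Hl].
  assert (El : l = x0 * (1 - x0) / 2) by (pose proof (Hc x0 Hx0 l l0 Hl Hl0); lra).
  rewrite <- El; exact Hl. }
intros Hx; pose proof (pos_INR n).
assert (P : 0 < / (INR n + 1)) by (apply Rinv_0_lt_compat; lra).
assert (Hzero : forall k, osc k 0 = 0) by (intros; unfold osc; rewrite Rmult_0_r, cos_0; ring).
assert (Hsym : forall v, saw_sum n v = saw_sum n (1 - v)).
{ intros v; unfold saw_sum, Rsum; apply sum_eq; intros k _; f_equal; unfold osc; f_equal.
  replace (freq k * (1 - v)) with (- (freq k * v) + 2 * INR (S k) * PI) by (unfold freq; rewrite S_INR; ring).
  now rewrite cos_period, cos_neg. }
assert (H0 : saw_sum n 0 = 0).
{ unfold saw_sum, Rsum; apply sum_eq_R0; intros; rewrite Hzero; ring. }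
destruct (Rle_dec x (1 / 2)) as [Hx2|Hx2].
- destruct (Req_dec x 0) as [->|Hx0].
  + rewrite H0; replace (0 * (1 - 0) / 2 - 0) with 0 by field; rewrite Rabs_R0; lra.
  + specialize (Hhalf x ltac:(lra) n); apply Rabs_le; lra.
- rewrite Hsym; destruct (Req_dec x 1) as [->|Hx1].
  + replace (1 - 1) with 0 by ring; rewrite H0; replace (1 * 0 / 2 - 0) with 0 by field; rewrite Rabs_R0; lra.
  + specialize (Hhalf (1 - x) ltac:(lra) n); replace (1 - (1 - x)) with x in Hhalf by ring; apply Rabs_le; lra.
Qed.

(** * Bernoulli numbers as even zeta values *)

(** Lemmas on integrals state equalities in the carrier of a normed module, in which [ring]
    does not recognize the real numbers. *)
Ltac real_eq := match goal with |- @eq _ ?u ?v => change (@eq R u v) end.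

(** The cosine coefficients on [0,1] of x^m / m!. *)
Fixpoint cos_moment (k m : nat) : R :=
  match m with
  | S (S m') => (/ INR (fact (S m')) - cos_moment k m') / freq k ^ 2
  | _ => 0
  end.

Lemma monomial_deriv m x : is_derive (fun x => x ^ S m / INR (fact (S m))) x (x ^ m / INR (fact m)).
Proof.
auto_derive; [easy|].
change (match m with O => 1 | S _ => INR m + 1 end) with (INR (S m)).
change (fact m + m * fact m)%nat with (fact (S m)).
rewrite fact_simpl, mult_INR; field; split; [apply INR_fact_neq_0|apply not_0_INR; lia].
Qed.

Lemma is_RInt_derive_01 (F f : R -> R) : (forall x, 0 <= x <= 1 -> is_derive F x (f x)) ->
  (forall x, 0 <= x <= 1 -> ex_derive f x) -> is_RInt f 0 1 (F 1 - F 0).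
Proof.
intros HF Hf; apply (is_RInt_derive (V:=R_CompleteNormedModule) F f 0 1);
  rewrite Rmin_left, Rmax_right by lra; [exact HF|].
intros x Hx; now apply (ex_derive_continuous f), Hf.
Qed.

Lemma cos_moment_spec k m : is_RInt (fun x => x ^ m / INR (fact m) * cos (freq k * x)) 0 1 (cos_moment k m).
Proof.
pose proof (freq_pos k) as Hw; set (w := freq k) in *.
destruct (freq_int k 1) as [Hc Hs]; simpl INR in Hc, Hs; rewrite Rmult_1_r in Hc, Hs; fold w in Hc, Hs.
assert (H : forall m, is_RInt (fun x => x ^ m / INR (fact m) * cos (w * x)) 0 1 (cos_moment k m) /\
   is_RInt (fun x => x ^ S m / INR (fact (S m)) * cos (w * x)) 0 1 (cos_moment k (S m))).
2:{ exact (proj1 (H m)). }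
clear m; intros m; induction m as [|m [IH1 IH2]].
- split; simpl cos_moment.
  + replace 0 with (sin (w * 1) / w - sin (w * 0) / w) at 2.
    * apply (is_RInt_derive_01 (fun x => sin (w * x) / w)).
      -- intros x _; auto_derive; [easy|simpl; field; lra].
      -- intros x _; auto_derive; easy.
    * rewrite Rmult_1_r, Rmult_0_r, Hs, sin_0; field; lra.
  + replace 0 with ((1 * sin (w * 1) / w + cos (w * 1) / w ^ 2) - (0 * sin (w * 0) / w + cos (w * 0) / w ^ 2)) at 2.
    * apply (is_RInt_derive_01 (fun x => x * sin (w * x) / w + cos (w * x) / w ^ 2)).
      -- intros x _; auto_derive; [easy|simpl; field; lra].
      -- intros x _; auto_derive; easy.
    * rewrite Rmult_1_r, Rmult_0_r, Hs, Hc, cos_0; field; lra.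
- split; [exact IH2|].
  set (Q := fun j (x : R) => x ^ j / INR (fact j)) in *.
  assert (HQ : forall j x, is_derive (Q (S j)) x (Q j x)) by (intros; apply monomial_deriv).
  assert (HQx : forall j x, ex_derive (Q j) x) by (intros; unfold Q; auto_derive; easy).
  assert (HQ1 : forall j, Q j 1 = / INR (fact j)) by (intros j; unfold Q; rewrite pow1; unfold Rdiv; ring).
  assert (HQ0 : forall j, Q (S j) 0 = 0) by (intros j; unfold Q; rewrite pow_i by lia; unfold Rdiv; ring).
  assert (HI : is_RInt (fun x => Q (S (S m)) x * cos (w * x) + / w ^ 2 * (Q m x * cos (w * x))) 0 1
     (/ INR (fact (S m)) / w ^ 2)).
  { replace (/ INR (fact (S m)) / w ^ 2) with
      ((Q (S (S m)) 1 * (sin (w * 1) / w) + Q (S m) 1 * (cos (w * 1) / w ^ 2))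
       - (Q (S (S m)) 0 * (sin (w * 0) / w) + Q (S m) 0 * (cos (w * 0) / w ^ 2))).
    2:{ rewrite !HQ0, !HQ1, Rmult_1_r, Hs, Hc; field; repeat split; first [apply INR_fact_neq_0|lra]. }
    apply (is_RInt_derive_01 (fun x => Q (S (S m)) x * (sin (w * x) / w) + Q (S m) x * (cos (w * x) / w ^ 2))).
    - intros x _.
      replace (Q (S (S m)) x * cos (w * x) + / w ^ 2 * (Q m x * cos (w * x))) with
        (plus (plus (mult (Q (S m) x) (sin (w * x) / w)) (mult (Q (S (S m)) x) (cos (w * x))))
          (plus (mult (Q m x) (cos (w * x) / w ^ 2)) (mult (Q (S m) x) (- sin (w * x) / w))))
        by (unfold plus, mult; simpl; field; lra).
      assert (D1 : is_derive (fun x => sin (w * x) / w) x (cos (w * x))) by (auto_derive; [easy|field; lra]).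
      assert (D2 : is_derive (fun x => cos (w * x) / w ^ 2) x (- sin (w * x) / w)) by (auto_derive; [easy|simpl; field; lra]).
      apply @is_derive_plus.
      + exact (is_derive_mult (K:=R_AbsRing) (Q (S (S m))) _ x _ _ (HQ (S m) x) D1 Rmult_comm).
      + exact (is_derive_mult (K:=R_AbsRing) (Q (S m)) _ x _ _ (HQ m x) D2 Rmult_comm).
    - intros x _; unfold Q; auto_derive; easy. }
  change (cos_moment k (S (S m))) with ((/ INR (fact (S m)) - cos_moment k m) / w ^ 2).
  replace ((/ INR (fact (S m)) - cos_moment k m) / w ^ 2) with
    (/ INR (fact (S m)) / w ^ 2 - / w ^ 2 * cos_moment k m)
    by (field; repeat split; first [apply INR_fact_neq_0|lra]).
  apply (is_RInt_ext (fun x => (Q (S (S m)) x * cos (w * x) + / w ^ 2 * (Q m x * cos (w * x)))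
     - / w ^ 2 * (Q m x * cos (w * x)))).
  { intros x _; unfold Q; real_eq; ring. }
  exact (is_RInt_minus (V:=R_NormedModule) _ _ _ _ _ _ HI (is_RInt_scal (V:=R_NormedModule) _ _ _ (/ w ^ 2) _ IH1)).
Qed.

(** The integral over [0,1] of x^m / m! against the kernel 1 - cos. *)
Definition osc_moment (k m : nat) : R := / INR (fact (S m)) - cos_moment k m.

Lemma osc_moment_spec k m : is_RInt (fun x => x ^ m / INR (fact m) * osc k x) 0 1 (osc_moment k m).
Proof.
assert (H : is_RInt (fun x => x ^ m / INR (fact m)) 0 1 (/ INR (fact (S m)))).
{ replace (/ INR (fact (S m))) with (1 ^ S m / INR (fact (S m)) - 0 ^ S m / INR (fact (S m))).
  - apply (is_RInt_derive_01 (fun x => x ^ S m / INR (fact (S m)))); [intros; apply monomial_deriv|].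
    intros x _; auto_derive; easy.
  - rewrite pow1, pow_i by lia; field; apply INR_fact_neq_0. }
apply (is_RInt_ext (fun x => minus (x ^ m / INR (fact m)) (x ^ m / INR (fact m) * cos (freq k * x)))).
{ intros x _; unfold osc, minus, plus, opp; simpl; real_eq; ring. }
exact (is_RInt_minus (V:=R_NormedModule) _ _ _ _ _ _ H (cos_moment_spec k m)).
Qed.

Lemma osc_moment_SS k m : osc_moment k (S (S m)) = / INR (fact (S (S (S m)))) - osc_moment k m / freq k ^ 2.
Proof. unfold osc_moment at 1; simpl cos_moment; reflexivity. Qed.

(** The integral of the Fourier series of x(1-x)/2 against x^m / m!. *)
Lemma osc_moment_sum m : is_lim_seq (fun n => Rsum (fun k => weight 1 k * osc_moment k m) n)
  (INR (m + 1) / (2 * INR (fact (m + 3)))).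
Proof.
assert (Hs : forall n, is_RInt (fun x => x ^ m / INR (fact m) * saw_sum n x) 0 1 (Rsum (fun k => weight 1 k * osc_moment k m) n)).
{ intros n; unfold saw_sum, Rsum; induction n as [|n IH]; simpl sum_f_R0.
  - apply (is_RInt_ext (fun x => scal (weight 1 0) (x ^ m / INR (fact m) * osc 0 x))).
    { intros x _; unfold scal; simpl; unfold mult; simpl; real_eq; ring. }
    apply (is_RInt_scal (V:=R_NormedModule)), osc_moment_spec.
  - apply (is_RInt_ext (fun x => plus (x ^ m / INR (fact m) * sum_f_R0 (fun k => weight 1 k * osc k x) n)
      (scal (weight 1 (S n)) (x ^ m / INR (fact m) * osc (S n) x)))).
    { intros x _; unfold plus, scal; simpl; unfold mult; simpl; real_eq; ring. }
    apply (is_RInt_plus (V:=R_NormedModule)); [exact IH|].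
    apply (is_RInt_scal (V:=R_NormedModule)), osc_moment_spec. }
set (L := INR (m + 1) / (2 * INR (fact (m + 3)))).
assert (Hf : INR (fact (m + 3)) = (INR m + 3) * (INR m + 2) * (INR m + 1) * INR (fact m)).
{ replace (m + 3)%nat with (S (S (S m))) by lia; rewrite !fact_simpl, !mult_INR, !S_INR; ring. }
pose proof (pos_INR m) as Hm; pose proof (INR_fact_lt_0 m) as Hfm.
assert (HL : is_RInt (fun x => x ^ m / INR (fact m) * (x * (1 - x) / 2)) 0 1 L).
{ set (P := fun x => (x ^ (m + 2) / (INR m + 2) - x ^ (m + 3) / (INR m + 3)) / (2 * INR (fact m))).
  replace L with (P 1 - P 0).
  - apply (is_RInt_derive_01 P).
    + intros x _; unfold P; auto_derive; [easy|].
      replace (pred (m + 2)) with (S m) by lia; replace (pred (m + 3)) with (S (S m)) by lia.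
      rewrite !plus_INR; simpl; field; lra.
    + intros x _; auto_derive; easy.
  - unfold P, L; rewrite !pow1, !pow_i, Hf, plus_INR by lia; simpl INR; field; lra. }
apply is_lim_seq_spec; intros eps.
pose proof (inv_INR_lim (2 / INR (fact m))) as Hl; apply is_lim_seq_spec in Hl; destruct (Hl eps) as [N HN].
exists N; intros n Hn; specialize (HN n Hn); rewrite Rminus_0_r in HN.
eapply Rle_lt_trans; [|exact HN].
eapply Rle_trans; [|apply Rle_abs].
rewrite Rabs_minus_sym.
replace (2 / INR (fact m) * / (INR n + 1)) with (1 * (2 / INR (fact m) * / (INR n + 1)) - 0 * (2 / INR (fact m) * / (INR n + 1))) by ring.
apply (norm_RInt_le (V:=R_NormedModule) (fun x => minus (x ^ m / INR (fact m) * (x * (1 - x) / 2)) (x ^ m / INR (fact m) * saw_sum n x))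
  (fun _ => 2 / INR (fact m) * / (INR n + 1)) 0 1); [lra| | |].
- intros x Hx; unfold norm, minus, plus, opp; simpl; unfold abs; simpl.
  replace (x ^ m / INR (fact m) * (x * (1 - x) / 2) + - (x ^ m / INR (fact m) * saw_sum n x)) with
    (x ^ m / INR (fact m) * (x * (1 - x) / 2 - saw_sum n x)) by ring.
  pose proof (saw_fourier n x Hx) as Hsf.
  assert (Hxm : 0 <= x ^ m <= 1) by (split; [apply pow_le; lra|rewrite <- (pow1 m); apply pow_incr; lra]).
  rewrite Rabs_mult; unfold Rdiv at 1; rewrite Rabs_mult, (Rabs_pos_eq (/ _)), (Rabs_pos_eq (x ^ m))
    by (try (left; now apply Rinv_0_lt_compat); lra).
  pose proof (Rinv_0_lt_compat _ Hfm).
  replace (2 / INR (fact m) * / (INR n + 1)) with ((1 * / INR (fact m)) * (2 * / (INR n + 1))) by (unfold Rdiv; ring).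
  apply Rmult_le_compat; [apply Rmult_le_pos; lra|apply Rabs_pos|apply Rmult_le_compat_r; lra|exact Hsf].
- exact (is_RInt_minus (V:=R_NormedModule) _ _ _ _ _ _ HL (Hs n)).
- apply (is_RInt_derive_01 (fun x => x * (2 / INR (fact m) * / (INR n + 1)))).
  + intros x _; apply is_derive_linear.
  + intros x _; apply ex_derive_const.
Qed.

Definition zeta_coef (j : nat) : R := (-1) ^ (j + 1) * weight_sum j.

(** Position 2i of the generating sequence carries zeta_coef (j+i), odd positions vanish. *)
Definition interleave (j i : nat) : R := if Nat.even i then zeta_coef (j + Nat.div2 i) else 0.

(** Two integrations by parts lower the degree by two and raise the index of the zeta value
    by one, which unrolls the moments into zeta values with factorial denominators. *)
Lemma interleave_moment j m : (1 <= j)%nat ->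
  is_lim_seq (fun n => Rsum (fun k => weight j k * osc_moment k m) n)
    ((-1) ^ (j + 1) * sum_f_R0 (fun i => interleave j i / INR (fact (m + 1 - i))) m).
Proof.
assert (Hsgn : forall j, (-1) ^ j * (-1) ^ j = 1).
{ intros i; rewrite <- pow_add; replace (i + i)%nat with (2 * i)%nat by lia; apply pow_1_even. }
assert (H0 : forall j c, (1 <= j)%nat -> is_lim_seq (fun n => Rsum (fun k => weight j k * c) n) (weight_sum j * c)).
{ intros i c Hi; apply (is_lim_seq_ext (fun n => Rsum (weight i) n * c)).
  - intros n; unfold Rsum; rewrite Rmult_comm, scal_sum; easy.
  - apply (is_lim_seq_scal_r _ c (weight_sum i)), weight_sum_lim, Hi. }
assert (H : forall m j, (1 <= j)%nat ->
  is_lim_seq (fun n => Rsum (fun k => weight j k * osc_moment k m) n)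
    ((-1) ^ (j + 1) * sum_f_R0 (fun i => interleave j i / INR (fact (m + 1 - i))) m) /\
  is_lim_seq (fun n => Rsum (fun k => weight j k * osc_moment k (S m)) n)
    ((-1) ^ (j + 1) * sum_f_R0 (fun i => interleave j i / INR (fact (S m + 1 - i))) (S m))).
2:{ intros Hj; exact (proj1 (H m j Hj)). }
clear j m; intros m; induction m as [|m IH]; intros j Hj.
- split.
  + eapply is_lim_seq_ext; [|replace (_ * _) with (weight_sum j * / INR (fact 1)); [apply H0, Hj|]].
    * intros n; unfold Rsum; apply sum_eq; intros k _; unfold osc_moment; simpl; ring.
    * unfold interleave, zeta_coef; simpl; rewrite Nat.add_0_r.
      transitivity (((-1) ^ (j + 1) * (-1) ^ (j + 1)) * weight_sum j); [rewrite Hsgn; field|field].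
  + eapply is_lim_seq_ext; [|replace (_ * _) with (weight_sum j * / INR (fact 2)); [apply H0, Hj|]].
    * intros n; unfold Rsum; apply sum_eq; intros k _; unfold osc_moment; simpl; ring.
    * unfold interleave, zeta_coef; simpl; rewrite Nat.add_0_r.
      transitivity (((-1) ^ (j + 1) * (-1) ^ (j + 1)) * weight_sum j / 2); [rewrite Hsgn; field|field].
- split; [apply IH, Hj|].
  destruct (IH (S j) ltac:(lia)) as [IH1 _].
  assert (Hd : sum_f_R0 (fun i => interleave j i / INR (fact (S (S m) + 1 - i))) (S (S m)) =
     zeta_coef j / INR (fact (S (S (S m)))) + sum_f_R0 (fun i => interleave (S j) i / INR (fact (m + 1 - i))) m).
  { rewrite decomp_sum, decomp_sum by lia; simpl pred.
    unfold interleave at 1 2; simpl Nat.even; simpl Nat.div2; rewrite Nat.add_0_r.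
    replace (S (S m) + 1 - 0)%nat with (S (S (S m))) by lia.
    replace (0 / INR (fact (S (S m) + 1 - 1))) with 0 by (unfold Rdiv; ring); rewrite Rplus_0_l.
    f_equal; apply sum_eq; intros i _; unfold interleave; simpl Nat.even; simpl Nat.div2.
    now replace (j + S (Nat.div2 i))%nat with (S j + Nat.div2 i)%nat by lia. }
  rewrite Hd.
  apply (is_lim_seq_ext (fun n => Rsum (fun k => weight j k * / INR (fact (S (S (S m))))) n
      - Rsum (fun k => weight (S j) k * osc_moment k m) n)).
  { intros n; unfold Rsum; rewrite <- minus_sum; apply sum_eq; intros k _.
    rewrite osc_moment_SS, weight_S; pose proof (freq_pos k); field; repeat split; first [apply INR_fact_neq_0|lra]. }
  replace ((-1) ^ (j + 1) * (zeta_coef j / INR (fact (S (S (S m)))) + sum_f_R0 (fun i => interleave (S j) i / INR (fact (m + 1 - i))) m))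
    with (weight_sum j * / INR (fact (S (S (S m)))) - (-1) ^ (S j + 1) * sum_f_R0 (fun i => interleave (S j) i / INR (fact (m + 1 - i))) m).
  + apply is_lim_seq_minus'; [apply H0, Hj|exact IH1].
  + rewrite Rmult_plus_distr_l; unfold zeta_coef, Rdiv.
    replace ((-1) ^ (j + 1) * ((-1) ^ (j + 1) * weight_sum j * / INR (fact (S (S (S m)))))) with
      (((-1) ^ (j + 1) * (-1) ^ (j + 1)) * weight_sum j * / INR (fact (S (S (S m))))) by ring.
    rewrite Hsgn; simpl; ring.
Qed.

(** The two evaluations of the integral of x(1-x)/2 against x^m / m!, exactly and through the
    Fourier series. *)
Lemma interleave_recurrence m :
  sum_f_R0 (fun i => interleave 1 i / INR (fact (m + 1 - i))) m = INR (m + 1) / (2 * INR (fact (m + 3))).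
Proof.
assert (H := is_lim_seq_unique _ _ (interleave_moment 1 m (le_n 1))).
rewrite (is_lim_seq_unique _ _ (osc_moment_sum m)) in H; injection H as H; simpl in H |- *; lra.
Qed.

Lemma bernoulli_recurrence_unique (u v : nat -> R) : u 0%nat = v 0%nat ->
  (forall n, (1 <= n)%nat -> sum_f_R0 (fun k => u k / INR (fact (n + 1 - k))) n = 0) ->
  (forall n, (1 <= n)%nat -> sum_f_R0 (fun k => v k / INR (fact (n + 1 - k))) n = 0) ->
  forall n, u n = v n.
Proof.
intros H0 Hu Hv n; induction n as [n IH] using (well_founded_induction Wf_nat.lt_wf).
destruct n as [|n]; [exact H0|].
specialize (Hu (S n) ltac:(lia)); specialize (Hv (S n) ltac:(lia)).
rewrite tech5 in Hu, Hv; replace (S n + 1 - S n)%nat with 1%nat in Hu, Hv by lia.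
rewrite (sum_eq (fun k => u k / INR (fact (S n + 1 - k))) (fun k => v k / INR (fact (S n + 1 - k)))) in Hu.
- simpl in Hu, Hv; lra.
- intros i Hi; now rewrite IH by lia.
Qed.

(** The zeta values, interleaved with zeros and preceded by 1 and -1/2, satisfy the recurrence
    that determines the Bernoulli numbers. *)
Theorem bernoulli_zeta N : (1 <= N)%nat -> bernoulli (2 * N) / INR (fact (2 * N)) = zeta_coef N.
Proof.
intros HN.
set (v := fun k => match k with O => 1 | S O => - (1 / 2) | S (S i) => interleave 1 i end).
assert (H := bernoulli_recurrence_unique (fun k => bernoulli k / INR (fact k)) v).
replace (zeta_coef N) with (v (2 * N)%nat).
2:{ destruct N as [|N]; [lia|]; replace (2 * S N)%nat with (S (S (2 * N))) by lia; simpl v.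
  unfold interleave; replace (N + (N + 0))%nat with (2 * N)%nat by lia.
  rewrite Nat.even_even; now rewrite Nat.div2_double. }
apply H; clear H.
- unfold v, bernoulli; simpl; field.
- intros n Hn; assert (Hr := bernoulli_rec n Hn).
  apply Rmult_eq_reg_l with (INR (fact (S n))); [|apply INR_fact_neq_0].
  rewrite Rmult_0_r, <- Hr, scal_sum; apply sum_eq; intros k Hk.
  unfold Binomial.C; replace (n + 1 - k)%nat with (S n - k)%nat by lia.
  field; split; apply INR_fact_neq_0.
- intros n Hn; destruct n as [|[|m]]; [lia|simpl; field|].
  rewrite decomp_sum, decomp_sum by lia; simpl pred; simpl v.
  rewrite (sum_eq _ (fun i => interleave 1 i / INR (fact (m + 1 - i)))).
  2:{ intros i _; now replace (S (S m) + 1 - S (S i))%nat with (m + 1 - i)%nat by lia. }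
  rewrite interleave_recurrence.
  replace (S (S m) + 1 - 0)%nat with (S (S (S m))) by lia; replace (S (S m) + 1 - 1)%nat with (S (S m)) by lia.
  replace (m + 3)%nat with (S (S (S m))) by lia.
  rewrite (fact_simpl (S (S m))), mult_INR, plus_INR, !S_INR; simpl (INR 0).
  field; pose proof (pos_INR m); split; [apply INR_fact_neq_0|lra].
Qed.

Lemma weight_sum_pos N : (1 <= N)%nat -> 0 < weight_sum N.
Proof.
intros HN; pose proof (weight_sum_tail N 0 HN); pose proof (weight_pos N 0); unfold Rsum in *; simpl in *; lra.
Qed.

Lemma bernoulli_abs N : (1 <= N)%nat -> Rabs (bernoulli (2 * N)) / INR (fact (2 * N)) = weight_sum N.
Proof.
intros HN; rewrite <- (Rabs_pos_eq (INR (fact (2 * N)))) by apply pos_INR.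
rewrite <- Rabs_div by apply INR_fact_neq_0; rewrite bernoulli_zeta by easy.
unfold zeta_coef; rewrite Rabs_mult, pow_1_abs, Rmult_1_l, Rabs_pos_eq; [easy|].
left; now apply weight_sum_pos.
Qed.

(** * The Euler-Maclaurin expression with an oscillating remainder *)

Definition osc_partial (N : nat) (a z : C) (n : nat) : C :=
  Csum (fun k => weight N k * osc_integral a z k n)%C n.

Lemma weight_partial_le N n : (1 <= N)%nat -> 0 <= Rsum (weight N) n <= weight_sum N.
Proof.
intros HN; split.
- unfold Rsum; apply cond_pos_sum; intros k; left; apply weight_pos.
- pose proof (weight_sum_tail N n HN); lra.
Qed.

(** The double limit, over the frequencies and over the interval of integration. *)
Lemma osc_partial_conv N (a z : C) : (1 <= N)%nat -> a <> 0 -> Rabs (Carg a) < PI -> 1 < Re z ->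
  exists l, Cconv (osc_partial N a z) l.
Proof.
intros HN Ha Harg Hz.
destruct (osc_integral_bound a z Ha Harg Hz) as [K [HK [H1 H2]]].
destruct (Cconv_Cauchy (osc_partial N a z)
  (fun n => weight_sum N * K * exp (- (Re z - 1) * ln (1 + INR n)) + K * / (INR n + 1))) as [l [Hl _]].
- replace 0 with (weight_sum N * K * 0 + 0) by ring.
  apply is_lim_seq_plus'; [|apply inv_INR_lim].
  apply (is_lim_seq_scal_l _ (weight_sum N * K) 0), power_tail_lim; lra.
- intros n m Hnm; unfold osc_partial.
  replace (Csum (fun k => weight N k * osc_integral a z k m) m - Csum (fun k => weight N k * osc_integral a z k n) n)%C
    with (Csum (fun k => weight N k * (osc_integral a z k m - osc_integral a z k n)) n +
     (Csum (fun k => weight N k * osc_integral a z k m) m - Csum (fun k => weight N k * osc_integral a z k m) n))%C.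
  + eapply Rle_trans; [apply Cmod_triangle|]; apply Rplus_le_compat.
    * eapply Rle_trans; [apply Csum_weighted_bound; [intros; left; apply weight_pos|intros; now apply H1]|].
      pose proof (exp_pos (- (Re z - 1) * ln (1 + INR n))).
      rewrite <- Rmult_assoc; apply Rmult_le_compat_r; [lra|apply Rmult_le_compat_r; [easy|apply weight_partial_le, HN]].
    * eapply Rle_trans; [apply Csum_weighted_tail; [intros; left; apply weight_pos|easy|intros; apply H2]|].
      rewrite Rmult_comm; apply Rmult_le_compat_l; [easy|].
      pose proof (weight_tail N n m HN Hnm); pose proof (pos_INR m).
      assert (0 < / (INR m + 1)) by (apply Rinv_0_lt_compat; lra); lra.
  + rewrite (Csum_ext (fun k => weight N k * (osc_integral a z k m - osc_integral a z k n))%C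
      (fun k => weight N k * osc_integral a z k m - weight N k * osc_integral a z k n)%C) by (intros; ring).
    rewrite Csum_minus; ring.
- now exists l.
Qed.

Definition osc_total (N : nat) (a z : C) : C := epsilon (inhabits (RtoC 0)) (Cconv (osc_partial N a z)).

Lemma osc_total_spec N (a z : C) : (1 <= N)%nat -> a <> 0 -> Rabs (Carg a) < PI -> 1 < Re z ->
  Cconv (osc_partial N a z) (osc_total N a z).
Proof.
intros; unfold osc_total; apply (epsilon_spec (inhabits (RtoC 0)) (Cconv (osc_partial N a z))).
now apply osc_partial_conv.
Qed.

Lemma osc_total_diff N (a z : C) : (1 <= N)%nat -> a <> 0 -> Rabs (Carg a) < PI -> 1 < Re z ->
  exists l, Cderiv (osc_total N a) z l.
Proof.
intros HN Ha Harg Hz.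
destruct (osc_integral_taylor a z Ha Harg Hz) as [d [K [Hd [HK HT]]]].
apply (Cderiv_limit (fun n y => osc_partial N a y n) (osc_total N a) z (Rmin d (Re z - 1)) (weight_sum N * K)).
- apply Rmin_pos; lra.
- apply Rmult_le_pos; [left; now apply weight_sum_pos|easy].
- intros y Hy; apply osc_total_spec; try easy.
  assert (Hy2 := Rlt_le_trans _ _ _ Hy (Rmin_r _ _)).
  pose proof (re_le_Cmod (y - z)) as H; pose proof (Rabs_def2 _ _ (Rle_lt_trans _ _ _ H Hy2)) as [_ H3].
  unfold Cminus in H3; rewrite re_plus, re_opp in H3; lra.
- intros n; destruct (choice _ (fun k => HT k n)) as [D HD].
  exists (Csum (fun k => weight N k * D k)%C n); intros y Hy.
  assert (Hy1 := Rlt_le_trans _ _ _ Hy (Rmin_l _ _)).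
  unfold osc_partial; rewrite <- Csum_scal, <- !Csum_minus.
  rewrite (Csum_ext _ (fun k => weight N k * (osc_integral a y k n - osc_integral a z k n - (y - z) * D k))%C)
    by (intros; ring).
  eapply Rle_trans; [apply Csum_weighted_bound; [intros; left; apply weight_pos|intros k _; now apply HD]|].
  rewrite Rmult_assoc; apply Rmult_le_compat_r; [apply Rmult_le_pos; [easy|apply pow2_ge_0]|].
  now apply weight_partial_le.
Qed.

Lemma shifted_power_lim (a p : C) : a <> 0 -> Rabs (Carg a) < PI -> 0 < Re p ->
  Cconv (fun n => shifted_power a p (INR n)) 0.
Proof.
intros Ha Harg Hp; destruct (shifted_power_bound a Ha Harg) as [D [HD HB]].
set (M := exp ((Rabs (Re p) + Rabs (Im p)) * D)).
apply (Cconv_dominated _ _ (fun n => M * exp (- Re p * ln (1 + INR n)))).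
- replace 0 with (M * 0) by ring; apply (is_lim_seq_scal_l _ M 0), power_tail_lim, Hp.
- intros n; replace (shifted_power a p (INR n) - 0)%C with (shifted_power a p (INR n)) by ring.
  apply HB, pos_INR.
Qed.

Lemma Cconv_RtoC u l : is_lim_seq u (Finite l) -> Cconv (fun n => RtoC (u n)) (RtoC l).
Proof.
intros H eps He; apply is_lim_seq_spec in H; destruct (H (mkposreal _ He)) as [N HN].
exists N; intros n Hn; rewrite <- RtoC_minus, Cmod_R; now apply HN.
Qed.

Lemma Csum_RtoC u n : Csum (fun k => RtoC (u k)) n = RtoC (Rsum u n).
Proof.
induction n as [|n IH]; [now rewrite Csum_O|rewrite Csum_S, IH; unfold Rsum; simpl sum_f_R0; now rewrite RtoC_plus].
Qed.

Lemma Cconv_mult u v l m : Cconv u l -> Cconv v m -> Cconv (fun n => u n * v n)%C (l * m)%C.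
Proof.
intros Hu Hv.
assert (Hb : exists B, 0 < B /\ exists N0, forall n, (N0 <= n)%nat -> Cmod (v n) <= B).
{ destruct (Hv 1 Rlt_0_1) as [N0 HN0]; exists (Cmod m + 1); split; [pose proof (Cmod_ge_0 m); lra|].
  exists N0; intros n Hn; specialize (HN0 n Hn).
  replace (v n) with ((v n - m) + m)%C by ring; eapply Rle_trans; [apply Cmod_triangle|lra]. }
destruct Hb as [B [HB [N0 HN0]]]; intros eps He; pose proof (Cmod_ge_0 l) as Hl.
destruct (Hu (eps / (2 * B)) ltac:(apply Rdiv_lt_0_compat; lra)) as [N1 HN1].
destruct (Hv (eps / (2 * (Cmod l + 1))) ltac:(apply Rdiv_lt_0_compat; lra)) as [N2 HN2].
exists (N0 + N1 + N2)%nat; intros n Hn.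
specialize (HN0 n ltac:(lia)); specialize (HN1 n ltac:(lia)); specialize (HN2 n ltac:(lia)).
replace (u n * v n - l * m)%C with ((u n - l) * v n + l * (v n - m))%C by ring.
eapply Rle_lt_trans; [apply Cmod_triangle|]; rewrite !Cmod_mult.
assert (A1 : Cmod (u n - l) * Cmod (v n) <= eps / 2).
{ apply Rle_trans with (eps / (2 * B) * B); [apply Rmult_le_compat; try apply Cmod_ge_0; lra|right; field; lra]. }
assert (A2 : Cmod l * Cmod (v n - m) < eps / 2).
{ apply Rle_lt_trans with (Cmod l * (eps / (2 * (Cmod l + 1)))); [apply Rmult_le_compat_l; lra|].
  apply Rmult_lt_reg_r with (Cmod l + 1); [lra|].
  replace (Cmod l * (eps / (2 * (Cmod l + 1))) * (Cmod l + 1)) with (Cmod l * (eps / 2)) by (field; lra); nra. }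
lra.
Qed.

(** Summed over the frequencies, the recurrence trades a zeta value for an integral with two
    more powers. *)
Lemma osc_total_recurrence N (a p : C) : (1 <= N)%nat -> a <> 0 -> Rabs (Carg a) < PI -> 0 < Re p ->
  (p * osc_total N a (p + 1) + p * (p + 1) * (p + 2) * osc_total (S N) a (p + 3))%C
  = (weight_sum N * shifted_power a p 0)%C.
Proof.
intros HN Ha Harg Hp; assert (Hc := off_cut_arg a Ha Harg).
eapply Cconv_unique.
- apply Cconv_plus; apply Cconv_scal; apply osc_total_spec; try easy; try lia; rewrite re_plus; simpl; lra.
- assert (Hl : Cconv (fun n => RtoC (Rsum (weight N) n) * (shifted_power a p 0 - shifted_power a p (INR n)))%C
    (weight_sum N * (shifted_power a p 0 - 0))%C).
  { apply Cconv_mult; [apply Cconv_RtoC, weight_sum_lim, HN|].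
    apply Cconv_minus; [apply Cconv_const|now apply shifted_power_lim]. }
  replace (shifted_power a p 0 - 0)%C with (shifted_power a p 0) in Hl by ring.
  eapply Cconv_ext; [|exact Hl].
  intros n; cbv beta; unfold osc_partial; rewrite <- !Csum_scal, <- Csum_plus, <- Csum_RtoC.
  rewrite (Cmult_comm (Csum _ n)), <- Csum_scal; apply Csum_ext; intros k _.
  rewrite <- (osc_integral_recurrence a p k n Hc), weight_S.
  pose proof (freq_pos k); rewrite RtoC_div by (apply pow_nonzero; lra).
  unfold Cdiv; ring.
Qed.

(** The Euler-Maclaurin expression of order N, with its remainder as a sum of oscillating
    integrals. *)
Definition em_value (N : nat) (a s : C) : C :=
  (/ 2 * Cpower a (- s) + Cpower a (1 - s) / (s - 1)
   + Cpower a (1 - s)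
     * sum_n_m (fun n : nat =>
          bernoulli (2 * n) / INR (fact (2 * n))
          * (Cpochhammer s (2 * n - 1) / a ^ (2 * n)))%C 1 (N - 1)
   + ((-1) ^ (N + 1))%R * Cpochhammer s (2 * N) * osc_total N a (s + 2 * INR N))%C.

Lemma Cpower_shift (a s : C) m : a <> 0 -> shifted_power a (s + INR m - 1) 0 = (Cpower a (1 - s) / a ^ m)%C.
Proof.
intros Ha; unfold shifted_power, Cpower; rewrite Cplus_0_l.
induction m as [|m IH].
- simpl Cpow; unfold Cdiv. replace (/ 1)%C with (RtoC 1) by (rewrite <- RtoC_inv by lra; f_equal; field).
  rewrite Cmult_1_r; f_equal; simpl INR; ring.
- rewrite Cpow_S, S_INR, RtoC_plus.
  replace (- ((s + (INR m + 1) - 1) * Clog a))%C with (- ((s + INR m - 1) * Clog a) - Clog a)%C by ring.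
  rewrite Cexp_minus, IH, Cexp_Clog by easy; assert (Hm := Cpow_nz a m Ha); field; repeat split; assumption.
Qed.

Lemma Cpochhammer_S w q : Cpochhammer w (S q) = (Cpochhammer w q * (w + INR q))%C.
Proof. reflexivity. Qed.

(** The recurrence moves one term, whose coefficient is the Bernoulli number, out of the
    remainder; so the expressions of all orders continue each other in [s]. *)
Lemma em_value_S N (a s : C) : (1 <= N)%nat -> a <> 0 -> Rabs (Carg a) < PI -> 1 - 2 * INR N < Re s ->
  em_value N a s = em_value (S N) a s.
Proof.
intros HN Ha Harg Hs.
set (p := (s + 2 * INR N - 1)%C).
assert (Hp : 0 < Re p).
{ unfold p; replace (Re (s + 2 * INR N - 1)) with (Re s + 2 * INR N - 1) by (destruct s; simpl; ring); lra. }
assert (HR := osc_total_recurrence N a p HN Ha Harg Hp).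
unfold em_value.
replace (S N - 1)%nat with (S (N - 1)) by lia.
rewrite sum_n_Sm by lia; replace (S (N - 1)) with N by lia.
match goal with |- context [sum_n_m ?f 1 (N - 1)] => set (Sg := sum_n_m f 1 (N - 1)) end.
change (@plus C_AbelianMonoid) with Cplus.
assert (EB : (RtoC (bernoulli (2 * N)) / RtoC (INR (fact (2 * N))))%C = (((-1) ^ (N + 1))%R * weight_sum N)%C).
{ rewrite <- RtoC_div by apply INR_fact_neq_0; rewrite bernoulli_zeta by easy; unfold zeta_coef; apply RtoC_mult. }
rewrite EB.
replace (2 * S N)%nat with (S (S (2 * N))) by lia.
rewrite !(Cpochhammer_S s).
set (P := Cpochhammer s (2 * N - 1)).
assert (E1 : (s + INR (2 * N - 1))%C = p).
{ unfold p; rewrite minus_INR, mult_INR by lia; simpl (INR 2); simpl (INR 1).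
  rewrite RtoC_minus, RtoC_mult; replace (1 + 1) with 2 by ring; ring. }
assert (E2 : (s + INR (2 * N))%C = (p + 1)%C).
{ unfold p; rewrite mult_INR, RtoC_mult; simpl (INR 2); replace (1 + 1) with 2 by ring; ring. }
assert (E3 : (s + INR (S (2 * N)))%C = (p + 2)%C).
{ rewrite S_INR, RtoC_plus; unfold p; rewrite mult_INR, RtoC_mult; simpl (INR 2); replace (1 + 1) with 2 by ring; ring. }
replace (s + 2 * INR N)%C with (p + 1)%C by (unfold p; ring).
replace (s + 2 * INR (S N))%C with (p + 3)%C by (rewrite S_INR, RtoC_plus; unfold p; ring).
assert (E4 : Cpochhammer s (2 * N) = (P * p)%C).
{ replace (2 * N)%nat with (S (2 * N - 1)) by lia; rewrite Cpochhammer_S, E1; easy. }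
rewrite E4, E2, E3.
assert (EP : shifted_power a p 0 = (Cpower a (1 - s) / a ^ (2 * N))%C).
{ rewrite <- Cpower_shift by easy; f_equal; unfold p; rewrite mult_INR, RtoC_mult; simpl (INR 2).
  replace (1 + 1) with 2 by ring; ring. }
rewrite EP in HR.
replace ((-1) ^ (S N + 1)) with (- (-1) ^ (N + 1)) by (simpl; ring); rewrite RtoC_opp.
set (e := RtoC ((-1) ^ (N + 1))); set (F := osc_total N a (p + 1)) in *; set (F' := osc_total (S N) a (p + 3)) in *.
set (B := Cpower a (1 - s)) in *.
replace (e * (P * p) * F)%C with (e * P * (p * F + p * (p + 1) * (p + 2) * F') - e * P * (p * (p + 1) * (p + 2) * F'))%C by ring.
rewrite HR; unfold Cdiv; ring.
Qed.

Lemma em_value_eq N M (a s : C) : (1 <= N)%nat -> (N <= M)%nat -> a <> 0 -> Rabs (Carg a) < PI ->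
  1 - 2 * INR N < Re s -> em_value N a s = em_value M a s.
Proof.
intros HN HNM Ha Harg Hs; induction HNM as [|M HM IH]; [easy|].
rewrite IH; apply le_INR in HM as HM'; apply em_value_S; [lia|exact Ha|exact Harg|lra].
Qed.

(** * The Euler-Maclaurin formula of first order *)

Lemma saw_sum_shift n j x : saw_sum n (x + INR j) = saw_sum n x.
Proof.
unfold saw_sum, Rsum; apply sum_eq; intros k _; f_equal; unfold osc; f_equal.
replace (freq k * (x + INR j)) with (freq k * x + 2 * INR (S k * j) * PI)
  by (unfold freq; rewrite mult_INR, S_INR; ring).
apply cos_period.
Qed.

Lemma saw_cell_integral (a s : C) j : off_cut a -> s <> 1 ->
  is_CInt (fun x => ((x - INR j) * (1 - (x - INR j)) / 2)%R * (s * (s + 1) * shifted_power a (s + 2) x))%C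
    (INR j) (INR (S j))
    (/ 2 * (shifted_power a s (INR j) + shifted_power a s (INR (S j)))
     + (shifted_power a (s - 1) (INR (S j)) - shifted_power a (s - 1) (INR j)) / (s - 1))%C.
Proof.
intros Ha Hs1; pose proof (pos_INR j) as Hj; assert (Hs : (s - 1)%C <> 0) by now apply Cminus_eq_contra.
(* With e = (x + a)^(-s) and t = y(1-y)/2, y = x - j, this is t e' - t' e minus a primitive
   of e. *)
set (F := fun x => (((x - INR j) * (1 - (x - INR j)) / 2)%R * (- s * shifted_power a (s + 1) x)
   + (x - INR j - 1 / 2)%R * shifted_power a s x + / (s - 1) * shifted_power a (s - 1) x)%C).
match goal with |- is_CInt _ _ _ ?v => replace v with (F (INR (S j)) - F (INR j))%C end.
2:{ unfold F; rewrite S_INR.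
  replace ((INR j + 1 - INR j) * (1 - (INR j + 1 - INR j)) / 2) with 0 by field.
  replace ((INR j - INR j) * (1 - (INR j - INR j)) / 2) with 0 by field.
  replace (INR j + 1 - INR j - 1 / 2) with (/ 2) by field.
  replace (INR j - INR j - 1 / 2) with (- / 2) by field.
  rewrite RtoC_opp, RtoC_inv by lra; unfold Cdiv; ring. }
assert (HD : forall z x, INR j <= x -> Rderiv (shifted_power a z) x (- z * shifted_power a (z + 1) x)%C).
{ intros z x Hx; apply shifted_power_deriv; [easy|lra]. }
assert (H1 : forall x, Rderiv (fun x => RtoC ((x - INR j) * (1 - (x - INR j)) / 2)) x (RtoC (1 / 2 - (x - INR j)))).
{ intros x; apply (Rderiv_RtoC (fun x => (x - INR j) * (1 - (x - INR j)) / 2)); auto_derive; [easy|field]. }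
assert (H2 : forall x, Rderiv (fun x => RtoC (x - INR j - 1 / 2)) x (RtoC 1)).
{ intros x; apply (Rderiv_RtoC (fun x => x - INR j - 1 / 2)); auto_derive; [easy|field]. }
apply is_CInt_derive; [rewrite S_INR; lra| |].
- intros x [Hx _].
  assert (D0 := HD (s - 1)%C x Hx); assert (D1 := HD s x Hx); assert (D2 := HD (s + 1)%C x Hx).
  replace (s - 1 + 1)%C with s in D0 by ring; replace (s + 1 + 1)%C with (s + 2)%C in D2 by ring.
  unfold F; eapply Rderiv_eq.
  + apply Rderiv_plus; [apply Rderiv_plus|].
    * apply Rderiv_mult; [apply H1|apply Rderiv_scal, D2].
    * apply Rderiv_mult; [apply H2|exact D1].
    * apply Rderiv_scal, D0.
  + replace (1 / 2 - (x - INR j)) with (- (x - INR j - 1 / 2)) by ring; rewrite (RtoC_opp (x - INR j - 1 / 2)).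
    field; exact Hs.
- intros x [Hx _]; eapply Rderiv_Ccont; apply Rderiv_mult; [apply H1|apply Rderiv_scal, HD, Hx].
Qed.

Lemma saw_sum_Rderiv n x : Rderiv (fun x => RtoC (saw_sum n x)) x (Rsum (fun k => 2 / freq k * sin (freq k * x)) n).
Proof.
apply (Rderiv_RtoC (saw_sum n)).
replace (Rsum (fun k => 2 / freq k * sin (freq k * x)) n) with (saw_error1 n x + (1 / 2 - x)) by (unfold saw_error1; ring).
apply (is_derive_ext (fun x => plus (saw_error n x) (x * (1 - x) / 2))).
{ intros t; unfold saw_error, plus; simpl; real_eq; ring. }
apply (is_derive_plus (V:=R_NormedModule)); [apply saw_error_deriv|auto_derive; [easy|field]].
Qed.

(** Cell by cell, Euler-Maclaurin with the kernel replaced by a partial sum of its Fourier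
    series; the errors of the cells telescope. *)
Lemma saw_sum_integral (a s : C) : a <> 0 -> Rabs (Carg a) < PI -> s <> 1 -> -1 < Re s ->
  exists K, 0 <= K /\ forall n m, exists I,
    is_CInt (fun x => saw_sum n x * (s * (s + 1) * shifted_power a (s + 2) x))%C 0 (INR m) I /\
    Cmod (I - (Csum (fun j => shifted_power a s (INR j)) m - / 2 * shifted_power a s 0
        - / 2 * shifted_power a s (INR m)
        + (shifted_power a (s - 1) (INR m) - shifted_power a (s - 1) 0) / (s - 1))) <= K * / (INR n + 1).
Proof.
intros Ha Harg Hs1 Hs; assert (Hc := off_cut_arg a Ha Harg).
destruct (shifted_power_bound a Ha Harg) as [D [HD HB]].
set (eta := Re s + 1); assert (He : 0 < eta) by (unfold eta; lra).
set (M := Cmod (s * (s + 1)) * exp ((Rabs (Re (s + 2)) + Rabs (Im (s + 2))) * D)).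
assert (HM : 0 <= M) by (apply Rmult_le_pos; [apply Cmod_ge_0|left; apply exp_pos]).
exists (2 * M / eta); split; [apply Rdiv_le_0_compat; lra|]; intros n m.
set (y := / (INR n + 1)).
assert (Hy : 0 < y) by (apply Rinv_0_lt_compat; pose proof (pos_INR n); lra).
set (B := fun x => 2 * M * y / eta * exp (- eta * ln (1 + x))).
set (f := fun x => (saw_sum n x * (s * (s + 1) * shifted_power a (s + 2) x))%C).
assert (Hf : forall x, 0 <= x -> Ccont f x).
{ intros x Hx; eapply Rderiv_Ccont; apply Rderiv_mult; [apply saw_sum_Rderiv|apply Rderiv_scal, shifted_power_deriv; easy]. }
assert (HBp : forall x, 0 <= B x).
{ intros x; unfold B; apply Rmult_le_pos; [|left; apply exp_pos].
  apply Rdiv_le_0_compat; [|easy]; apply Rmult_le_pos; lra. }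
assert (H : exists I, is_CInt f 0 (INR m) I /\
    Cmod (I - (Csum (fun j => shifted_power a s (INR j)) m - / 2 * shifted_power a s 0
        - / 2 * shifted_power a s (INR m)
        + (shifted_power a (s - 1) (INR m) - shifted_power a (s - 1) 0) / (s - 1))) <= B 0 - B (INR m)).
{ induction m as [|m [I [HI HI2]]].
  - exists 0; split.
    + exact (is_RInt_point (V:=C_R_NormedModule) f 0).
    + rewrite Csum_O; simpl INR; match goal with |- Cmod ?z <= _ => replace z with (RtoC 0) end.
      * rewrite Cmod_0; lra.
      * unfold Cdiv; field; now apply Cminus_eq_contra.
  - pose proof (pos_INR m) as Hm.
    assert (HJ : is_CInt f (INR m) (INR (S m)) (CInt f (INR m) (INR (S m)))).
    { apply CInt_correct, Ccont_integrable_le; [rewrite S_INR; lra|]; intros t Ht; apply Hf; lra. }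
    set (J := CInt f (INR m) (INR (S m))) in *.
    exists (I + J)%C; split; [now apply (is_CInt_Chasles f 0 (INR m))|].
    assert (HC := saw_cell_integral a s m Hc Hs1).
    set (V := (/ 2 * (shifted_power a s (INR m) + shifted_power a s (INR (S m)))
     + (shifted_power a (s - 1) (INR (S m)) - shifted_power a (s - 1) (INR m)) / (s - 1))%C) in *.
    assert (Hd : Cmod (J - V) <= B (INR m) - B (INR (S m))).
    { replace (B (INR m) - B (INR (S m))) with (- B (INR (S m)) - - B (INR m)) by ring.
      eapply (is_CInt_bound _ (INR m) (INR (S m)) (J - V)%C (fun x => - B x)
        (fun x => 2 * M * y * exp (- (1 + eta) * ln (1 + x)))); [rewrite S_INR; lra|exact (is_CInt_minus _ _ _ _ _ _ HJ HC)| | |].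
      - intros x Hx; unfold f.
        match goal with |- Cmod ?z <= _ => replace z with
          ((saw_sum n x - (x - INR m) * (1 - (x - INR m)) / 2)%R * (s * (s + 1) * shifted_power a (s + 2) x))%C
          by (rewrite RtoC_minus; ring) end.
        rewrite Cmod_mult, Cmod_R, Cmod_mult.
        rewrite S_INR in Hx.
        assert (HF := saw_fourier n (x - INR m) ltac:(lra)).
        rewrite Rabs_minus_sym in HF.
        rewrite <- (saw_sum_shift n m (x - INR m)) in HF.
        replace (x - INR m + INR m) with x in HF by ring.
        specialize (HB (s + 2)%C x ltac:(lra)).
        replace (- Re (s + 2)) with (- (1 + eta)) in HB by (unfold eta; destruct s; simpl; ring).
        replace (2 * M * y * exp (- (1 + eta) * ln (1 + x))) with ((2 * y) * (M * exp (- (1 + eta) * ln (1 + x)))) by ring.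
        apply Rmult_le_compat; [apply Rabs_pos|apply Rmult_le_pos; apply Cmod_ge_0|exact HF|].
        unfold M; rewrite Rmult_assoc; apply Rmult_le_compat_l; [apply Cmod_ge_0|exact HB].
      - intros t Ht; unfold B; auto_derive; [lra|].
        replace (- (1 + eta) * ln (1 + t)) with (- eta * ln (1 + t) + - ln (1 + t)) by ring.
        rewrite exp_plus, exp_Ropp, exp_ln by lra; field; lra.
      - intros t Ht; apply (ex_derive_continuous (fun x => 2 * M * y * exp (- (1 + eta) * ln (1 + x)))).
        auto_derive; lra. }
    rewrite Csum_S.
    match goal with |- Cmod ?z <= _ => match type of HI2 with Cmod ?w <= _ => replace z with (w + (J - V))%C end end.
    + eapply Rle_trans; [apply Cmod_triangle|lra].
    + unfold V; field; now apply Cminus_eq_contra. }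
destruct H as [I [HI1 HI2]]; exists I; split; [exact HI1|].
eapply Rle_trans; [exact HI2|].
pose proof (HBp (INR m)) as Hm.
replace (2 * M / eta * y) with (B 0); [lra|].
unfold B; rewrite Rplus_0_r, ln_1, Rmult_0_r, exp_0; field; lra.
Qed.

(** For Re s > 1 all terms at the upper end tend to 0. *)
Theorem em_value_series (a s : C) : a <> 0 -> Rabs (Carg a) < PI -> 1 < Re s ->
  Cconv (Csum (fun n => Cpower (INR n + a) (- s))) (em_value 1 a s).
Proof.
intros Ha Harg Hs; assert (Hc := off_cut_arg a Ha Harg).
assert (Hs1 : s <> 1) by (intros ->; simpl in Hs; lra).
assert (Hsm : (s - 1)%C <> 0) by now apply Cminus_eq_contra.
destruct (saw_sum_integral a s Ha Harg Hs1 ltac:(lra)) as [K [HK HI]].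
assert (HG := osc_total_spec 1 a (s + 2) (le_n 1) Ha Harg ltac:(rewrite re_plus; simpl; lra)).
set (e := shifted_power a s) in *; set (h := shifted_power a (s - 1)) in *.
apply (Cconv_ext (Csum (fun j => e (INR j)))).
{ intros n; apply Csum_ext; intros k _; unfold e, shifted_power, Cpower; f_equal; ring. }
set (err := fun n => (s * (s + 1) * osc_partial 1 a (s + 2) n -
   (Csum (fun j => e (INR j)) n - / 2 * e 0 - / 2 * e (INR n) + (h (INR n) - h 0) / (s - 1)))%C).
assert (Herr : Cconv err 0).
{ apply (Cconv_dominated _ _ (fun n => K * / (INR n + 1))); [apply inv_INR_lim|].
  intros n; destruct (HI n n) as [I [HI1 HI2]].
  replace (err n - 0)%C with (err n) by ring; unfold err.
  replace (s * (s + 1) * osc_partial 1 a (s + 2) n)%C with I; [exact HI2|].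
  rewrite <- (is_CInt_unique _ _ _ _ HI1); apply is_CInt_unique.
  pose proof (pos_INR n) as Hn.
  assert (HW := is_CInt_weighted_sum (weight 1) (osc_integrand a (s + 2)) (fun k => osc_integral a (s + 2) k n) 0 (INR n) n
     (fun k => is_CInt_osc a (s + 2) k 0 (INR n) Hc ltac:(lra))).
  eapply is_CInt_ext; [|apply (is_CInt_scal (s * (s + 1)) _ _ _ _ HW)].
  intros x _; cbv beta; unfold osc_integrand, saw_sum.
  rewrite <- Csum_RtoC.
  rewrite (Csum_ext (fun k => weight 1 k * (osc k x * shifted_power a (s + 2) x))%C
     (fun k => shifted_power a (s + 2) x * RtoC (weight 1 k * osc k x))%C)
    by (intros; rewrite RtoC_mult; ring).
  rewrite Csum_scal; ring. }
assert (He : Cconv (fun n => e (INR n)) 0) by (apply shifted_power_lim; try easy; lra).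
assert (Hh : Cconv (fun n => h (INR n)) 0).
{ apply shifted_power_lim; try easy; unfold Cminus; rewrite re_plus, re_opp; simpl; lra. }
replace (em_value 1 a s) with
  (s * (s + 1) * osc_total 1 a (s + 2) + / 2 * e 0 + / 2 * 0 + (- / (s - 1)) * (0 - h 0) - 0)%C.
- eapply Cconv_ext; [|apply Cconv_minus; [apply Cconv_plus; [apply Cconv_plus; [apply Cconv_plus;
    [apply Cconv_scal, HG|apply (Cconv_const (/ 2 * e 0)%C)]|apply Cconv_scal, He]|
    apply Cconv_scal, Cconv_minus; [exact Hh|apply Cconv_const]]|exact Herr]].
  intros n; cbv beta; unfold err, Cdiv; ring.
- unfold em_value; simpl (1 - 1)%nat; rewrite sum_n_m_zero by lia.
  change (@zero C_AbelianMonoid) with (RtoC 0).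
  simpl (2 * 1)%nat; simpl (1 + 1)%nat; replace ((-1) ^ 2) with 1 by ring; simpl Cpochhammer; simpl (INR 1); simpl (INR 0).
  replace (s + 2 * 1)%C with (s + 2)%C by ring.
  unfold e, h, shifted_power, Cpower; rewrite Cplus_0_l.
  replace (- (s * Clog a))%C with (- s * Clog a)%C by ring.
  replace (- ((s - 1) * Clog a))%C with ((1 - s) * Clog a)%C by ring.
  unfold Cdiv; ring.
Qed.

(** * Identification of the Hurwitz zeta function *)

Lemma Cdiff_pochhammer m z : Cdiff (fun s => Cpochhammer s m) z.
Proof.
induction m as [|m IH]; [exact (Cdiff_const 1 z)|].
apply (Cdiff_mult (fun s => Cpochhammer s m) (fun s => s + INR m)%C); [exact IH|].
apply (Cdiff_plus (fun s => s)); [apply Cdiff_id|apply Cdiff_const].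
Qed.

Lemma Cdiff_sum (f : nat -> C -> C) m z : (forall n, Cdiff (f n) z) ->
  Cdiff (fun s => sum_n_m (fun n => f n s) 1 m) z.
Proof.
intros Hf; induction m as [|m IH].
- destruct (Cdiff_const 0 z) as [l Hl]; exists l; revert Hl; apply Cderiv_ext.
  intros s; now rewrite sum_n_m_zero by lia.
- destruct (Cdiff_plus _ _ z IH (Hf (S m))) as [l Hl]; exists l; revert Hl; apply Cderiv_ext.
  intros s; rewrite sum_n_Sm by lia; reflexivity.
Qed.

Lemma em_value_diff N (a s : C) : (1 <= N)%nat -> a <> 0 -> Rabs (Carg a) < PI -> s <> 1 ->
  1 - 2 * INR N < Re s -> Cdiff (em_value N a) s.
Proof.
intros HN Ha Harg Hs1 Hs.
assert (H1 : Cdiff (fun s => Cpower a (- s)) s).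
{ apply (Cdiff_comp Cexp (fun s => - s * Clog a)%C); [eexists; apply Cderiv_Cexp|].
  apply (Cdiff_mult Copp (fun _ => Clog a)); [eexists; apply (Cderiv_opp (fun w => w)), Cderiv_id|apply Cdiff_const]. }
assert (Hm : Cdiff (fun s => s - 1)%C s).
{ eexists; apply (Cderiv_minus (fun w => w) (fun _ => RtoC 1)); [apply Cderiv_id|apply Cderiv_const]. }
assert (H2 : Cdiff (fun s => Cpower a (1 - s)) s).
{ apply (Cdiff_comp Cexp (fun s => (1 - s) * Clog a)%C); [eexists; apply Cderiv_Cexp|].
  apply (Cdiff_mult (fun s => 1 - s)%C (fun _ => Clog a)); [|apply Cdiff_const].
  eexists; apply (Cderiv_minus (fun _ => RtoC 1) (fun w => w)); [apply Cderiv_const|apply Cderiv_id]. }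
unfold em_value.
apply (Cdiff_plus (fun s => / 2 * Cpower a (- s) + Cpower a (1 - s) / (s - 1)
   + Cpower a (1 - s)
     * sum_n_m (fun n : nat =>
          bernoulli (2 * n) / INR (fact (2 * n))
          * (Cpochhammer s (2 * n - 1) / a ^ (2 * n))) 1 (N - 1))%C
   (fun s => ((-1) ^ (N + 1))%R * Cpochhammer s (2 * N) * osc_total N a (s + 2 * INR N))%C).
- apply (Cdiff_plus (fun s => / 2 * Cpower a (- s) + Cpower a (1 - s) / (s - 1))%C).
  + apply (Cdiff_plus (fun s => / 2 * Cpower a (- s))%C).
    * apply (Cdiff_mult (fun _ => / 2)%C); [apply Cdiff_const|exact H1].
    * apply (Cdiff_mult (fun s => Cpower a (1 - s)) (fun s => / (s - 1))%C); [exact H2|].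
      apply (Cdiff_comp Cinv (fun s => s - 1)%C); [eexists; apply Cderiv_inv; now apply Cminus_eq_contra|exact Hm].
  + apply (Cdiff_mult (fun s => Cpower a (1 - s))); [exact H2|].
    apply (Cdiff_sum (fun n s => bernoulli (2 * n) / INR (fact (2 * n)) * (Cpochhammer s (2 * n - 1) / a ^ (2 * n)))%C).
    intros n; apply (Cdiff_mult (fun _ => bernoulli (2 * n) / INR (fact (2 * n)))%C); [apply Cdiff_const|].
    apply (Cdiff_mult (fun s => Cpochhammer s (2 * n - 1)) (fun _ => / a ^ (2 * n))%C); [apply Cdiff_pochhammer|apply Cdiff_const].
- apply (Cdiff_mult (fun s => ((-1) ^ (N + 1))%R * Cpochhammer s (2 * N))%C (fun s => osc_total N a (s + 2 * INR N))).
  + apply (Cdiff_mult (fun _ => RtoC ((-1) ^ (N + 1)))); [apply Cdiff_const|apply Cdiff_pochhammer].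
  + apply (Cdiff_comp (osc_total N a) (fun s => s + 2 * INR N)%C).
    * apply osc_total_diff; try easy.
      replace (Re (s + 2 * INR N)) with (Re s + 2 * INR N) by (destruct s; simpl; ring); lra.
    * apply (Cdiff_plus (fun s => s)); [apply Cdiff_id|apply Cdiff_const].
Qed.

Lemma Cconv_is_series (u : nat -> C) l : Cconv (Csum u) l -> @is_series C_AbsRing C_NormedModule u l.
Proof.
intros H P [eps HP].
destruct (H eps (cond_pos eps)) as [N HN]; exists N; intros n Hn; apply HP.
specialize (HN n Hn); split.
- eapply Rle_lt_trans; [apply (re_le_Cmod (Csum u n - l))|exact HN].
- eapply Rle_lt_trans; [apply (im_le_Cmod (Csum u n - l))|exact HN].
Qed.

(** A number of Euler-Maclaurin terms sufficient at [s]. *)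
Definition em_order (s : C) : nat := S (Z.to_nat (up (Rabs (Re s)))).

Lemma em_order_spec s : 1 - 2 * INR (em_order s) < Re s.
Proof.
unfold em_order; rewrite S_INR, INR_IZR_INZ, Z2Nat.id.
- pose proof (archimed (Rabs (Re s))) as [H _]; pose proof (Rle_abs (- Re s)) as H2; rewrite Rabs_Ropp in H2.
  pose proof (Rabs_pos (Re s)); lra.
- apply le_IZR; pose proof (archimed (Rabs (Re s))) as [H _]; pose proof (Rabs_pos (Re s)); lra.
Qed.

Lemma em_value_consistent N M (a s : C) : (1 <= N)%nat -> (1 <= M)%nat -> a <> 0 -> Rabs (Carg a) < PI ->
  1 - 2 * INR N < Re s -> 1 - 2 * INR M < Re s -> em_value N a s = em_value M a s.
Proof.
intros HN HM Ha Harg H1 H2; destruct (Nat.le_ge_cases N M) as [H|H].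
- now apply em_value_eq.
- symmetry; now apply em_value_eq.
Qed.

Lemma em_value_is_hurwitz_zeta (a : C) : a <> 0 -> Rabs (Carg a) < PI ->
  is_hurwitz_zeta a (fun s => em_value (em_order s) a s).
Proof.
intros Ha Harg; split.
- intros s Hs; rewrite (em_value_consistent (em_order s) 1).
  + now apply Cconv_is_series, em_value_series.
  + unfold em_order; lia.
  + lia.
  + easy.
  + easy.
  + apply em_order_spec.
  + simpl; lra.
- intros s Hs1; assert (Ho := em_order_spec s).
  destruct (em_value_diff (em_order s) a s ltac:(unfold em_order; lia) Ha Harg Hs1 Ho) as [l Hl].
  exists l; change (Cderiv (fun s => em_value (em_order s) a s) s l).
  rewrite Cderiv_eps in Hl |- *; intros eps He; destruct (Hl eps He) as [d [Hd Hd2]].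
  set (g := Re s - (1 - 2 * INR (em_order s))) in *; assert (Hg : 0 < g) by (unfold g; lra).
  exists (Rmin d g); split; [now apply Rmin_pos|]; intros y Hy.
  rewrite (em_value_consistent (em_order y) (em_order s)).
  + apply Hd2; eapply Rlt_le_trans; [exact Hy|apply Rmin_l].
  + unfold em_order; lia.
  + unfold em_order; lia.
  + easy.
  + easy.
  + apply em_order_spec.
  + assert (Hy2 := Rlt_le_trans _ _ _ Hy (Rmin_r _ _)).
    pose proof (Rabs_def2 _ _ (Rle_lt_trans _ _ _ (re_le_Cmod (y - s)) Hy2)) as [_ H3].
    unfold Cminus in H3; rewrite re_plus, re_opp in H3; unfold g in H3; lra.
Qed.

(** Two continuations from Re s > 1 to the punctured plane agree, so the Euler-Maclaurin
    expressions compute the zeta function whichever continuation defines it. *)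
Theorem hurwitz_zeta_em N (a s : C) : (1 <= N)%nat -> a <> 0 -> Rabs (Carg a) < PI -> s <> 1 ->
  1 - 2 * INR N < Re s -> hurwitz_zeta s a = em_value N a s.
Proof.
intros HN Ha Harg Hs1 Hs.
assert (HF := em_value_is_hurwitz_zeta a Ha Harg).
assert (HZ : is_hurwitz_zeta a (fun s => hurwitz_zeta s a)).
{ exact (epsilon_spec (inhabits (fun _ : C => RtoC 0)) (is_hurwitz_zeta a) (ex_intro _ _ HF)). }
rewrite (em_value_consistent N (em_order s)); try easy; [|unfold em_order; lia|apply em_order_spec].
destruct HF as [F1 F2]; destruct HZ as [Z1 Z2].
apply (identity_punctured (fun s => hurwitz_zeta s a) (fun s => em_value (em_order s) a s)); try easy.
intros w Hw; exact (filterlim_locally_unique _ _ _ (Z1 w Hw) (F1 w Hw)).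
Qed.

Theorem hurwitz_remainder_osc N (a s : C) : (1 <= N)%nat -> a <> 0 -> Rabs (Carg a) < PI -> s <> 1 ->
  1 - 2 * INR N < Re s ->
  hurwitz_remainder N s a =
    (((-1) ^ (N + 1))%R * Cpochhammer s (2 * N) * osc_total N a (s + 2 * INR N) / Cpower a (1 - s))%C.
Proof.
intros HN Ha Harg Hs1 Hs; unfold hurwitz_remainder; rewrite (hurwitz_zeta_em N a s) by easy.
unfold em_value.
match goal with |- context [sum_n_m ?f 1 (N - 1)] => set (Sg := sum_n_m f 1 (N - 1)) end.
assert (H0 : Cpower a (1 - s) <> 0) by apply Cexp_neq_0.
set (P := Cpower a (1 - s)) in *; unfold Cdiv; set (u := (/ (s - 1))%C); field; exact H0.
Qed.

(** * The gamma function at positive arguments *)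

Definition gamma_fun (x t : R) : R := Rpower t (x - 1) * exp (- t).
Definition gamma_part (x u v : R) : R := RInt (gamma_fun x) u v.

Lemma gamma_fun_pos x t : 0 < gamma_fun x t.
Proof. apply Rmult_lt_0_compat; apply exp_pos. Qed.

Lemma gamma_fun_cont x t : 0 < t -> continuous (gamma_fun x) t.
Proof.
intros Ht; apply (ex_derive_continuous (gamma_fun x)); unfold gamma_fun, Rpower; auto_derive; lra.
Qed.

Lemma gamma_part_spec x u v : 0 < u <= v -> is_RInt (gamma_fun x) u v (gamma_part x u v).
Proof.
intros Huv; apply (RInt_correct (V:=R_CompleteNormedModule)), (ex_RInt_continuous (V:=R_CompleteNormedModule)).
rewrite Rmin_left, Rmax_right by lra; intros t Ht; apply gamma_fun_cont; lra.
Qed.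

Lemma is_RInt_nonneg (f : R -> R) a b l : a <= b -> is_RInt f a b l -> (forall t, a < t < b -> 0 <= f t) -> 0 <= l.
Proof.
intros Hab H Hf; assert (H0 : is_RInt (fun _ => 0) a b ((b - a) * 0)) by exact (is_RInt_const (V:=R_NormedModule) a b 0).
rewrite Rmult_0_r in H0.
exact (is_RInt_le _ _ a b _ _ Hab H0 H Hf).
Qed.

Lemma gamma_part_mono x u u' v v' : 0 < u' <= u -> u <= v -> v <= v' -> gamma_part x u v <= gamma_part x u' v'.
Proof.
intros Hu Huv Hv.
assert (H1 := gamma_part_spec x u' u ltac:(lra)); assert (H2 := gamma_part_spec x u v ltac:(lra)).
assert (H3 := gamma_part_spec x v v' ltac:(lra)).
assert (H : gamma_part x u' v' = gamma_part x u' u + gamma_part x u v + gamma_part x v v').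
{ apply (is_RInt_unique (V:=R_CompleteNormedModule)).
  exact (is_RInt_Chasles (V:=R_NormedModule) _ _ _ _ _ _ (is_RInt_Chasles (V:=R_NormedModule) _ _ _ _ _ _ H1 H2) H3). }
pose proof (is_RInt_nonneg _ _ _ _ (proj2 Hu) H1 (fun t _ => Rlt_le _ _ (gamma_fun_pos x t))).
pose proof (is_RInt_nonneg _ _ _ _ Hv H3 (fun t _ => Rlt_le _ _ (gamma_fun_pos x t))); lra.
Qed.

Lemma gamma_fun_decay x : 0 <= x -> exists K, 0 < K /\ forall t, 0 < t -> Rpower t x * exp (- t) <= K * exp (- t / 2).
Proof.
intros Hx; destruct (log_absorb x (1 / 2) Hx ltac:(lra)) as [K HK].
exists (exp K); split; [apply exp_pos|]; intros t Ht; unfold Rpower; rewrite <- !exp_plus; apply exp_mono.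
specialize (HK t Ht); lra.
Qed.

(** Integration by parts. *)
Lemma gamma_part_succ x u v : 0 < u <= v ->
  x * gamma_part x u v = gamma_part (x + 1) u v + (Rpower v x * exp (- v) - Rpower u x * exp (- u)).
Proof.
intros Huv.
assert (H : is_RInt (fun t => x * gamma_fun x t - gamma_fun (x + 1) t) u v (Rpower v x * exp (- v) - Rpower u x * exp (- u))).
{ apply (is_RInt_derive (V:=R_CompleteNormedModule) (fun t => Rpower t x * exp (- t)));
    rewrite Rmin_left, Rmax_right by lra; intros t Ht.
  - unfold gamma_fun, Rpower; replace (x + 1 - 1) with x by ring; auto_derive; [lra|].
    replace ((x - 1) * ln t) with (x * ln t + - ln t) by ring; rewrite exp_plus, (exp_Ropp (ln t)), exp_ln by lra.
    field; lra.
  - apply (ex_derive_continuous (fun t => x * gamma_fun x t - gamma_fun (x + 1) t)).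
    unfold gamma_fun, Rpower; auto_derive; lra. }
assert (H2 : is_RInt (fun t => x * gamma_fun x t - gamma_fun (x + 1) t) u v (x * gamma_part x u v - gamma_part (x + 1) u v)).
{ exact (is_RInt_minus (V:=R_NormedModule) _ _ _ _ _ _ (is_RInt_scal (V:=R_NormedModule) _ _ _ x _ (gamma_part_spec x u v Huv))
    (gamma_part_spec (x + 1) u v Huv)). }
pose proof (is_RInt_unique (V:=R_CompleteNormedModule) _ _ _ _ H) as E1.
pose proof (is_RInt_unique (V:=R_CompleteNormedModule) _ _ _ _ H2) as E2.
rewrite E1 in E2; lra.
Qed.

Lemma power_decay_at_0 x : 0 < x -> forall eps, 0 < eps -> exists d, 0 < d /\ forall t, 0 < t < d -> Rpower t x < eps.
Proof.
intros Hx eps He; exists (exp (ln eps / x)); split; [apply exp_pos|]; intros t Ht.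
assert (H : ln t < ln eps / x) by (rewrite <- (ln_exp (ln eps / x)); apply ln_increasing; lra).
unfold Rpower; rewrite <- (exp_ln eps) by easy; apply exp_increasing.
apply (Rmult_lt_compat_l x) in H; [|easy]; replace (x * (ln eps / x)) with (ln eps) in H by (field; lra); lra.
Qed.

(** Raising the exponent by integration by parts removes the singularity at 0. *)
Lemma gamma_part_bounded x : 0 < x -> exists M, forall u v, 0 < u <= v -> gamma_part x u v <= M.
Proof.
intros Hx; destruct (gamma_fun_decay x ltac:(lra)) as [K [HK HD]].
exists (3 * K / x); intros u v Huv.
apply Rmult_le_reg_l with x; [easy|]; rewrite gamma_part_succ by easy.
assert (H : gamma_part (x + 1) u v <= - (2 * K * exp (- v / 2)) - - (2 * K * exp (- u / 2))).
{ apply (is_RInt_le (gamma_fun (x + 1)) (fun t => K * exp (- t / 2)) u v); [lra|now apply gamma_part_spec| |].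
  - apply (is_RInt_derive (V:=R_CompleteNormedModule) (fun t => - (2 * K * exp (- t / 2)))).
    + intros t _; apply Rderiv_half_exp.
    + intros t _; apply (ex_derive_continuous (fun t => K * exp (- t / 2))); auto_derive; easy.
  - intros t Ht; unfold gamma_fun; replace (x + 1 - 1) with x by ring; apply HD; lra. }
pose proof (HD v ltac:(lra)); pose proof (exp_pos (- v / 2)) as Hev.
assert (0 < Rpower u x * exp (- u)) by (apply Rmult_lt_0_compat; apply exp_pos).
assert (Hv1 : exp (- v / 2) <= 1) by (rewrite <- exp_0; apply exp_mono; lra).
assert (Hu1 : exp (- u / 2) <= 1) by (rewrite <- exp_0; apply exp_mono; lra).
replace (x * (3 * K / x)) with (3 * K) by (field; lra); nra.
Qed.

(** The improper integral of a positive function is the supremum of its proper parts. *)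
Lemma Gamma_spec x : 0 < x -> (forall u v, 0 < u <= v -> gamma_part x u v <= Gamma x) /\
  (forall eps, 0 < eps -> exists u v, 0 < u < v /\ Gamma x - eps < gamma_part x u v).
Proof.
intros Hx; destruct (gamma_part_bounded x Hx) as [M HM].
destruct (completeness (fun y => exists u v, 0 < u <= v /\ y = gamma_part x u v)) as [L [HL1 HL2]].
{ exists M; intros y [u [v [H ->]]]; now apply HM. }
{ exists (gamma_part x 1 1), 1, 1; split; [lra|easy]. }
assert (Happ : forall eps, 0 < eps -> exists u v, 0 < u < v /\ L - eps < gamma_part x u v).
{ intros eps He; apply NNPP; intros Hn.
  assert (HU : L <= L - eps); [|lra].
  apply HL2; intros y [u [v [Huv ->]]]; apply Rnot_lt_le; intros Hlt; apply Hn.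
  exists u, (v + 1); split; [lra|].
  eapply Rlt_le_trans; [exact Hlt|apply gamma_part_mono; lra]. }
assert (HG : is_RInt_gen (gamma_fun x) (at_right 0) (Rbar_locally p_infty) L).
{ intros P [eps HP].
  destruct (Happ eps (cond_pos eps)) as [u0 [v0 [Huv0 H0]]].
  exists (fun u => 0 < u < u0) (fun v => v0 < v).
  - exists (mkposreal u0 (proj1 Huv0)); intros u Hu Hu0; split; [easy|].
    change (Rabs (u - 0) < u0) in Hu; rewrite Rminus_0_r in Hu; apply Rabs_def2 in Hu; lra.
  - now exists v0.
  - intros u v Hu Hv; simpl; exists (gamma_part x u v); split; [apply gamma_part_spec; lra|].
    apply HP; change (Rabs (gamma_part x u v - L) < eps).
    assert (A : gamma_part x u v <= L) by (apply HL1; exists u, v; split; [lra|easy]).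
    assert (B : gamma_part x u0 v0 <= gamma_part x u v) by (apply gamma_part_mono; lra).
    apply Rabs_def1; pose proof (cond_pos eps); lra. }
assert (E : Gamma x = L) by exact (is_RInt_gen_unique (V:=R_CompleteNormedModule) _ _ HG).
rewrite E; split; [|exact Happ].
intros u v Huv; apply HL1; exists u, v; easy.
Qed.

Lemma Gamma_pos x : 0 < x -> 0 < Gamma x.
Proof.
intros Hx; destruct (Gamma_spec x Hx) as [H1 _].
eapply Rlt_le_trans; [|apply (H1 1 2); lra].
apply RInt_gt_0; [lra|intros; apply gamma_fun_pos|].
intros t Ht; apply gamma_fun_cont; lra.
Qed.

Lemma Gamma_succ x : 0 < x -> Gamma (x + 1) = x * Gamma x.
Proof.
intros Hx; destruct (Gamma_spec x Hx) as [A1 A2]; destruct (Gamma_spec (x + 1) ltac:(lra)) as [B1 B2].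
apply Rle_antisym; apply le_epsilon; intros eps He.
- destruct (power_decay_at_0 x Hx (eps / 2) ltac:(lra)) as [d [Hd Hd2]].
  destruct (B2 (eps / 2) ltac:(lra)) as [u [v [Huv HB]]].
  set (u' := Rmin u (d / 2)).
  assert (Hu' : 0 < u' <= u) by (unfold u'; split; [apply Rmin_pos; lra|apply Rmin_l]).
  assert (Hu'd : u' < d) by (unfold u'; eapply Rle_lt_trans; [apply Rmin_r|lra]).
  assert (HB' : gamma_part (x + 1) u v <= gamma_part (x + 1) u' v) by (apply gamma_part_mono; lra).
  pose proof (gamma_part_succ x u' v ltac:(lra)) as E.
  specialize (A1 u' v ltac:(lra)).
  assert (0 < Rpower v x * exp (- v)) by (apply Rmult_lt_0_compat; apply exp_pos).
  assert (Rpower u' x * exp (- u') <= Rpower u' x).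
  { assert (exp (- u') <= 1) by (rewrite <- exp_0; apply exp_mono; lra).
    assert (0 < Rpower u' x) by apply exp_pos; nra. }
  specialize (Hd2 u' ltac:(lra)).
  assert (x * gamma_part x u' v <= x * Gamma x) by (apply Rmult_le_compat_l; lra); lra.
- destruct (gamma_fun_decay x ltac:(lra)) as [K [HK HD]].
  destruct (A2 (eps / (2 * x)) ltac:(apply Rdiv_lt_0_compat; lra)) as [u [v [Huv HA]]].
  pose proof (half_exp_lim K) as Hl; apply is_lim_seq_spec in Hl.
  destruct (Hl (mkposreal (eps / 2) ltac:(lra))) as [N HN].
  destruct (INR_unbounded v) as [n Hn].
  set (v' := INR (N + n)).
  assert (Hv' : v <= v') by (unfold v'; rewrite plus_INR; pose proof (pos_INR N); lra).
  specialize (HN (N + n)%nat ltac:(lia)); fold v' in HN; simpl in HN; rewrite Rminus_0_r in HN; apply Rabs_def2 in HN.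
  assert (HA' : gamma_part x u v <= gamma_part x u v') by (apply gamma_part_mono; lra).
  pose proof (gamma_part_succ x u v' ltac:(lra)) as E.
  specialize (B1 u v' ltac:(lra)); specialize (HD v' ltac:(lra)).
  assert (0 < Rpower u x * exp (- u)) by (apply Rmult_lt_0_compat; apply exp_pos).
  assert (x * (Gamma x - eps / (2 * x)) <= x * gamma_part x u v') by (apply Rmult_le_compat_l; lra).
  replace (x * (Gamma x - eps / (2 * x))) with (x * Gamma x - eps / 2) in * by (field; lra); lra.
Qed.

(** Half-steps of the gamma function, by the inequality of the two means under the integral. *)
Lemma Gamma_half_step x : 0 < x -> Gamma (x + 1 / 2) <= sqrt x * Gamma x.
Proof.
intros Hx; destruct (Gamma_spec x Hx) as [A1 _]; destruct (Gamma_spec (x + 1) ltac:(lra)) as [B1 _].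
destruct (Gamma_spec (x + 1 / 2) ltac:(lra)) as [_ C2].
apply le_epsilon; intros eps He; destruct (C2 eps He) as [u [v [Huv HC]]].
assert (Hs : 0 < sqrt x) by now apply sqrt_lt_R0.
assert (Hss : sqrt x * sqrt x = x) by (apply sqrt_sqrt; lra).
assert (H : 2 * sqrt x * gamma_part (x + 1 / 2) u v <= x * gamma_part x u v + gamma_part (x + 1) u v).
{ apply (is_RInt_le (fun t => 2 * sqrt x * gamma_fun (x + 1 / 2) t) (fun t => x * gamma_fun x t + gamma_fun (x + 1) t) u v); [lra| | |].
  - exact (is_RInt_scal (V:=R_NormedModule) _ _ _ (2 * sqrt x) _ (gamma_part_spec (x + 1 / 2) u v ltac:(lra))).
  - exact (is_RInt_plus (V:=R_NormedModule) _ _ _ _ _ _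
      (is_RInt_scal (V:=R_NormedModule) _ _ _ x _ (gamma_part_spec x u v ltac:(lra))) (gamma_part_spec (x + 1) u v ltac:(lra))).
  - intros t Ht; unfold gamma_fun.
    replace (x + 1 / 2 - 1) with ((x - 1) + / 2) by field; replace (x + 1 - 1) with ((x - 1) + 1) by ring.
    rewrite !Rpower_plus, Rpower_1, Rpower_sqrt by lra.
    assert (P : 0 < Rpower t (x - 1) * exp (- t)) by (apply Rmult_lt_0_compat; apply exp_pos).
    assert (Ht2 : sqrt t * sqrt t = t) by (apply sqrt_sqrt; lra).
    pose proof (pow2_ge_0 (sqrt x - sqrt t)); set (g := Rpower t (x - 1)) in *; set (e := exp (- t)) in *.
    assert (2 * sqrt x * sqrt t <= x + t) by nra.
    replace (2 * sqrt x * (g * sqrt t * e)) with ((g * e) * (2 * sqrt x * sqrt t)) by ring.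
    replace (x * (g * e) + g * t * e) with ((g * e) * (x + t)) by ring.
    apply Rmult_le_compat_l; lra. }
specialize (A1 u v ltac:(lra)); specialize (B1 u v ltac:(lra)); rewrite Gamma_succ in B1 by easy.
assert (Hb : 2 * sqrt x * gamma_part (x + 1 / 2) u v <= 2 * sqrt x * (sqrt x * Gamma x)).
{ replace (2 * sqrt x * (sqrt x * Gamma x)) with (2 * (sqrt x * sqrt x) * Gamma x) by ring; rewrite Hss; nra. }
apply Rmult_le_reg_l in Hb; lra.
Qed.

(** * An integral bounded by the function chi *)

Definition beta_fun (q y : R) : R := exp (- ((q + 1) / 2) * ln (1 + y ^ 2)).
Definition beta_part (q Y : R) : R := RInt (beta_fun q) 0 Y.

Lemma one_plus_sqr_pos y : 0 < 1 + y ^ 2.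
Proof. pose proof (pow2_ge_0 y); lra. Qed.

Lemma beta_fun_cont q y : continuous (beta_fun q) y.
Proof.
apply (ex_derive_continuous (beta_fun q)); unfold beta_fun; pose proof (one_plus_sqr_pos y); auto_derive; simpl in *; lra.
Qed.

Lemma beta_part_spec q u v : is_RInt (beta_fun q) u v (RInt (beta_fun q) u v).
Proof.
apply (RInt_correct (V:=R_CompleteNormedModule)), (ex_RInt_continuous (V:=R_CompleteNormedModule)).
intros; apply beta_fun_cont.
Qed.

Lemma beta_part_mono q Y Z : 0 <= Y <= Z -> beta_part q Y <= beta_part q Z.
Proof.
intros H; unfold beta_part.
assert (E : RInt (beta_fun q) 0 Z = RInt (beta_fun q) 0 Y + RInt (beta_fun q) Y Z).
{ apply (is_RInt_unique (V:=R_CompleteNormedModule)).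
  exact (is_RInt_Chasles (V:=R_NormedModule) _ _ _ _ _ _ (beta_part_spec q 0 Y) (beta_part_spec q Y Z)). }
pose proof (is_RInt_nonneg _ _ _ _ (proj2 H) (beta_part_spec q Y Z) (fun t _ => Rlt_le _ _ (exp_pos _))); lra.
Qed.

Lemma beta_part_anti q q' Y : 0 <= Y -> q <= q' -> beta_part q' Y <= beta_part q Y.
Proof.
intros HY Hq; apply (is_RInt_le _ _ 0 Y _ _ HY (beta_part_spec q' 0 Y) (beta_part_spec q 0 Y)).
intros t _; apply exp_mono.
assert (0 <= ln (1 + t ^ 2)) by (rewrite <- ln_1; apply ln_le; [lra|pose proof (pow2_ge_0 t); lra]); nra.
Qed.

Lemma beta_part_bounded q : 0 < q -> exists M, forall Y, 0 <= Y -> beta_part q Y <= M.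
Proof.
intros Hq; set (K := exp ((q + 1) / 2 * ln 2)); assert (HK : 0 < K) by apply exp_pos.
exists (K / q); intros Y HY.
apply Rle_trans with (- (K / q * exp (- q * ln (1 + Y))) - - (K / q * exp (- q * ln (1 + 0)))).
- apply (is_RInt_le (beta_fun q) (fun y => K * exp (- (1 + q) * ln (1 + y))) 0 Y); [easy|apply beta_part_spec| |].
  + apply (is_RInt_derive (V:=R_CompleteNormedModule) (fun y => - (K / q * exp (- q * ln (1 + y)))));
      rewrite Rmin_left, Rmax_right by lra; intros t Ht.
    * auto_derive; [lra|].
      replace (- (1 + q) * ln (1 + t)) with (- q * ln (1 + t) + - ln (1 + t)) by ring.
      rewrite exp_plus, (exp_Ropp (ln (1 + t))), exp_ln by lra; field; lra.
    * apply (ex_derive_continuous (fun y => K * exp (- (1 + q) * ln (1 + y)))); auto_derive; lra.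
  + intros t Ht; unfold beta_fun, K; rewrite <- exp_plus; apply exp_mono.
    assert (Hl : 2 * ln (1 + t) <= ln 2 + ln (1 + t ^ 2)).
    { replace (2 * ln (1 + t)) with (ln (1 + t) + ln (1 + t)) by ring.
      rewrite <- !ln_mult by (pose proof (one_plus_sqr_pos t); lra); apply ln_le; [nra|].
      pose proof (pow2_ge_0 (1 - t)); nra. }
    nra.
- rewrite Rplus_0_r, ln_1, Rmult_0_r, exp_0.
  assert (0 < K / q * exp (- q * ln (1 + Y))) by (apply Rmult_lt_0_compat; [now apply Rdiv_lt_0_compat|apply exp_pos]); lra.
Qed.

(** The integral of (1 + y^2)^(-(q+1)/2) over the half-line. *)
Definition beta_int (q : R) : R := real (Lim_seq (fun n => beta_part q (INR n))).

Lemma beta_int_lim q : 0 < q -> is_lim_seq (fun n => beta_part q (INR n)) (beta_int q).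
Proof.
intros Hq; destruct (beta_part_bounded q Hq) as [M HM].
destruct (growing_cv (fun n => beta_part q (INR n))) as [l Hl].
- intros n; apply beta_part_mono; rewrite S_INR; pose proof (pos_INR n); lra.
- exists M; intros y [n ->]; apply HM, pos_INR.
- apply is_lim_seq_Reals in Hl; unfold beta_int; now rewrite (is_lim_seq_unique _ _ Hl).
Qed.

Lemma beta_part_le q Y : 0 < q -> 0 <= Y -> beta_part q Y <= beta_int q.
Proof.
intros Hq HY; destruct (INR_unbounded Y) as [n Hn].
assert (H : Rbar_le (beta_part q Y) (beta_int q)); [|exact H].
refine (is_lim_seq_le_loc (fun _ => beta_part q Y) _ _ _ _ (is_lim_seq_const _) (beta_int_lim q Hq)).
exists n; intros m Hm; apply beta_part_mono; apply le_INR in Hm; lra.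
Qed.

Lemma beta_int_anti q q' : 0 < q <= q' -> beta_int q' <= beta_int q.
Proof.
intros Hq; assert (H : Rbar_le (beta_int q') (beta_int q)); [|exact H].
refine (is_lim_seq_le _ _ _ _ _ (beta_int_lim q' ltac:(lra)) (beta_int_lim q ltac:(lra))).
intros n; apply beta_part_anti; [apply pos_INR|lra].
Qed.

Lemma beta_int_pos q : 0 < q -> 0 < beta_int q.
Proof.
intros Hq; eapply Rlt_le_trans; [|apply (beta_part_le q 1); lra].
apply RInt_gt_0; [lra|intros; apply exp_pos|intros; apply beta_fun_cont].
Qed.

(** Wallis's reduction. *)
Lemma beta_int_step q : 0 < q -> (q + 1) * beta_int (q + 2) = q * beta_int q.
Proof.
intros Hq.
assert (H : forall Y, (q + 1) * beta_part (q + 2) Y - q * beta_part q Y = Y * beta_fun q Y).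
{ intros Y.
  assert (H1 : is_RInt (fun y => (q + 1) * beta_fun (q + 2) y - q * beta_fun q y) 0 Y (Y * beta_fun q Y - 0 * beta_fun q 0)).
  { apply (is_RInt_derive (V:=R_CompleteNormedModule) (fun y => y * beta_fun q y)); intros t _; pose proof (one_plus_sqr_pos t) as Ht.
    - unfold beta_fun; replace (- ((q + 2 + 1) / 2) * ln (1 + t ^ 2)) with (- ((q + 1) / 2) * ln (1 + t ^ 2) + - ln (1 + t ^ 2)) by field.
      rewrite exp_plus, (exp_Ropp (ln (1 + t ^ 2))), exp_ln by easy.
      auto_derive; [simpl in Ht; lra|].
      replace (t * (t * 1)) with (t ^ 2) by ring; field; lra.
    - apply (ex_derive_continuous (fun y => (q + 1) * beta_fun (q + 2) y - q * beta_fun q y)).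
      unfold beta_fun; auto_derive; simpl in Ht; repeat split; lra. }
  assert (H2 : is_RInt (fun y => (q + 1) * beta_fun (q + 2) y - q * beta_fun q y) 0 Y
     ((q + 1) * beta_part (q + 2) Y - q * beta_part q Y)).
  { exact (is_RInt_minus (V:=R_NormedModule) _ _ _ _ _ _
      (is_RInt_scal (V:=R_NormedModule) _ _ _ (q + 1) _ (beta_part_spec (q + 2) 0 Y))
      (is_RInt_scal (V:=R_NormedModule) _ _ _ q _ (beta_part_spec q 0 Y))). }
  pose proof (is_RInt_unique (V:=R_CompleteNormedModule) _ _ _ _ H1) as E1.
  pose proof (is_RInt_unique (V:=R_CompleteNormedModule) _ _ _ _ H2) as E2.
  rewrite E1 in E2; lra. }
assert (L1 : is_lim_seq (fun n => INR n * beta_fun q (INR n)) ((q + 1) * beta_int (q + 2) - q * beta_int q)).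
{ apply (is_lim_seq_ext (fun n => (q + 1) * beta_part (q + 2) (INR n) - q * beta_part q (INR n))); [intros; apply H|].
  apply is_lim_seq_minus'; (apply (is_lim_seq_scal_l _ _ (Finite _))); apply beta_int_lim; lra. }
assert (L2 : is_lim_seq (fun n => INR n * beta_fun q (INR n)) 0).
{ apply (is_lim_seq_le_le (fun _ => 0) _ (fun n => exp (q / 2 * ln 2) * exp (- q * ln (1 + INR n)))).
  - intros n; pose proof (pos_INR n) as Hn; split; [apply Rmult_le_pos; [easy|left; apply exp_pos]|].
    pose proof (one_plus_sqr_pos (INR n)) as Hp; set (y := INR n) in *.
    assert (Hy : y <= exp (/ 2 * ln (1 + y ^ 2))).
    { fold (Rpower (1 + y ^ 2) (/ 2)); rewrite Rpower_sqrt by easy.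
      rewrite <- (sqrt_pow2 y) at 1 by easy; apply sqrt_le_1_alt; lra. }
    apply Rle_trans with (exp (/ 2 * ln (1 + y ^ 2)) * beta_fun q y); [apply Rmult_le_compat_r; [left; apply exp_pos|easy]|].
    unfold beta_fun; rewrite <- !exp_plus; apply exp_mono.
    assert (Hl : 2 * ln (1 + y) <= ln 2 + ln (1 + y ^ 2)).
    { replace (2 * ln (1 + y)) with (ln (1 + y) + ln (1 + y)) by ring.
      rewrite <- !ln_mult by lra; apply ln_le; [nra|].
      pose proof (pow2_ge_0 (1 - y)); nra. }
    nra.
  - apply is_lim_seq_const.
  - replace 0 with (exp (q / 2 * ln 2) * 0) by ring; apply (is_lim_seq_scal_l _ _ 0), power_tail_lim, Hq. }
apply is_lim_seq_unique in L1; apply is_lim_seq_unique in L2; rewrite L1 in L2; injection L2; lra.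
Qed.

Lemma beta_int_1 : beta_int 1 = PI / 2.
Proof.
assert (H : forall Y, 0 <= Y -> beta_part 1 Y = atan Y).
{ intros Y HY; apply (is_RInt_unique (V:=R_CompleteNormedModule)).
  replace (atan Y) with (atan Y - atan 0) by (rewrite atan_0; ring).
  apply (is_RInt_derive (V:=R_CompleteNormedModule) atan); intros t _; [|apply beta_fun_cont].
  unfold beta_fun; pose proof (one_plus_sqr_pos t) as Ht.
  replace (- ((1 + 1) / 2) * ln (1 + t ^ 2)) with (- ln (1 + t ^ 2)) by field; rewrite exp_Ropp, exp_ln by easy.
  auto_derive; [easy|]; unfold Rsqr; field; simpl in Ht; lra. }
assert (L : is_lim_seq (fun n => beta_part 1 (INR n)) (PI / 2)).
{ apply is_lim_seq_spec; intros eps; pose proof (cond_pos eps) as He.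
  destruct (INR_unbounded (/ eps)) as [N HN]; exists N; intros n Hn; apply le_INR in Hn.
  pose proof (Rinv_0_lt_compat _ He) as Hi.
  rewrite H by apply pos_INR.
  pose proof (atan_inv (INR n) ltac:(lra)) as E.
  assert (Hn0 : 0 < / INR n) by (apply Rinv_0_lt_compat; lra).
  assert (Hlt : / INR n < eps).
  { rewrite <- (Rinv_inv eps); apply Rinv_lt_contravar; [apply Rmult_lt_0_compat; lra|lra]. }
  assert (Hat : 0 < atan (/ INR n) <= / INR n).
  { split; [rewrite <- atan_0; now apply atan_increasing|].
    pose proof (atan_bound (/ INR n)) as Hb; pose proof (atan_increasing 0 _ Hn0) as Hp; rewrite atan_0 in Hp.
    rewrite <- (tan_atan (/ INR n)) at 2.
    destruct (MVT_gen tan 0 (atan (/ INR n)) (fun x => 1 + tan x ^ 2)) as [c [Hc1 Hc2]].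
    - rewrite Rmin_left, Rmax_right by lra; intros x Hx.
      assert (0 < cos x) by (apply cos_gt_0; lra).
      unfold tan; auto_derive; [lra|].
      pose proof (sin2_cos2 x) as Hsc; unfold Rsqr in Hsc; field; lra.
    - rewrite Rmin_left, Rmax_right by lra; intros x Hx.
      assert (0 < cos x) by (apply cos_gt_0; lra).
      apply derivable_continuous_pt, derivable_pt_tan; lra.
    - rewrite tan_0, !Rminus_0_r in Hc2; rewrite Hc2; pose proof (pow2_ge_0 (tan c)); nra. }
  apply Rabs_def1; lra. }
unfold beta_int; now rewrite (is_lim_seq_unique _ _ L).
Qed.

Lemma beta_int_2 : beta_int 2 = 1.
Proof.
assert (H : forall Y, beta_part 2 Y = Y / sqrt (1 + Y ^ 2)).
{ intros Y; apply (is_RInt_unique (V:=R_CompleteNormedModule)).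
  replace (Y / sqrt (1 + Y ^ 2)) with (Y / sqrt (1 + Y ^ 2) - 0 / sqrt (1 + 0 ^ 2)) by (unfold Rdiv; ring).
  apply (is_RInt_derive (V:=R_CompleteNormedModule) (fun y => y / sqrt (1 + y ^ 2))); intros t _; [|apply beta_fun_cont].
  unfold beta_fun; pose proof (one_plus_sqr_pos t) as Ht.
  assert (Hs : 0 < sqrt (1 + t ^ 2)) by now apply sqrt_lt_R0.
  assert (Hss : sqrt (1 + t ^ 2) * sqrt (1 + t ^ 2) = 1 + t ^ 2) by (apply sqrt_sqrt; lra).
  replace (- ((2 + 1) / 2) * ln (1 + t ^ 2)) with (- (/ 2 * ln (1 + t ^ 2) + ln (1 + t ^ 2))) by field.
  rewrite exp_Ropp, exp_plus, exp_ln by easy; fold (Rpower (1 + t ^ 2) (/ 2)); rewrite Rpower_sqrt by easy.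
  auto_derive; [simpl in Ht, Hs; split; [lra|split; [lra|easy]]|].
  replace (t * (t * 1)) with (t ^ 2) by ring; set (r := sqrt (1 + t ^ 2)) in *.
  rewrite <- Hss; field_simplify; [|lra|lra].
  replace (r ^ 2) with (1 + t ^ 2) by (rewrite <- Hss; ring); field_simplify; [|lra|lra]; easy. }
assert (L : is_lim_seq (fun n => beta_part 2 (INR n)) 1).
{ apply (is_lim_seq_le_le (fun n => 1 - 1 * / (INR n + 1)) _ (fun _ => 1)).
  - intros n; rewrite H; pose proof (pos_INR n) as Hn; set (y := INR n) in *.
    pose proof (one_plus_sqr_pos y) as Hy.
    assert (Hs : 0 < sqrt (1 + y ^ 2)) by now apply sqrt_lt_R0.
    assert (H1 : y <= sqrt (1 + y ^ 2)) by (rewrite <- (sqrt_pow2 y) at 1 by easy; apply sqrt_le_1_alt; lra).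
    assert (H2 : sqrt (1 + y ^ 2) <= 1 + y) by (rewrite <- (sqrt_pow2 (1 + y)) by lra; apply sqrt_le_1_alt; nra).
    split.
    + replace (1 - 1 * / (y + 1)) with (y * / (1 + y)) by (field; lra).
      apply Rmult_le_compat_l; [easy|now apply Rinv_le_contravar].
    + apply Rmult_le_reg_r with (sqrt (1 + y ^ 2)); [easy|]; unfold Rdiv; rewrite Rmult_assoc, Rinv_l; lra.
  - replace (Finite 1) with (Finite (1 - 0)) by (f_equal; ring); apply is_lim_seq_minus'; [apply is_lim_seq_const|apply inv_INR_lim].
  - apply is_lim_seq_const. }
unfold beta_int; now rewrite (is_lim_seq_unique _ _ L).
Qed.

Definition beta_product (q : R) : R := q * beta_int q * beta_int (q + 1).

Lemma beta_product_periodic q m : 0 < q -> beta_product (q + INR m) = beta_product q.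
Proof.
intros Hq; induction m as [|m IH]; [f_equal; simpl; ring|].
rewrite <- IH, S_INR; pose proof (pos_INR m); unfold beta_product.
pose proof (beta_int_step (q + INR m) ltac:(lra)) as E.
replace (q + (INR m + 1) + 1) with (q + INR m + 2) by ring; replace (q + (INR m + 1)) with (q + INR m + 1) by ring.
replace ((q + INR m + 1) * beta_int (q + INR m + 1) * beta_int (q + INR m + 2)) with
  (beta_int (q + INR m + 1) * ((q + INR m + 1) * beta_int (q + INR m + 2))) by ring.
rewrite E; ring.
Qed.

(** The product q J(q) J(q+1) is periodic; comparison with integers at infinity bounds it. *)
Lemma beta_product_le q : 0 < q -> beta_product q <= PI / 2.
Proof.
intros Hq; apply le_epsilon; intros eps He; pose proof PI_RGT_0 as Hpi.
destruct (INR_unbounded (PI / 2 / eps + 1)) as [m Hm].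
assert (Hpe : 0 < PI / 2 / eps) by (apply Rdiv_lt_0_compat; lra).
rewrite <- (beta_product_periodic q m Hq).
set (x := q + INR m); assert (Hx : 0 <= x) by (unfold x; lra).
destruct (nfloor_ex x Hx) as [n [Hn1 Hn2]].
assert (Hn : PI / 2 / eps < INR n) by (unfold x in *; lra).
destruct n as [|n]; [simpl in Hn; lra|].
assert (E : beta_product (INR (S n)) = PI / 2).
{ rewrite S_INR, Rplus_comm, beta_product_periodic by lra; unfold beta_product.
  replace (1 + 1) with 2 by ring; rewrite beta_int_1, beta_int_2; ring. }
unfold beta_product in E |- *; set (y := INR (S n)) in *.
assert (H1 : beta_int x <= beta_int y) by (apply beta_int_anti; lra).
assert (H2 : beta_int (x + 1) <= beta_int (y + 1)) by (apply beta_int_anti; lra).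
pose proof (beta_int_pos x ltac:(lra)); pose proof (beta_int_pos (x + 1) ltac:(lra)).
pose proof (beta_int_pos y ltac:(lra)); pose proof (beta_int_pos (y + 1) ltac:(lra)).
apply Rle_trans with ((y + 1) * (beta_int y * beta_int (y + 1))).
- rewrite Rmult_assoc; apply Rmult_le_compat; [easy|apply Rmult_le_pos; lra|lra|apply Rmult_le_compat; lra].
- replace ((y + 1) * (beta_int y * beta_int (y + 1))) with (PI / 2 + (PI / 2) / y) by (rewrite <- E; field; lra).
  apply Rplus_le_compat_l; apply Rmult_le_reg_r with y; [lra|].
  unfold Rdiv at 1; rewrite Rmult_assoc, Rinv_l, Rmult_1_r by lra.
  apply (Rmult_lt_compat_l eps) in Hn; [|easy].
  replace (eps * (PI / 2 / eps)) with (PI / 2) in Hn by (field; lra); lra.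
Qed.

Definition chi_quotient (q : R) : R := chi q / q.

Lemma chi_quotient_step q : 0 < q -> (q + 1) * chi_quotient (q + 2) = q * chi_quotient q.
Proof.
intros Hq; unfold chi_quotient, chi.
replace ((q + 2) / 2 + 1) with ((q / 2 + 1) + 1) by field; replace ((q + 2) / 2 + / 2) with ((q / 2 + / 2) + 1) by field.
rewrite !Gamma_succ by lra.
pose proof (Gamma_pos (q / 2 + / 2) ltac:(lra)); field; lra.
Qed.

(** The half-step inequality at q/2 + 1, with Gamma(x + 1) = x Gamma(x), is sharp to leading
    order as q -> oo. *)
Lemma chi_quotient_lower q : 0 < q -> PI * (q + 1) ^ 2 / (2 * q ^ 2 * (q + 2)) <= chi_quotient q ^ 2.
Proof.
intros Hq; unfold chi_quotient, chi.
set (x := q / 2 + / 2); assert (Hx : 0 < x) by (unfold x; lra).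
assert (HG := Gamma_pos x Hx).
assert (H := Gamma_half_step (x + 1 / 2) ltac:(lra)).
replace (x + 1 / 2 + 1 / 2) with (x + 1) in H by field; rewrite Gamma_succ in H by easy.
replace (q / 2 + 1) with (x + 1 / 2) by (unfold x; field).
set (g := Gamma (x + 1 / 2)) in *; set (g0 := Gamma x) in *.
assert (Hg : 0 < g) by (apply Gamma_pos; lra).
assert (Hsq : (x * g0) ^ 2 <= (x + 1 / 2) * g ^ 2).
{ replace ((x + 1 / 2) * g ^ 2) with ((sqrt (x + 1 / 2) * g) ^ 2).
  - apply pow_incr; split; [apply Rmult_le_pos; lra|easy].
  - rewrite Rpow_mult_distr; f_equal; apply pow2_sqrt; lra. }
replace ((sqrt PI * g / g0 / q) ^ 2) with (PI * (g ^ 2 / (g0 ^ 2 * q ^ 2))).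
2:{ replace ((sqrt PI * g / g0 / q) ^ 2) with ((sqrt PI ^ 2) * (g ^ 2 / (g0 ^ 2 * q ^ 2))) by (field; lra).
  rewrite pow2_sqrt; [easy|pose proof PI_RGT_0; lra]. }
replace (PI * (q + 1) ^ 2 / (2 * q ^ 2 * (q + 2))) with (PI * (x ^ 2 / ((x + 1 / 2) * q ^ 2))).
2:{ unfold x; field; lra. }
apply Rmult_le_compat_l; [pose proof PI_RGT_0; lra|].
apply Rmult_le_reg_r with ((x + 1 / 2) * (g0 ^ 2 * q ^ 2)).
{ repeat apply Rmult_lt_0_compat; try (apply pow_lt); lra. }
replace (x ^ 2 / ((x + 1 / 2) * q ^ 2) * ((x + 1 / 2) * (g0 ^ 2 * q ^ 2))) with ((x * g0) ^ 2) by (field; lra).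
replace (g ^ 2 / (g0 ^ 2 * q ^ 2) * ((x + 1 / 2) * (g0 ^ 2 * q ^ 2))) with ((x + 1 / 2) * g ^ 2) by (field; lra).
exact Hsq.
Qed.

Lemma chi_quotient_pos q : 0 < q -> 0 < chi_quotient q.
Proof.
intros Hq; unfold chi_quotient, chi; pose proof (Gamma_pos (q / 2 + 1) ltac:(lra)); pose proof (Gamma_pos (q / 2 + / 2) ltac:(lra)).
pose proof (sqrt_lt_R0 PI PI_RGT_0); repeat apply Rdiv_lt_0_compat; nra.
Qed.

(** Both sides satisfy the same reduction from q + 2 to q, and their quotient is at most 1 in
    the limit q -> oo. *)
Theorem beta_int_le_chi q : 0 < q -> beta_int q <= chi q / q.
Proof.
intros Hq; fold (chi_quotient q).
set (rho := beta_int q / chi_quotient q).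
assert (HV := chi_quotient_pos q Hq); assert (HJ := beta_int_pos q Hq).
assert (Hper : forall m, beta_int (q + 2 * INR m) = rho * chi_quotient (q + 2 * INR m)).
{ induction m as [|m IH].
  - simpl INR; rewrite Rmult_0_r, Rplus_0_r; unfold rho; field; lra.
  - rewrite S_INR; pose proof (pos_INR m).
    replace (q + 2 * (INR m + 1)) with (q + 2 * INR m + 2) by ring.
    pose proof (beta_int_step (q + 2 * INR m) ltac:(lra)) as E1.
    pose proof (chi_quotient_step (q + 2 * INR m) ltac:(lra)) as E2.
    apply Rmult_eq_reg_l with (q + 2 * INR m + 1); [|lra].
    rewrite E1, IH; replace ((q + 2 * INR m + 1) * (rho * chi_quotient (q + 2 * INR m + 2))) with
      (rho * ((q + 2 * INR m + 1) * chi_quotient (q + 2 * INR m + 2))) by ring.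
    rewrite E2; ring. }
assert (Hrho : 0 < rho) by now apply Rdiv_lt_0_compat.
assert (Hb : forall m, (1 <= m)%nat -> rho ^ 2 <= 1 + 3 / INR m).
{ intros m Hm; specialize (Hper m); set (x := q + 2 * INR m) in *.
  assert (Hm1 : 1 <= INR m) by (apply le_INR in Hm; simpl in Hm; lra).
  assert (Hx : INR m + 1 <= x) by (unfold x; lra).
  assert (HP := beta_product_le (x - 1) ltac:(lra)); unfold beta_product in HP.
  replace (x - 1 + 1) with x in HP by ring.
  assert (Hanti : beta_int x <= beta_int (x - 1)) by (apply beta_int_anti; lra).
  assert (HJx := beta_int_pos x ltac:(lra)).
  assert (H1 : (x - 1) * beta_int x ^ 2 <= PI / 2).
  { eapply Rle_trans; [|exact HP]; rewrite Rmult_assoc; apply Rmult_le_compat_l; [lra|]; simpl; nra. }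
  rewrite Hper, Rpow_mult_distr in H1.
  assert (H2 := chi_quotient_lower x ltac:(lra)).
  pose proof PI_RGT_0 as Hpi; pose proof (pow_lt rho 2 Hrho) as Hr2.
  assert (H3 : (x - 1) * (rho ^ 2 * (PI * (x + 1) ^ 2 / (2 * x ^ 2 * (x + 2)))) <= PI / 2).
  { eapply Rle_trans; [|exact H1]; apply Rmult_le_compat_l; [lra|]; apply Rmult_le_compat_l; lra. }
  assert (Hx2 : 0 < x ^ 2) by (apply pow_lt; lra).
  assert (Hd : 0 < 2 / PI * (x ^ 2 * (x + 2))).
  { apply Rmult_lt_0_compat; [apply Rdiv_lt_0_compat; lra|apply Rmult_lt_0_compat; lra]. }
  apply (Rmult_le_compat_r _ _ _ (Rlt_le _ _ Hd)) in H3.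
  replace ((x - 1) * (rho ^ 2 * (PI * (x + 1) ^ 2 / (2 * x ^ 2 * (x + 2)))) * (2 / PI * (x ^ 2 * (x + 2))))
    with (rho ^ 2 * ((x - 1) * (x + 1) ^ 2)) in H3 by (field; lra).
  replace (PI / 2 * (2 / PI * (x ^ 2 * (x + 2)))) with (x ^ 2 * (x + 2)) in H3 by (field; lra).
  apply Rmult_le_reg_r with ((x - 1) * (x + 1) ^ 2).
  { apply Rmult_lt_0_compat; [lra|apply pow_lt; lra]. }
  eapply Rle_trans; [exact H3|].
  apply Rle_trans with ((x + 2) * (x + 1) ^ 2).
  { rewrite Rmult_comm; apply Rmult_le_compat_l; [lra|apply pow_incr; lra]. }
  rewrite <- Rmult_assoc; apply Rmult_le_compat_r; [apply pow_le; lra|].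
  rewrite Rmult_plus_distr_r, Rmult_1_l.
  assert (3 <= 3 / INR m * (x - 1)).
  { replace 3 with (3 / INR m * INR m) at 1 by (field; lra).
    apply Rmult_le_compat_l; [apply Rdiv_le_0_compat; lra|lra]. }
  lra. }
assert (Hrho2 : rho ^ 2 <= 1).
{ apply le_epsilon; intros eps He; destruct (INR_unbounded (3 / eps)) as [m Hm].
  assert (H3 : 0 < 3 / eps) by (apply Rdiv_lt_0_compat; lra).
  destruct m as [|m]; [simpl in Hm; lra|].
  eapply Rle_trans; [apply (Hb (S m)); lia|]; apply Rplus_le_compat_l.
  apply Rmult_le_reg_r with (INR (S m)); [lra|]; unfold Rdiv; rewrite Rmult_assoc, Rinv_l, Rmult_1_r by lra.
  apply (Rmult_lt_compat_l eps) in Hm; [|easy]; replace (eps * (3 / eps)) with 3 in Hm by (field; lra); lra. }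
assert (Hr1 : rho <= 1) by nra.
replace (beta_int q) with (rho * chi_quotient q) by (unfold rho; field; lra); nra.
Qed.

(** * Bounds for the remainder *)

Lemma is_derive_eq_R (f : R -> R) (x l l' : R) : is_derive f x l -> l = l' -> is_derive f x l'.
Proof. now intros H <-. Qed.

(** The integral equal to the terminant in the limit. *)
Definition terminant_partial (a p : C) (k n : nat) : C :=
  (p * Cexp (p * Clog a) * osc_integral a (p + 1) k n)%C.

Lemma Re_Clog a : Re (Clog a) = ln (Cmod a). Proof. reflexivity. Qed.
Lemma Im_Clog a : Im (Clog a) = Carg a. Proof. reflexivity. Qed.

(** The argument of x + a moves from arg a towards 0, so the factor that it contributes is
    largest at one of the two ends. *)
Lemma shifted_power_ratio (a p z : C) x : off_cut a -> 0 <= x -> Im z = Im p ->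
  Cmod (Cexp (p * Clog a) * shifted_power a z x) <=
  Rmax 1 (exp (- Im p * Carg a)) * exp (Re p * ln (Cmod a) - Re z * ln (Cmod (x + a))).
Proof.
intros Ha Hx Hz; rewrite Cmod_mult, Cmod_shifted_power, Cmod_Cexp, re_mult, !Re_Clog, !Im_Clog, Hz, <- exp_plus.
replace (Re p * ln (Cmod a) - Im p * Carg a + (- Re z * ln (Cmod (x + a)) + Im p * Carg (x + a))) with
  (Im p * (Carg (x + a) - Carg a) + (Re p * ln (Cmod a) - Re z * ln (Cmod (x + a)))) by ring.
rewrite exp_plus; apply Rmult_le_compat_r; [left; apply exp_pos|].
destruct (Carg_shift a x Ha Hx) as [H|H]; destruct (Rle_dec 0 (Im p)) as [Hp|Hp].
- eapply Rle_trans; [|apply Rmax_l]; rewrite <- exp_0; apply exp_mono; nra.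
- eapply Rle_trans; [|apply Rmax_r]; apply exp_mono; nra.
- eapply Rle_trans; [|apply Rmax_r]; apply exp_mono; nra.
- eapply Rle_trans; [|apply Rmax_l]; rewrite <- exp_0; apply exp_mono; nra.
Qed.

Lemma terminant_partial_is_CInt a p k n : off_cut a ->
  is_CInt (fun x => p * Cexp (p * Clog a) * osc_integrand a (p + 1) k x)%C 0 (INR n) (terminant_partial a p k n).
Proof. intros Ha; apply is_CInt_scal, is_CInt_osc; [easy|pose proof (pos_INR n); lra]. Qed.

(** The estimate |x + a| >= (x + |a|) cos(arg a / 2) reduces the integrand to that of the
    positive axis, where two integrations by parts leave a term of constant sign to be
    discarded. *)
Lemma terminant_partial_sector (a p : C) k n : a <> 0 -> Rabs (Carg a) < PI -> 0 < Re p ->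
  Cmod (terminant_partial a p k n) <=
    Cmod p / Re p * Rpower (/ cos (Carg a / 2)) (Re p + 1) * Rmax 1 (exp (- Im p * Carg a)).
Proof.
intros Ha Harg Hp; assert (Hc := off_cut_arg a Ha Harg).
assert (Hcos := cos_half_arg_pos a Harg); assert (HA := proj1 (Cmod_gt_0 a) Ha).
set (A := Cmod a) in *; set (q := Re p) in *; set (w := freq k); assert (Hw : 0 < w) by apply freq_pos.
set (c := cos (Carg a / 2)) in *; set (X := Rmax 1 (exp (- Im p * Carg a))).
assert (HX : 1 <= X) by apply Rmax_l.
set (S := Rpower (/ c) (q + 1)); assert (HS : 0 < S) by apply exp_pos.
set (r := fun m x => exp (q * ln A - m * ln (x + A))).
assert (Hr : forall m x, 0 <= x -> is_derive (r m) x (- m * r (m + 1) x)).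
{ intros m x Hx; unfold r; auto_derive; [lra|].
  replace (q * ln A - (m + 1) * ln (x + A)) with ((q * ln A - m * ln (x + A)) + - ln (x + A)) by ring.
  rewrite (exp_plus (q * ln A - m * ln (x + A))), (exp_Ropp (ln (x + A))), exp_ln by lra; unfold Rminus; field; lra. }
assert (Hrp : forall m x, 0 < r m x) by (intros; apply exp_pos).
set (G := Cmod p * X * S).
assert (HG : 0 <= G) by (unfold G; repeat apply Rmult_le_pos; [apply Cmod_ge_0|lra|lra]).
(* With e = r q / q, this is G times -e - e''/w^2 + sin(wx) e'/w + cos(wx) e''/w^2. *)
set (B := fun x => G * (- r q x / q - (q + 1) * r (q + 2) x / w ^ 2 - sin (w * x) / w * r (q + 1) x
   + cos (w * x) / w ^ 2 * ((q + 1) * r (q + 2) x))).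
set (dB := fun x => G * (osc k x * (r (q + 1) x + (q + 1) * (q + 2) / w ^ 2 * r (q + 3) x))).
apply Rle_trans with (B (INR n) - B 0).
- apply (is_CInt_bound _ _ _ _ B dB (pos_INR n) (terminant_partial_is_CInt a p k n Hc)).
  + intros x [Hx _]; unfold dB, osc_integrand.
    replace (p * Cexp (p * Clog a) * (osc k x * shifted_power a (p + 1) x))%C with
      (RtoC (osc k x) * (p * (Cexp (p * Clog a) * shifted_power a (p + 1) x)))%C by ring.
    assert (Hz : Im (p + 1) = Im p) by (destruct p; simpl; ring).
    pose proof (osc_bounds k x) as Ho.
    pose proof (shifted_power_ratio a p (p + 1) x Hc Hx Hz) as HR; fold A q X in HR.
    replace (Re (p + 1)) with (q + 1) in HR by (unfold q; destruct p; simpl; ring).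
    assert (HE : exp (q * ln A - (q + 1) * ln (Cmod (x + a))) <= S * r (q + 1) x).
    { unfold S, r, Rpower; rewrite <- exp_plus; apply exp_mono; rewrite ln_Rinv by easy.
      pose proof (Cmod_shift_ge a x Ha Harg Hx) as Hm; fold A c in Hm.
      apply ln_le in Hm; [|apply Rmult_lt_0_compat; lra]; rewrite ln_mult in Hm by lra; nra. }
    rewrite !(Cmod_mult (osc k x)), (Cmod_mult p), Cmod_R, Rabs_pos_eq by lra.
    apply Rle_trans with (osc k x * (Cmod p * (X * (S * r (q + 1) x)))).
    * apply Rmult_le_compat_l; [lra|]; apply Rmult_le_compat_l; [apply Cmod_ge_0|].
      eapply Rle_trans; [exact HR|]; apply Rmult_le_compat_l; lra.
    * replace (osc k x * (Cmod p * (X * (S * r (q + 1) x)))) with (G * (osc k x * r (q + 1) x)) by (unfold G; ring).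
      apply Rmult_le_compat_l; [easy|]; apply Rmult_le_compat_l; [lra|].
      assert (0 <= (q + 1) * (q + 2) / w ^ 2 * r (q + 3) x); [|lra].
      apply Rmult_le_pos; [|left; apply Hrp]; apply Rdiv_le_0_compat; [nra|now apply pow_lt].
  + intros x [Hx _]; unfold B, dB, osc; fold w.
    pose proof (Hr q x Hx) as D0; pose proof (Hr (q + 1) x Hx) as D1; pose proof (Hr (q + 2) x Hx) as D2.
    replace (q + 1 + 1) with (q + 2) in D1 by ring; replace (q + 2 + 1) with (q + 3) in D2 by ring.
    apply (is_derive_eq_R (fun x => G * (- r q x / q - (q + 1) * r (q + 2) x / w ^ 2 - sin (w * x) / w * r (q + 1) x
      + cos (w * x) / w ^ 2 * ((q + 1) * r (q + 2) x))) x
      (G * (- (- q * r (q + 1) x) / q - (q + 1) * (- (q + 2) * r (q + 3) x) / w ^ 2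
         - (cos (w * x) * r (q + 1) x + sin (w * x) / w * (- (q + 1) * r (q + 2) x))
         + (- sin (w * x) / w * ((q + 1) * r (q + 2) x) + cos (w * x) / w ^ 2 * ((q + 1) * (- (q + 2) * r (q + 3) x))))));
      [|field; lra].
    auto_derive.
    * repeat split; try (eexists; eassumption).
    * assert (U0 : Derive (fun x : R => r q x) x = - q * r (q + 1) x) by exact (is_derive_unique _ _ _ D0).
      assert (U1 : Derive (fun x : R => r (q + 1) x) x = - (q + 1) * r (q + 2) x) by exact (is_derive_unique _ _ _ D1).
      assert (U2 : Derive (fun x : R => r (q + 2) x) x = - (q + 2) * r (q + 3) x) by exact (is_derive_unique _ _ _ D2).
      rewrite U0, U1, U2; field; lra.
  + intros x [Hx _]; apply (ex_derive_continuous dB); unfold dB, osc.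
    pose proof (Hr (q + 1) x Hx) as D1; pose proof (Hr (q + 3) x Hx) as D3.
    auto_derive; repeat split; try (eexists; eassumption).
- assert (E0 : B 0 = - (G / q)).
  { unfold B; rewrite Rmult_0_r, sin_0, cos_0.
    assert (Er : r q 0 = 1).
    { unfold r; rewrite Rplus_0_l; replace (q * ln A - q * ln A) with 0 by ring; apply exp_0. }
    rewrite Er; field; lra. }
  assert (En : B (INR n) = - (G / q * r q (INR n))).
  { unfold B, w; destruct (freq_int k n) as [E1 E2]; rewrite E1, E2; fold w; field; lra. }
  rewrite E0, En; pose proof (Hrp q (INR n)).
  replace (Cmod p / q * S * X) with (G / q) by (unfold G; field; lra).
  assert (0 <= G / q) by (apply Rdiv_le_0_compat; lra); nra.
Qed.

Lemma shifted_power_0 (a p : C) : (Cexp (p * Clog a) * shifted_power a p 0)%C = 1.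
Proof.
unfold shifted_power; rewrite Cplus_0_l, <- Cexp_plus.
replace (p * Clog a + - (p * Clog a))%C with (RtoC 0) by ring; apply Cexp_0.
Qed.

Lemma beta_part_deriv q Y : is_derive (beta_part q) Y (beta_fun q Y).
Proof.
apply (is_derive_RInt (V:=R_NormedModule) (beta_fun q) (beta_part q) 0 Y).
- apply filter_forall; intros y; apply beta_part_spec.
- apply beta_fun_cont.
Qed.

(** The constant part of the kernel is integrated exactly. In the cosine part the cosine is
    bounded by 1 and |x + a|^2 >= x^2 + |a|^2. *)
Lemma terminant_partial_right (a p : C) k n : a <> 0 -> Rabs (Carg a) <= PI / 2 -> 0 < Re p ->
  Cmod (terminant_partial a p k n) <=
    1 + Cmod p / Re p * chi (Re p) * Rmax 1 (exp (- Im p * Carg a))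
      + Cmod (Cexp (p * Clog a) * shifted_power a p (INR n)).
Proof.
intros Ha Harg Hp; pose proof PI_RGT_0 as Hpi.
assert (Harg' : Rabs (Carg a) < PI) by lra; assert (Hc := off_cut_arg a Ha Harg').
assert (HA := proj1 (Cmod_gt_0 a) Ha).
set (A := Cmod a) in *; set (q := Re p) in *; set (X := Rmax 1 (exp (- Im p * Carg a))).
assert (HX : 1 <= X) by apply Rmax_l.
set (ap := Cexp (p * Clog a)).
assert (Hcos : 0 <= cos (Carg a)) by (apply Rabs_le_between in Harg; apply cos_ge_0; lra).
assert (HD : is_CInt (fun x => ap * (- p * shifted_power a (p + 1) x))%C 0 (INR n)
   (ap * shifted_power a p (INR n) - ap * shifted_power a p 0)%C).
{ apply (is_CInt_derive (fun x => ap * shifted_power a p x)%C); [apply pos_INR| |].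
  - intros t [Ht _]; apply Rderiv_scal, shifted_power_deriv; easy.
  - intros t [Ht _].
    exact (Rderiv_Ccont _ _ _ (Rderiv_scal ap _ _ _ (Rderiv_scal (- p)%C _ _ _ (shifted_power_deriv a (p + 1) t Hc Ht)))). }
assert (HI := is_CInt_plus _ _ _ _ _ _ (terminant_partial_is_CInt a p k n Hc) HD).
assert (Hb : Cmod (terminant_partial a p k n + (ap * shifted_power a p (INR n) - ap * shifted_power a p 0)) <=
   Cmod p * X * beta_part q (INR n / A) - Cmod p * X * beta_part q (0 / A)).
{ apply (is_CInt_bound _ _ _ _ (fun x => Cmod p * X * beta_part q (x / A))
    (fun x => Cmod p * X * (/ A * beta_fun q (x / A))) (pos_INR n) HI).
  - intros x [Hx _]; fold ap.
    replace (p * ap * osc_integrand a (p + 1) k x + ap * (- p * shifted_power a (p + 1) x))%C with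
      (RtoC (- cos (freq k * x)) * (p * (ap * shifted_power a (p + 1) x)))%C
      by (unfold osc_integrand, osc; rewrite RtoC_minus, RtoC_opp; ring).
    assert (Hz : Im (p + 1) = Im p) by (destruct p; simpl; ring).
    pose proof (shifted_power_ratio a p (p + 1) x Hc Hx Hz) as HR; fold ap A q X in HR.
    replace (Re (p + 1)) with (q + 1) in HR by (unfold q; destruct p; simpl; ring).
    rewrite (Cmod_mult (RtoC _)), (Cmod_mult p), Cmod_R.
    assert (H1 : Rabs (- cos (freq k * x)) <= 1) by (pose proof (COS_bound (freq k * x)); apply Rabs_le; lra).
    assert (HE : exp (q * ln A - (q + 1) * ln (Cmod (x + a))) <= / A * beta_fun q (x / A)).
    { unfold beta_fun; rewrite <- (exp_ln A) at 2 by easy; rewrite <- exp_Ropp, <- exp_plus; apply exp_mono.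
      assert (Hm : x ^ 2 + A ^ 2 <= Cmod (x + a) ^ 2).
      { rewrite Cmod2_shift by easy; fold A.
        assert (0 <= 2 * x * A * cos (Carg a)) by (repeat apply Rmult_le_pos; lra); lra. }
      assert (P1 : 0 < x ^ 2 + A ^ 2) by (pose proof (pow_lt A 2 HA); pose proof (pow2_ge_0 x); lra).
      apply ln_le in Hm; [|easy].
      replace (x ^ 2 + A ^ 2) with ((A * A) * (1 + (x / A) ^ 2)) in Hm by (field; lra).
      pose proof (one_plus_sqr_pos (x / A)) as P2.
      rewrite !ln_mult in Hm by (try apply Rmult_lt_0_compat; lra).
      assert (P3 : 0 < Cmod (x + a)) by (apply Cmod_gt_0, off_cut_neq_0, off_cut_shift; easy).
      replace (Cmod (x + a) ^ 2) with (Cmod (x + a) * Cmod (x + a)) in Hm by ring.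
      rewrite ln_mult in Hm by easy; nra. }
    rewrite <- (Rmult_1_l (Cmod p * X * (/ A * beta_fun q (x / A)))).
    apply Rmult_le_compat; [apply Rabs_pos|apply Rmult_le_pos; apply Cmod_ge_0|easy|].
    rewrite Rmult_assoc; apply Rmult_le_compat_l; [apply Cmod_ge_0|].
    eapply Rle_trans; [exact HR|]; apply Rmult_le_compat_l; lra.
  - intros x _.
    apply (is_derive_scal (fun x => beta_part q (x / A)) x (Cmod p * X)).
    apply (is_derive_comp (K:=R_AbsRing) (V:=R_NormedModule) (beta_part q) (fun x => x / A)); [apply beta_part_deriv|].
    auto_derive; [easy|real_eq; field; lra].
  - intros x _; apply (ex_derive_continuous (fun x => Cmod p * X * (/ A * beta_fun q (x / A)))).
    unfold beta_fun; pose proof (one_plus_sqr_pos (x / A)) as P; unfold Rdiv in P; auto_derive.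
    repeat split; simpl in P; lra. }
assert (H0 : beta_part q (0 / A) = 0).
{ unfold Rdiv; rewrite Rmult_0_l; exact (RInt_point (V:=R_CompleteNormedModule) 0 (beta_fun q)). }
assert (Hbeta : beta_part q (INR n / A) <= chi q / q).
{ eapply Rle_trans; [apply beta_part_le; [easy|apply Rdiv_le_0_compat; [apply pos_INR|easy]]|now apply beta_int_le_chi]. }
unfold ap in Hb; rewrite shifted_power_0 in Hb; fold ap in Hb; rewrite H0, Rmult_0_r, Rminus_0_r in Hb.
replace (terminant_partial a p k n) with
  ((terminant_partial a p k n + (ap * shifted_power a p (INR n) - 1)) + (1 - ap * shifted_power a p (INR n)))%C by ring.
eapply Rle_trans; [apply Cmod_triangle|].
assert (H1 : Cmod (1 - ap * shifted_power a p (INR n)) <= 1 + Cmod (ap * shifted_power a p (INR n))).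
{ unfold Cminus; eapply Rle_trans; [apply Cmod_triangle|]; rewrite Cmod_opp, Cmod_1; lra. }
assert (H2 : Cmod p * X * beta_part q (INR n / A) <= Cmod p * X * (chi q / q)).
{ apply Rmult_le_compat_l; [apply Rmult_le_pos; [apply Cmod_ge_0|lra]|easy]. }
replace (Cmod p / q * chi q * X) with (Cmod p * X * (chi q / q)) by (field; lra); lra.
Qed.

Lemma Cconv_bound_lim u l B (tau : nat -> R) : Cconv u l -> is_lim_seq tau 0 ->
  (forall n, Cmod (u n) <= B + tau n) -> Cmod l <= B.
Proof.
intros H Ht HB; apply le_epsilon; intros eps He.
apply is_lim_seq_spec in Ht; destruct (Ht (mkposreal (eps / 2) ltac:(lra))) as [N1 H1].
destruct (H (eps / 2) ltac:(lra)) as [N2 H2].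
specialize (H1 (N1 + N2)%nat ltac:(lia)); specialize (H2 (N1 + N2)%nat ltac:(lia)); specialize (HB (N1 + N2)%nat).
simpl in H1; rewrite Rminus_0_r in H1; apply Rabs_def2 in H1.
replace l with (u (N1 + N2)%nat - (u (N1 + N2)%nat - l))%C by ring; unfold Cminus at 1.
eapply Rle_trans; [apply Cmod_triangle|]; rewrite Cmod_opp; lra.
Qed.

(** The remainder is an average of terminants, with the weights 2 / (2 pi k)^(2N) whose sum
    is |B_2N| / (2N)!. *)
Theorem remainder_bound N (s a : C) L (tau : nat -> R) :
  (1 <= N)%nat -> s <> 1 -> 1 - 2 * INR N < Re s -> a <> 0 -> Rabs (Carg a) < PI ->
  is_lim_seq tau 0 ->
  (forall k n, Cmod (terminant_partial a (s + 2 * INR N - 1) k n) <= L + tau n) ->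
  Cmod (hurwitz_remainder N s a) <=
    Rabs (bernoulli (2 * N)) / INR (fact (2 * N)) * (Cmod (Cpochhammer s (2 * N - 1)) / Cmod a ^ (2 * N)) * L.
Proof.
intros HN Hs1 Hs Ha Harg Ht HL; assert (HA := proj1 (Cmod_gt_0 a) Ha).
set (p := (s + 2 * INR N - 1)%C) in *; set (ap := Cexp (p * Clog a)).
assert (Hz : 1 < Re (s + 2 * INR N)).
{ replace (Re (s + 2 * INR N)) with (Re s + 2 * INR N) by (destruct s; simpl; ring); lra. }
assert (HF := osc_total_spec N a (s + 2 * INR N) HN Ha Harg Hz).
set (F := osc_total N a (s + 2 * INR N)) in *.
assert (HpF : Cmod (p * ap * F) <= weight_sum N * L).
{ apply (Cconv_bound_lim (fun n => p * ap * osc_partial N a (s + 2 * INR N) n)%C _ _ (fun n => weight_sum N * tau n)).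
  - now apply Cconv_scal.
  - replace 0 with (weight_sum N * 0) by ring; now apply (is_lim_seq_scal_l _ _ 0).
  - intros n; unfold osc_partial; rewrite <- Csum_scal.
    rewrite (Csum_ext _ (fun k => weight N k * terminant_partial a p k n)%C).
    2:{ intros k _; unfold terminant_partial; fold ap; replace (p + 1)%C with (s + 2 * INR N)%C by (unfold p; ring); ring. }
    eapply Rle_trans; [apply Csum_weighted_bound; [intros; left; apply weight_pos|intros k _; apply HL]|].
    rewrite <- Rmult_plus_distr_l; apply Rmult_le_compat_r; [|now apply weight_partial_le].
    eapply Rle_trans; [apply Cmod_ge_0|apply (HL O n)]. }
rewrite hurwitz_remainder_osc, bernoulli_abs by easy; fold F.
assert (EP : Cpochhammer s (2 * N) = (Cpochhammer s (2 * N - 1) * p)%C).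
{ replace (2 * N)%nat with (S (2 * N - 1)) at 1 by lia; rewrite Cpochhammer_S; f_equal.
  unfold p; rewrite minus_INR, mult_INR by lia; simpl (INR 2); simpl (INR 1).
  rewrite RtoC_minus, RtoC_mult; replace (1 + 1) with 2 by ring; ring. }
assert (EA : (/ Cpower a (1 - s))%C = (ap / a ^ (2 * N))%C).
{ assert (E := Cpower_shift a s (2 * N) Ha).
  assert (Ep : (s + INR (2 * N) - 1)%C = p).
  { unfold p; rewrite mult_INR, RtoC_mult; simpl (INR 2); replace (1 + 1) with 2 by ring; ring. }
  rewrite Ep in E.
  assert (E2 := shifted_power_0 a p); fold ap in E2; rewrite E in E2.
  pose proof (Cpow_nz a (2 * N) Ha) as N1.
  assert (N2 : Cpower a (1 - s) <> 0) by apply Cexp_neq_0.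
  set (P := Cpower a (1 - s)) in *.
  transitivity ((ap * (P / a ^ (2 * N))) / P)%C; [rewrite E2; unfold Cdiv; ring|].
  field; split; assumption. }
unfold Cdiv at 1; rewrite EA, EP.
replace (((-1) ^ (N + 1))%R * (Cpochhammer s (2 * N - 1) * p) * F * (ap / a ^ (2 * N)))%C with
  (((-1) ^ (N + 1))%R * (Cpochhammer s (2 * N - 1) * (p * ap * F)) / a ^ (2 * N))%C by (unfold Cdiv; ring).
rewrite Cmod_div, !(Cmod_mult (RtoC _)), (Cmod_mult (Cpochhammer _ _)), Cmod_R, pow_1_abs, Rmult_1_l, Cmod_pow by now apply Cpow_nz.
replace (weight_sum N * (Cmod (Cpochhammer s (2 * N - 1)) / Cmod a ^ (2 * N)) * L) with
  (Cmod (Cpochhammer s (2 * N - 1)) * (weight_sum N * L) / Cmod a ^ (2 * N)) by (unfold Rdiv; ring).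
apply Rmult_le_compat_r; [left; apply Rinv_0_lt_compat, pow_lt, HA|].
apply Rmult_le_compat_l; [apply Cmod_ge_0|exact HpF].
Qed.

(** The rate at which the terminant is approached does not depend on the frequency. *)
Lemma terminant_partial_close (a p : C) : a <> 0 -> Rabs (Carg a) < PI -> 0 < Re p ->
  exists tau, is_lim_seq tau 0 /\ forall k n,
    Cmod (terminant_partial a p k n) <= Cmod (terminant p (Clog (2 * PI * a * RtoC (INR k + 1)))) + tau n.
Proof.
intros Ha Harg Hp; assert (Hc := off_cut_arg a Ha Harg).
assert (Hz : 1 < Re (p + 1)) by (rewrite re_plus; simpl; lra).
destruct (osc_integral_bound a (p + 1) Ha Harg Hz) as [K [HK [H1 _]]].
set (M := Cmod (p * Cexp (p * Clog a))).
assert (HM : 0 <= M) by apply Cmod_ge_0.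
exists (fun n => M * K * exp (- (Re (p + 1) - 1) * ln (1 + INR n))); split.
- replace 0 with (M * K * 0) by ring; apply (is_lim_seq_scal_l _ _ 0), power_tail_lim; lra.
- intros k n; assert (Hlim := terminant_osc_integral a p k Hc Hp).
  set (T := terminant p _) in *.
  apply le_epsilon; intros eps He; destruct (Hlim eps He) as [N HN].
  specialize (HN (N + n)%nat ltac:(lia)); specialize (H1 k n (N + n)%nat ltac:(lia)).
  replace (terminant_partial a p k n) with
    (T + (terminant_partial a p k (N + n) - T) + - (p * Cexp (p * Clog a) * (osc_integral a (p + 1) k (N + n) - osc_integral a (p + 1) k n)))%C
    by (unfold terminant_partial; ring).
  eapply Rle_trans; [apply Cmod_triangle|]; rewrite Cmod_opp, Cmod_mult; fold M.
  pose proof (Cmod_triangle T (terminant_partial a p k (N + n) - T)).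
  unfold terminant_partial in *.
  assert (M * Cmod (osc_integral a (p + 1) k (N + n) - osc_integral a (p + 1) k n) <=
    M * (K * exp (- (Re (p + 1) - 1) * ln (1 + INR n)))) by now apply Rmult_le_compat_l.
  lra.
Qed.

Theorem theorem1p2 (N : nat) (s a : C)
    (hN : (1 <= N)%nat) (hs1 : s <> 1) (hs : 1 - 2 * INR N < Re s) (ha : a <> 0) :
  let p : C := (s + 2 * INR N - 1)%C in
  let K : R :=
    Rabs (bernoulli (2 * N)) / INR (fact (2 * N))
    * (Cmod (Cpochhammer s (2 * N - 1)) / Cmod a ^ (2 * N)) in
  (Rabs (Carg a) < PI ->
     Rbar_le (Cmod (hurwitz_remainder N s a))
       (Rbar_mult K
          (Lub_Rbar (fun y : R => exists r : R,
             1 <= r /\ y = Cmod (terminant p (Clog (2 * PI * a * r)))))) /\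
     Cmod (hurwitz_remainder N s a) <=
       K * (Cmod p / (Re s + 2 * INR N - 1))
         * Rpower (/ cos (Carg a / 2)) (Re s + 2 * INR N)
         * Rmax 1 (exp (- Im s * Carg a))) /\
  (Rabs (Carg a) <= PI / 2 ->
     Cmod (hurwitz_remainder N s a) <=
       K * (1 + Cmod p / (Re s + 2 * INR N - 1)
                * chi (Re s + 2 * INR N - 1)
                * Rmax 1 (exp (- Im s * Carg a)))).
Proof.
intros p K.
assert (Ep : Re p = Re s + 2 * INR N - 1) by (unfold p; destruct s; simpl; ring).
assert (Ei : Im p = Im s) by (unfold p; destruct s; simpl; ring).
assert (Hp : 0 < Re p) by lra.
assert (HK : 0 <= K).
{ unfold K; rewrite bernoulli_abs by easy; apply Rmult_le_pos; [left; now apply weight_sum_pos|].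
  apply Rdiv_le_0_compat; [apply Cmod_ge_0|apply pow_lt, Cmod_gt_0, ha]. }
split; [intros harg; split|intros harg].
- set (P := fun y : R => _); destruct (Lub_Rbar_correct P) as [Hub _].
  destruct (terminant_partial_close a p ha harg Hp) as [tau [Htau Hclose]].
  assert (HP : forall k, P (Cmod (terminant p (Clog (2 * PI * a * RtoC (INR k + 1)))))).
  { intros k; exists (INR k + 1); split; [pose proof (pos_INR k); lra|easy]. }
  destruct (Lub_Rbar P) as [L| |].
  + apply (remainder_bound N s a L tau); try easy.
    intros k n; eapply Rle_trans; [apply Hclose|]; apply Rplus_le_compat_r; exact (Hub _ (HP k)).
  + destruct HK as [HK|HK].
    * rewrite (is_Rbar_mult_unique K p_infty p_infty); [easy|].
      apply is_Rbar_mult_sym, is_Rbar_mult_p_infty_pos; exact HK.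
    * rewrite <- HK, Rbar_mult_0_l.
      assert (H : Cmod (hurwitz_remainder N s a) <= K * (Cmod p / Re p * Rpower (/ cos (Carg a / 2)) (Re p + 1) * Rmax 1 (exp (- Im p * Carg a)))).
      { apply (remainder_bound N s a _ (fun _ => 0)); try easy; [apply is_lim_seq_const|].
        intros k n; rewrite Rplus_0_r; now apply terminant_partial_sector. }
      rewrite <- HK, Rmult_0_l in H; exact H.
  + destruct (Hub _ (HP O)).
- replace (K * (Cmod p / (Re s + 2 * INR N - 1)) * Rpower (/ cos (Carg a / 2)) (Re s + 2 * INR N) * Rmax 1 (exp (- Im s * Carg a)))
    with (K * (Cmod p / Re p * Rpower (/ cos (Carg a / 2)) (Re p + 1) * Rmax 1 (exp (- Im p * Carg a)))).
  + apply (remainder_bound N s a _ (fun _ => 0)); try easy; [apply is_lim_seq_const|].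
    intros k n; rewrite Rplus_0_r; now apply terminant_partial_sector.
  + rewrite Ei, Ep; replace (Re s + 2 * INR N - 1 + 1) with (Re s + 2 * INR N) by ring; ring.
- rewrite <- Ep, <- Ei; pose proof PI_RGT_0.
  apply (remainder_bound N s a _ (fun n => Cmod (Cexp (p * Clog a) * shifted_power a p (INR n)))); try easy; [lra| |].
  + assert (Hl := Cconv_scal (Cexp (p * Clog a)) _ _ (shifted_power_lim a p ha ltac:(lra) Hp)).
    apply is_lim_seq_spec; intros eps; destruct (Hl eps (cond_pos eps)) as [M HM]; exists M; intros n Hn.
    specialize (HM n Hn); rewrite Rminus_0_r, Rabs_pos_eq by apply Cmod_ge_0.
    now replace (Cexp (p * Clog a) * shifted_power a p (INR n) - Cexp (p * Clog a) * 0)%C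
      with (Cexp (p * Clog a) * shifted_power a p (INR n))%C in HM by ring.
  + intros k n; now apply terminant_partial_right.
Qed.
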